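(* The $\mathcal{L}$-theory $\Sigma_{\mathrm{QRC}}$ (of quasi-real closed fields with a non-trivial compatible valuation) admits quantifier elimination in the language $\mathcal{L}=\{+,\cdot,-,\preceq,\preceq_v,0,1\}$.
   Context: A quasi-ordering is a binary reflexive transitive total relation; write $x\asymp y$ for $x\preceq y\preceq x$ and $x\prec y$ for $x\preceq y$ and not $x\asymp y$. A quasi-ordered field is a field $K$ with a quasi-ordering $\preceq$ such that for all $x,y,z\in K$: (Q0) $x\asymp 0 \Rightarrow x=0$; (Q1) $x\preceq y \wedge 0\preceq z \Rightarrow xz\preceq yz$; (Q2) $x\preceq y \wedge z\not\asymp y \Rightarrow x+z\preceq y+z$. Every quasi-ordered field is either an ordered field or $\preceq$ is induced by a valuation $w$ via $a\preceq b\Leftrightarrow w(b)\le w(a)$ (the latter happens iff $0\prec -1$). A quasi-ordered field $(K,\preceq)$ is quasi-real closed iff every $x$ with $0\preceq x$ is a square in $K$ and every odd-degree polynomial over $K$ has a root in $K$ (equivalently: $(K,\preceq)$ is a real closed ordered field, or $\preceq$ is valuation-induced and $K$ is algebraically closed). The language is $\mathcal{L}=\{+,\cdot,-,\preceq,\preceq_v,0,1\}$ with $\preceq,\preceq_v$ binary relation symbols. $\Sigma_{\mathrm{QRC}}$ is the set of $\mathcal{L}$-sentences stating: (1) $(K,+,\cdot,-,0,1)$ is a field; (2) $(K,\preceq)$ is a quasi-real closed quasi-ordered field (axioms (Q0)–(Q2) plus the square-root and odd-degree-root conditions above); (3) $(K,\preceq_v)$ is a quasi-ordered field whose quasi-ordering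 is induced by a non-trivial valuation $v$ (i.e. $a\preceq_v b\Leftrightarrow v(b)\le v(a)$ with $v$ non-trivial); (4) $\phi_1\equiv 0\prec -1 \rightarrow (\forall x,y\colon (0\preceq x\preceq y) \leftrightarrow x\preceq_v y)$ and $\phi_2\equiv -1\prec 0\rightarrow (\forall x,y\colon 0\preceq x\preceq y\rightarrow x\preceq_v y)$. (Thus if $\preceq$ is valuation-induced it coincides with $\preceq_v$, and if $\preceq$ is an ordering then $v$ is compatible with it, i.e. its valuation ring is convex.)
   Formalization: The theory also contains the axioms that, if 0 ≺ −1, every non-constant polynomial has a root (K algebraically closed); in characteristic 2 this does not follow from square roots and odd-degree roots, and without it quantifier elimination fails. *)

(* Defs.v *)
From Stdlib Require List.
From mathcomp Require Import all_boot.
From mathcomp Require Import boolp.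
Set Implicit Arguments.
Unset Strict Implicit.
Unset Printing Implicit Defensive.

(******************************************************************************)
(* First-order logic (with equality) over L = {+, *, -, <=, <=_v, 0, 1}.      *)
(* Variables are named by natural numbers; "-" is the unary opposite.         *)
(******************************************************************************)

Inductive term : Type :=
  | TVar (n : nat)
  | TZero
  | TOne
  | TOpp (t : term)
  | TAdd (t u : term)
  | TMul (t u : term).

Inductive formula : Type :=
  | FEq (t u : term)
  | FLe (t u : term)
  | FLev (t u : term)
  | FNot (f : formula)
  | FAnd (f g : formula)
  | FOr (f g : formula)
  | FImp (f g : formula)
  | FEx (n : nat) (f : formula)
  | FAll (n : nat) (f : formula).

Definition FIff (f g : formula) : formula := FAnd (FImp f g) (FImp g f).

Fixpoint term_vars (t : term) : seq nat :=
  match t with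
  | TVar n => [:: n]
  | TZero | TOne => [::]
  | TOpp t => term_vars t
  | TAdd t u | TMul t u => term_vars t ++ term_vars u
  end.

Fixpoint free_vars (f : formula) : seq nat :=
  match f with
  | FEq t u | FLe t u | FLev t u => term_vars t ++ term_vars u
  | FNot f => free_vars f
  | FAnd f g | FOr f g | FImp f g => free_vars f ++ free_vars g
  | FEx n f | FAll n f => [seq k <- free_vars f | k != n]
  end.

Fixpoint quantifier_free (f : formula) : bool :=
  match f with
  | FEq _ _ | FLe _ _ | FLev _ _ => true
  | FNot f => quantifier_free f
  | FAnd f g | FOr f g | FImp f g => quantifier_free f && quantifier_free g
  | FEx _ _ | FAll _ _ => false
  end.

Record structure : Type := Structure {
  carrier :> Type;
  s_add : carrier -> carrier -> carrier;
  s_mul : carrier -> carrier -> carrier;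
  s_opp : carrier -> carrier;
  s_le : carrier -> carrier -> Prop;
  s_lev : carrier -> carrier -> Prop;
  s_zero : carrier;
  s_one : carrier }.

Arguments s_zero {s}.
Arguments s_one {s}.

Definition update (T : Type) (e : nat -> T) (n : nat) (a : T) : nat -> T :=
  fun k => if k == n then a else e k.

Fixpoint eval (M : structure) (e : nat -> M) (t : term) : M :=
  match t with
  | TVar n => e n
  | TZero => s_zero
  | TOne => s_one
  | TOpp t => s_opp (eval e t)
  | TAdd t u => s_add (eval e t) (eval e u)
  | TMul t u => s_mul (eval e t) (eval e u)
  end.

Fixpoint sat (M : structure) (e : nat -> M) (f : formula) : Prop :=
  match f with
  | FEq t u => eval e t = eval e u
  | FLe t u => s_le (eval e t) (eval e u)
  | FLev t u => s_lev (eval e t) (eval e u)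
  | FNot f => ~ sat e f
  | FAnd f g => sat e f /\ sat e g
  | FOr f g => sat e f \/ sat e g
  | FImp f g => sat e f -> sat e g
  | FEx n f => exists a : M, sat (update e n a) f
  | FAll n f => forall a : M, sat (update e n a) f
  end.

Definition theory : Type := formula -> Prop.

Definition is_model (T : theory) (M : structure) : Prop :=
  forall f, T f -> forall e : nat -> M, sat e f.

Definition entails (T : theory) (f : formula) : Prop :=
  forall M : structure, is_model T M -> forall e : nat -> M, sat e f.

Definition admits_QE (T : theory) : Prop :=
  forall f : formula, exists g : formula,
    [/\ quantifier_free g,
        {subset free_vars g <= free_vars f}
      & entails T (FIff f g)].

(******************************************************************************)
(* The axioms                                                                 *)
(******************************************************************************)

Declare Scope fol_scope.
Delimit Scope fol_scope with fol.
Bind Scope fol_scope with term.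
Bind Scope fol_scope with formula.
Local Open Scope fol_scope.

Local Notation "0" := TZero : fol_scope.
Local Notation "1" := TOne : fol_scope.
Local Notation "- t" := (TOpp t) : fol_scope.
Local Notation "t + u" := (TAdd t u) : fol_scope.
Local Notation "t * u" := (TMul t u) : fol_scope.
Local Notation "t == u" := (FEq t u) : fol_scope.
Local Notation "~ f" := (FNot f) : fol_scope.
Local Notation "f /\ g" := (FAnd f g) : fol_scope.
Local Notation "f \/ g" := (FOr f g) : fol_scope.
Local Notation "f -> g" := (FImp f g) : fol_scope.

Local Notation x := (TVar 0%N).
Local Notation y := (TVar 1%N).
Local Notation z := (TVar 2%N).
Local Notation "'all_x' f" := (FAll 0%N f) (at level 200) : fol_scope.
Local Notation "'all_xy' f" := (FAll 0%N (FAll 1%N f))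
  (at level 200) : fol_scope.
Local Notation "'all_xyz' f" := (FAll 0%N (FAll 1%N (FAll 2%N f)))
  (at level 200) : fol_scope.
Local Notation "'ex_x' f" := (FEx 0%N f) (at level 200) : fol_scope.
Local Notation "'ex_y' f" := (FEx 1%N f) (at level 200) : fol_scope.

Definition field_axioms : seq formula := [::
  all_xyz (x + (y + z) == (x + y) + z);
  all_xy (x + y == y + x);
  all_x (0 + x == x);
  all_x (- x + x == 0);
  all_xyz (x * (y * z) == (x * y) * z);
  all_xy (x * y == y * x);
  all_x (1 * x == x);
  all_xyz ((x + y) * z == x * z + y * z);
  ~ (1 == 0);
  all_x (~ (x == 0) -> ex_y (x * y == 1))].

(* R stands for one of the two relation symbols, i.e., FLe or FLev *)
Definition FAsymp (R : term -> term -> formula) (t u : term) : formula :=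
  R t u /\ R u t.

Definition FPrec (R : term -> term -> formula) (t u : term) : formula :=
  R t u /\ ~ FAsymp R t u.

Definition quasi_order_axioms (R : term -> term -> formula) : seq formula := [::
  all_x (R x x);
  all_xyz (R x y /\ R y z -> R x z);
  all_xy (R x y \/ R y x);
  all_x (FAsymp R x 0 -> x == 0);
  all_xyz (R x y /\ R 0 z -> R (x * z) (y * z));
  all_xyz (R x y /\ ~ FAsymp R z y -> R (x + z) (y + z))].

Definition square_root_axiom : formula :=
  all_x (FLe 0 x -> ex_y (x == y * y)).

Fixpoint FAlls (n : nat) (f : formula) : formula :=
  if n is k.+1 then FAlls k (FAll k f) else f.

Fixpoint TPow (t : term) (n : nat) : term :=
  if n is k.+1 then t * TPow t k else 1.

(* X_0 + X_1 t + ... + X_d t^d *)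
Fixpoint TPoly (d : nat) (t : term) : term :=
  if d is k.+1 then TPoly k t + TVar d * TPow t d else TVar 0%N.

(* every polynomial of degree exactly d has a root *)
Definition FRoot (d : nat) : formula :=
  FAlls d.+1 (~ (TVar d == 0) -> FEx d.+1 (TPoly d (TVar d.+1) == 0)).

Definition odd_root_axiom (n : nat) : formula := FRoot n.*2.+1.

(* If <= is valuation-induced (0 < -1), then K is algebraically closed. In    *)
(* characteristic 2 this does not follow from the existence of square roots   *)
(* and of roots of odd-degree polynomials: the fixed field of a 2-Sylow       *)
(* subgroup of the absolute Galois group of the perfect hull of F_2((t)),     *)
(* with its t-adic valuation, has both, but x^2 + x + 1 has no root there. So *)
(* without this axiom, the sentence saying that x^2 + x + 1 has a root would  *)
(* separate two models that agree on all quantifier-free sentences.           *)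
Definition alg_closed_axiom (n : nat) : formula :=
  FPrec FLe 0 (TOpp 1) -> FRoot n.+1.

(* <=_v is induced by a valuation v: v(0) = oo is the greatest value, and     *)
(* v(x + y) >= min(v x, v y). Given the quasi-ordered field axioms, v is then *)
(* the projection of K^* onto the quotient K^*/~, where ~ is the equivalence  *)
(* relation of <=_v (cf. SigmaQRC_models below). The last axiom says that v   *)
(* is not trivial.                                                            *)
Definition valuation_axioms : seq formula := [::
  all_x (FLev 0 x);
  all_xy (FLev x y -> FLev (x + y) y);
  ex_x (~ (x == 0) /\ ~ FAsymp FLev x 1)].

Definition phi1 : formula :=
  FPrec FLe 0 (TOpp 1) ->
  all_xy (FIff (FLe 0 x /\ FLe x y) (FLev x y)).

Definition phi2 : formula :=
  FPrec FLe (TOpp 1) 0 ->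
  all_xy (FLe 0 x /\ FLe x y -> FLev x y).

Inductive SigmaQRC : theory :=
  | Sigma_field f of List.In f field_axioms : SigmaQRC f
  | Sigma_le f of List.In f (quasi_order_axioms FLe) : SigmaQRC f
  | Sigma_square_root : SigmaQRC square_root_axiom
  | Sigma_odd_root n : SigmaQRC (odd_root_axiom n)
  | Sigma_alg_closed n : SigmaQRC (alg_closed_axiom n)
  | Sigma_lev f of List.In f (quasi_order_axioms FLev) : SigmaQRC f
  | Sigma_valuation f of List.In f valuation_axioms : SigmaQRC f
  | Sigma_phi1 : SigmaQRC phi1
  | Sigma_phi2 : SigmaQRC phi2.

Local Close Scope fol_scope.

(******************************************************************************)
(* The models of SigmaQRC, described without syntax                           *)
(******************************************************************************)

Record is_field (M : structure) : Prop := IsField {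
  _ : associative (@s_add M);
  _ : commutative (@s_add M);
  _ : left_id s_zero (@s_add M);
  _ : left_inverse s_zero (@s_opp M) (@s_add M);
  _ : associative (@s_mul M);
  _ : commutative (@s_mul M);
  _ : left_id s_one (@s_mul M);
  _ : left_distributive (@s_mul M) (@s_add M);
  _ : s_one <> s_zero :> M;
  _ : forall a : M, a <> s_zero -> exists b, s_mul a b = s_one }.

Definition asymp (T : Type) (R : T -> T -> Prop) (a b : T) : Prop :=
  R a b /\ R b a.

Definition prec (T : Type) (R : T -> T -> Prop) (a b : T) : Prop :=
  R a b /\ ~ asymp R a b.

Record is_quasi_order (M : structure) (R : M -> M -> Prop) : Prop :=
  IsQuasiOrder {
    _ : forall a, R a a;
    _ : forall a b c, R a b -> R b c -> R a c;
    _ : forall a b, R a b \/ R b a;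
    _ : forall a, asymp R a s_zero -> a = s_zero;
    _ : forall a b c, R a b -> R s_zero c -> R (s_mul a c) (s_mul b c);
    _ : forall a b c, R a b -> ~ asymp R c b ->
          R (s_add a c) (s_add b c) }.

Record ordered_group : Type := OrderedGroup {
  og :> Type;
  og_add : og -> og -> og;
  og_zero : og;
  og_opp : og -> og;
  og_le : og -> og -> Prop;
  og_addA : associative og_add;
  og_addC : commutative og_add;
  og_add0 : left_id og_zero og_add;
  og_addN : left_inverse og_zero og_opp og_add;
  og_refl : forall g, og_le g g;
  og_anti : forall g h, og_le g h -> og_le h g -> g = h;
  og_trans : forall g h k, og_le g h -> og_le h k -> og_le g k;
  og_total : forall g h, og_le g h \/ og_le h g;
  og_leD : forall g h k, og_le g h -> og_le (og_add g k) (og_add h k) }.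

(* The value oo is represented by None. *)
Definition val_le (G : ordered_group) (g h : option G) : Prop :=
  match g, h with
  | _, None => True
  | None, Some _ => False
  | Some g, Some h => og_le g h
  end.

Definition val_add (G : ordered_group) (g h : option G) : option G :=
  if g is Some g' then if h is Some h' then Some (og_add g' h') else None
  else None.

Record is_valuation (M : structure) (G : ordered_group) (v : M -> option G) :
    Prop := IsValuation {
  _ : forall a, v a = None <-> a = s_zero;
  _ : forall a b, v (s_mul a b) = val_add (v a) (v b);
  _ : forall a b, val_le (v a) (v (s_add a b)) \/
                  val_le (v b) (v (s_add a b)) }.

Definition nontrivial_valuation (M : structure) (G : ordered_group)
    (v : M -> option G) : Prop :=
  exists2 a, a <> s_zero & v a <> Some (og_zero G).

Definition induced_by (M : structure) (R : M -> M -> Prop) (G : ordered_group)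
    (v : M -> option G) : Prop :=
  forall a b, R a b <-> val_le (v b) (v a).

Fixpoint pow (M : structure) (a : M) (n : nat) : M :=
  if n is k.+1 then s_mul a (pow a k) else s_one.

Fixpoint poly_eval (M : structure) (c : nat -> M) (d : nat) (a : M) : M :=
  if d is k.+1 then s_add (poly_eval c k a) (s_mul (c d) (pow a d)) else c 0.

Definition has_roots (M : structure) (d : nat) : Prop :=
  forall c : nat -> M, c d <> s_zero -> exists a, poly_eval c d a = s_zero.

Record quasi_real_closed (M : structure) : Prop := QuasiRealClosed {
  _ : forall a : M, s_le s_zero a -> exists b, a = s_mul b b;
  _ : forall n, has_roots M n.*2.+1;
  _ : (exists (G : ordered_group) (v : M -> option G),
         is_valuation v /\ induced_by (@s_le M) v) ->
      forall n, has_roots M n.+1 }.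

Record QRC_model (M : structure) : Prop := QRCModel {
  _ : is_field M;
  _ : is_quasi_order (@s_le M);
  _ : quasi_real_closed M;
  _ : is_quasi_order (@s_lev M);
  _ : exists (G : ordered_group) (v : M -> option G),
        [/\ is_valuation v, nontrivial_valuation v & induced_by (@s_lev M) v];
  _ : prec (@s_le M) s_zero (s_opp s_one) ->
      forall a b : M, s_le s_zero a /\ s_le a b <-> s_lev a b;
  _ : prec (@s_le M) (s_opp s_one) s_zero ->
      forall a b : M, s_le s_zero a -> s_le a b -> s_lev a b }.

Lemma sat_FAlls (M : structure) n (f : formula) (e : nat -> M) :
  sat e (FAlls n f) <->
  forall c : nat -> M, sat (fun k => if k < n then c k else e k) f.
Proof.
elim: n f => [|n IHn] f /=; first by split=> // /(_ e).
have updE (c : nat -> M) a :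
    update (fun k => if k < n then c k else e k) n a =
    fun k => if k < n.+1 then update c n a k else e k.
  apply/funext=> k; rewrite /update (ltnS k) (leq_eqVlt k).
  by case: (eqVneq k n).
rewrite IHn /=; split=> [sf c|sf c a]; last by rewrite updE; apply: sf.
have := sf c (c n); rewrite updE; congr (sat _ f); apply/funext => k.
by rewrite /update; case: (eqVneq k n) => [->|].
Qed.

Lemma eval_TPoly (M : structure) d (t : term) (e : nat -> M) :
  eval e (TPoly d t) = poly_eval e d (eval e t).
Proof.
have evalP n : eval e (TPow t n) = pow (eval e t) n.
  by elim: n => //= n ->.
by elim: d => //= d ->; rewrite evalP.
Qed.

Lemma eq_poly_eval (M : structure) (c c' : nat -> M) d (a : M) :
  (forall k, k <= d -> c k = c' k) -> poly_eval c d a = poly_eval c' d a.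
Proof.
elim: d => [|d IHd] cc' /=; first exact: cc'.
by rewrite IHd ?cc' // => k kd; rewrite cc' // ltnW.
Qed.

Lemma sat_FRoot (M : structure) d (e : nat -> M) :
  sat e (FRoot d) <-> has_roots M d.
Proof.
have polyE (c : nat -> M) a :
    eval (update (fun k => if k < d.+1 then c k else e k) d.+1 a)
      (TPoly d (TVar d.+1)) = poly_eval c d a.
  rewrite eval_TPoly /= {2}/update eqxx; apply: eq_poly_eval => k kd.
  by rewrite /update ltnS kd ltn_eqF.
rewrite /FRoot sat_FAlls /has_roots; split=> root c /=.
  have /= := root c; rewrite leqnn => {}root /root[a].
  by rewrite polyE; exists a.
by rewrite leqnn => /root[a ca]; exists a; rewrite polyE.
Qed.

Lemma free_vars_FAlls n (f : formula) :
  free_vars (FAlls n f) = [seq k <- free_vars f | n <= k].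
Proof.
elim: n f => [|n IHn] f /=; first by rewrite filter_predT.
rewrite IHn /= -filter_predI; apply: eq_filter => k /=.
by rewrite ltn_neqAle eq_sym andbC.
Qed.

Lemma term_vars_TPoly d n (t : term) :
  d < n -> all (leq^~ n) (term_vars t) -> all (leq^~ n) (term_vars (TPoly d t)).
Proof.
move=> dn tn; have powP m : all (leq^~ n) (term_vars (TPow t m)).
  by elim: m => //= m; rewrite all_cat tn.
elim: d dn => [|d IHd] dn /=; first by [].
by rewrite all_cat IHd ?(ltnW dn) //= all_cat tn powP (ltnW dn).
Qed.

Lemma free_vars_FRoot d : free_vars (FRoot d) = [::].
Proof.
rewrite /FRoot free_vars_FAlls /= ltnn cats0.
have /allP bnd : all (leq^~ d.+1) (term_vars (TPoly d (TVar d.+1))).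
  by apply: term_vars_TPoly; rewrite /= ?leqnn.
apply/eqP; rewrite -(negbK (_ == _)) -has_filter; apply/hasPn => k.
by rewrite mem_filter -ltnNge => /andP[kd /bnd]; rewrite leq_eqVlt (negbTE kd).
Qed.

Lemma SigmaQRC_sentence (f : formula) : SigmaQRC f -> free_vars f = [::].
Proof.
have inP (fs : seq formula) : all (fun g => nilp (free_vars g)) fs ->
    forall g, List.In g fs -> free_vars g = [::].
  elim: fs => //= h fs IHfs /andP[/nilP h0 /IHfs{}IHfs] g [<- //|].
  exact: IHfs.
by case=> {f} [f|f||n|n|f|f||]; first [exact: inP | rewrite /= free_vars_FRoot
  | rewrite /odd_root_axiom free_vars_FRoot | idtac].
Qed.

Lemma field_mul0 (M : structure) (a : M) :
  is_field M -> s_mul s_zero a = s_zero.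
Proof.
case=> addA _ add0 addN _ _ _ mulDl _ _.
have idem : s_add (s_mul s_zero a) (s_mul s_zero a) = s_mul s_zero a.
  by rewrite -mulDl add0.
move: idem; set t := s_mul _ _ => idem.
by rewrite -[LHS]add0 -(addN t) -addA idem.
Qed.

Lemma quasi_order_valuation (M : structure) (R : M -> M -> Prop) :
    is_field M -> is_quasi_order R ->
    (forall a, R s_zero a) -> (forall a b, R a b -> R (s_add a b) b) ->
  exists (G : ordered_group) (v : M -> option G),
    is_valuation v /\ induced_by R v.
Proof.
move=> Mfield [Rxx Rtrans Rtotal R0 RM _] Rz RD.
have mul0 a : s_mul s_zero a = s_zero :> M := field_mul0 a Mfield.
have [addC mulA mulC mul1] : [/\ commutative (@s_add M),
  associative (@s_mul M), commutative (@s_mul M) & left_id s_one (@s_mul M)].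
  by case: Mfield.
have one_neq0 : s_one <> s_zero :> M by case: Mfield.
have mulV (a : M) : a <> s_zero -> exists b, s_mul a b = s_one.
  by case: Mfield => _ _ _ _ _ _ _ _ _; apply.
have mul_neq0 (a b : M) : a <> s_zero -> b <> s_zero -> s_mul a b <> s_zero.
  move=> /mulV[a' aa'] b0 ab0; apply: b0.
  by rewrite -(mul1 b) -aa' (mulC a) -mulA ab0 mulC mul0.
pose ch (P : M -> Prop) : M :=
  if pselect (exists x, P x) is left h then sval (cid h) else s_zero.
pose rep a := ch (asymp R a).
have repP a : asymp R a (rep a).
  rewrite /rep /ch; case: pselect => [h|[]]; first by case: (cid h).
  by exists a; split.
have asymp_sym a b : asymp R a b -> asymp R b a by case; split.
have asymp_trans a b c : asymp R a b -> asymp R b c -> asymp R a c.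
  move=> [ab ba] [bc cb].
  by split; [exact: (Rtrans _ _ _ ab bc) | exact: (Rtrans _ _ _ cb ba)].
have rep_eq a b : asymp R a b -> rep a = rep b.
  move=> ab; congr ch; apply/funext => c; apply/propext; split.
    by apply: asymp_trans; apply: asymp_sym.
  exact: asymp_trans.
have rep_neq0 a : a <> s_zero -> rep a <> s_zero.
  by move=> a0 ra0; apply: a0; apply: R0; rewrite -ra0; apply: repP.
pose G := {a : M | a <> s_zero /\ rep a = a}.
have mkP a : a <> s_zero -> rep a <> s_zero /\ rep (rep a) = rep a.
  by move=> a0; split; [apply: rep_neq0|rewrite -(rep_eq _ _ (repP a))].
pose mk a (a0 : a <> s_zero) : G := exist _ (rep a) (mkP a a0).
have G_eq (g h : G) : asymp R (sval g) (sval h) -> g = h.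
  move: g h => [g gP] [h hP] /= gh; apply: eq_exist.
  by rewrite -(proj2 gP) -(proj2 hP); apply: rep_eq.
have asympM a b c d : asymp R a b -> asymp R c d ->
    asymp R (s_mul a c) (s_mul b d).
  move=> [ab ba] [cd dc]; apply: (@asymp_trans _ (s_mul b c)).
    by split; apply: RM.
  by rewrite !(mulC b); split; apply: RM.
have asymp_refl a : asymp R a a by [].
pose Gadd (g h : G) : G :=
  mk _ (mul_neq0 _ _ (proj1 (svalP g)) (proj1 (svalP h))).
pose inv a (a0 : a <> s_zero) : M := sval (cid (mulV a a0)).
have invP a (a0 : a <> s_zero) : s_mul a (inv a a0) = s_one.
  by rewrite /inv; case: (cid _).
have inv_neq0 a (a0 : a <> s_zero) : inv a a0 <> s_zero.
  by move=> i0; apply: one_neq0; rewrite -(invP a a0) i0 mulC mul0.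
pose Gopp (g : G) : G := mk _ (inv_neq0 _ (proj1 (svalP g))).
pose Gle (g h : G) := R (sval h) (sval g).
have rs a : asymp R (rep a) a by apply: asymp_sym.
have GaddA : associative Gadd.
  move=> g h k; apply: G_eq => /=.
  apply: (asymp_trans _ _ _ (rs _)); apply: asymp_sym.
  apply: (asymp_trans _ _ _ (rs _)).
  apply: (@asymp_trans _ (s_mul (s_mul (sval g) (sval h)) (sval k))).
    exact: asympM.
  by rewrite -mulA; apply: asympM.
have GaddC : commutative Gadd.
  by move=> g h; apply: G_eq; rewrite /= mulC.
have Gadd0 : left_id (mk _ one_neq0) Gadd.
  move=> g; apply: G_eq => /=; apply: (asymp_trans _ _ _ (rs _)).
  by rewrite -[X in asymp R _ X]mul1; apply: asympM.
have GaddN : left_inverse (mk _ one_neq0) Gopp Gadd.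
  move=> g; apply: G_eq => /=; apply: (asymp_trans _ _ _ (rs _)).
  apply: (@asymp_trans _ s_one) => //.
  by rewrite -(invP _ (proj1 (svalP g))) mulC; apply: asympM.
have Gle_refl g : Gle g g by [].
have Gle_anti g h : Gle g h -> Gle h g -> g = h.
  by move=> gh hg; apply: G_eq; split.
have Gle_trans g h k : Gle g h -> Gle h k -> Gle g k.
  by move=> gh hk; exact: (Rtrans _ _ _ hk gh).
have Gle_total g h : Gle g h \/ Gle h g by apply: Rtotal.
have GleD g h k : Gle g h -> Gle (Gadd g k) (Gadd h k).
  move=> gh; rewrite /Gle /=.
  apply: (Rtrans _ _ _ (proj1 (rs _)));
      apply: (Rtrans _ _ _ _ (proj1 (repP _))).
  exact: RM.
exists (OrderedGroup GaddA GaddC Gadd0 GaddN Gle_refl Gle_anti Gle_trans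
  Gle_total GleD).
pose v a : option G := if pselect (a = s_zero) is right a0 then Some (mk a a0)
  else None.
have v0 : v s_zero = None by rewrite /v; case: pselect.
have vE a (a0 : a <> s_zero) : v a = Some (mk a a0).
  by rewrite /v; case: pselect => // a0'; congr Some; apply: G_eq.
have vle : @induced_by M R (OrderedGroup GaddA GaddC Gadd0 GaddN Gle_refl
    Gle_anti Gle_trans Gle_total GleD) v.
  move=> a b; have [->|a0] := pselect (a = s_zero).
    by rewrite v0; split=> // _; case: (v b).
  rewrite (vE _ a0); have [->|b0] := pselect (b = s_zero).
    by rewrite v0; split=> // a_le; apply: a0; apply: R0.
  rewrite (vE _ b0) /= /Gle /=; split=> ab.
    by apply: (Rtrans _ _ _ (proj1 (rs _)));
      apply: (Rtrans _ _ _ _ (proj1 (repP _))).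
  by apply: (Rtrans _ _ _ (proj1 (repP _)));
      apply: (Rtrans _ _ _ _ (proj1 (rs _))).
exists v; split=> //; split.
- move=> a; split=> [|->//]; have [//|a0] := pselect (a = s_zero).
  by rewrite (vE _ a0).
- move=> a b; have [->|a0] := pselect (a = s_zero); first by rewrite mul0 v0.
  have [->|b0] := pselect (b = s_zero).
    by rewrite mulC mul0 v0; case: (v a).
  rewrite (vE _ a0) (vE _ b0) (vE _ (mul_neq0 _ _ a0 b0)) /=; congr Some.
  apply: G_eq => /=; apply: (asymp_trans _ _ _ (rs _)).
  by apply: asymp_sym; apply: (asymp_trans _ _ _ (rs _)); apply: asympM.
- move=> a b; have [ab|ba] := Rtotal a b; [right|left]; apply/vle.
    exact: RD.
  by rewrite addC; apply: RD.
Qed.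

Lemma valuation_quasi_order (M : structure) (R : M -> M -> Prop)
    (G : ordered_group) (v : M -> option G) :
    is_field M -> is_valuation v -> induced_by R v ->
  [/\ forall a, R s_zero a, forall a b, R a b -> R (s_add a b) b
    & forall a, asymp R a s_one <-> v a = Some (og_zero G)].
Proof.
move=> Mfield [v0 vM vD] Rv; have [addC mul1 one_neq0] :
    [/\ commutative (@s_add M), left_id s_one (@s_mul M)
      & s_one <> s_zero :> M] by case: Mfield.
have vle_refl g : val_le (G := G) g g by case: g => //= g; apply: og_refl.
split.
- by move=> a; apply/Rv; rewrite (proj2 (v0 s_zero)) //; case: (v a).
- move=> a b /Rv ba; apply/Rv; case: (vD a b) => // ab.
  case: (v (s_add a b)) (v a) (v b) ab ba => [g|] [h|] [k|] //=.
  by move=> hg kh; apply: og_trans hg.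
have v1 : v s_one = Some (og_zero G).
  have := vM s_one s_one; rewrite mul1.
  case: (v s_one) (proj1 (v0 s_one)) => [g _ /= [gg]|/(_ erefl)//].
  by congr Some; rewrite -[LHS](og_add0) -(og_addN g) -og_addA -gg.
move=> a; split=> [[/Rv + /Rv]|va]; last by split; apply/Rv; rewrite va v1.
rewrite v1; case: (v a) => //= g ge le; congr Some; exact: og_anti.
Qed.

Theorem SigmaQRC_models (M : structure) : is_model SigmaQRC M <-> QRC_model M.
Proof.
split=> [MS|].
  pose e (_ : nat) : M := s_zero.
  have ax f : SigmaQRC f -> sat e f by move=> Sf; apply: MS.
  have inax (fs : seq formula) : (forall f, List.In f fs -> SigmaQRC f) ->
      foldr (fun f => and (sat e f)) True fs.
    elim: fs => //= f fs IH fsS; split; first by apply: ax; apply: fsS; left.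
    by apply: IH => g gfs; apply: fsS; right.
  have Mfield : is_field M.
    have := inax _ Sigma_field; rewrite /= /update /=.
    by case=> ? [? [? [? [? [? [? [? [? [? _]]]]]]]]]; split.
  have Mle : is_quasi_order (@s_le M).
    have := inax _ Sigma_le; rewrite /= /update /=.
    case=> A [B [C [D [E [F _]]]]]; split=> //.
    - by move=> a b c ab bc; apply: (B a b c).
    - by move=> a b c ab bc; apply: (E a b c).
    - by move=> a b c ab bc; apply: (F a b c).
  have Mlev : is_quasi_order (@s_lev M).
    have := inax _ Sigma_lev; rewrite /= /update /=.
    case=> A [B [C [D [E [F _]]]]]; split=> //.
    - by move=> a b c ab bc; apply: (B a b c).
    - by move=> a b c ab bc; apply: (E a b c).
    - by move=> a b c ab bc; apply: (F a b c).
  have := ax _ Sigma_phi2; have := ax _ Sigma_phi1.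
  rewrite /= /update /= => M1 M2.
  split=> //.
  - split.
    + by have := ax _ Sigma_square_root.
    + by move=> n; apply/(sat_FRoot _ e); apply: ax; apply: Sigma_odd_root.
    + move=> [G [v [vv Rv]]] n; apply/(sat_FRoot _ e).
      have [le0 _ _] := valuation_quasi_order Mfield vv Rv.
      apply: (ax _ (Sigma_alg_closed n)) => /=; split=> // N1.
      have {}N1 : s_opp s_one = s_zero :> M.
        by case: Mle => _ _ _ + _ _; apply; case: N1.
      case: Mfield => _ _ add0 addN _ _ _ _ + _; apply.
      by have := addN s_one; rewrite N1 add0.
  - have := inax _ Sigma_valuation; rewrite /= /update /=.
    case=> [le0 [leD [[a [a0 a1]] _]]].
    have [G [v [vv Rv]]] := quasi_order_valuation Mfield Mlev le0 leD.
    exists G, v; split=> //; exists a => // va; apply: a1.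
    by have [_ _ v1] := valuation_quasi_order Mfield vv Rv; apply/v1.
  - by move=> N1 a b a0 ab; apply: M2.
case=> Mfield Mle [Msq Modd Mac] Mlev [G [v [vv [a a0 a1] Rv]]] M1 M2.
have [lev0 levD lev1] := valuation_quasi_order Mfield vv Rv.
have le_val : prec (@s_le M) s_zero (s_opp s_one) ->
    exists (G : ordered_group) (v : M -> option G),
      is_valuation v /\ induced_by (@s_le M) v.
  move=> /M1 {}M1; exists G, v; split=> // c d; rewrite -(Rv c d) -M1.
  split=> [cd|[]//]; split=> //.
  by have [] := proj2 (M1 s_zero c) (lev0 c).
move=> f [] {f}.
- move=> f + e; case: Mfield => ? ? ? ? ? ? ? ? ? ?.
  by rewrite /=; intuition subst.
- move=> f + e; case: Mle => A B C D E F.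
  rewrite /= => -[|[|[|[|[|[|[]]]]]]] <- /=; rewrite /update /= => //.
  + by move=> b c d [bc cd]; apply: (B b c d).
  + by move=> b c d [bc cd]; apply: E.
  + by move=> b c d [bc cd]; apply: F.
- by move=> e /= b b0; apply: Msq.
- by move=> n e; apply: (proj2 (sat_FRoot n.*2.+1 e)); apply: Modd.
- move=> n e N1; apply: (proj2 (sat_FRoot n.+1 e)); apply: Mac.
  exact: (le_val N1).
- move=> f + e; case: Mlev => A B C D E F.
  rewrite /= => -[|[|[|[|[|[|[]]]]]]] <- /=; rewrite /update /= => //.
  + by move=> b c d [bc cd]; apply: (B b c d).
  + by move=> b c d [bc cd]; apply: E.
  + by move=> b c d [bc cd]; apply: F.
- move=> f + e; rewrite /= => -[|[|[]]]// <- /=; rewrite /update /=.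
  + exact: lev0.
  + exact: levD.
  + by exists a; split=> //; move/lev1.
- by move=> e /= N1 b c; have := M1 N1 b c; rewrite /update /=; tauto.
- by move=> e /= N1 b c [b0 bc]; apply: M2.
Qed.

(* Main.v *)
(* In a model, either 0 < -1, and both relations are the relation of one
   non-trivial valuation on an algebraically closed field, or -1 < 0, and the
   model is a real closed field with a non-trivial convex valuation.

   By an ultraproduct argument it suffices that whenever two models M, N contain
   isomorphic substructures generated by finitely many elements, an existential
   formula in one variable over the substructure that holds in M holds in N.
   Extend the isomorphism to a maximal one, between subfields identified with a
   field F. Then F is relatively algebraically closed in M, because an algebraic
   element r of M has a counterpart in N:
   - in the algebraically closed case, for a polynomial g over F the number of
     roots c of the minimal polynomial of r with |g(c)| <= 1 is read off the
     Newton polygon of the product of the X - g(c), whose coefficients lie in F;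
     finitely many such conditions merge into one, so each pattern of conditions
     is realised equally often in M and in N;
   - in the real closed case, Tarski queries count the sign patterns in the same
     way, and the signs determine the valuation, because it is convex.
   If the existential formula is witnessed by b outside F, split the polynomials
   over F that occur in it. The norm of b - c for the relevant c in F is then
   max(|b - c0|, |c0 - c|), where c0 is nearest to b, so the formula becomes a
   finite set of comparisons |A s^n| <= |B s^m| for s = b - c0, i.e., a cut in a
   divisible ordered group, which has a realisation in the non-trivially valued
   field N. *)

From HB Require Import structures.
From mathcomp Require Import all_boot all_order all_fingroup all_algebra all_field.
From mathcomp Require Import boolp classical_sets filter.
From mathcomp Require Import mpoly polyrcf qe_rcf_th ring zify.
Require Import Defs.
Set Implicit Arguments.
Unset Strict Implicit.
Unset Printing Implicit Defensive.
Import GRing.Theory Num.Theory Order.TTheory.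

(** * Quantifier elimination from ultraproducts *)

(** The two extension steps ask for different things. An algebraic element must get a counterpart
    matching it on all polynomials at once, since only a true extension contradicts maximality. No
    saturation or Galois theory is needed for this: the minimal polynomial has finitely many roots
    in the target, and if each of them failed one condition, these finitely many conditions would
    form a pattern counted differently in the two fields. A transcendental element only has to match
    on the polynomials of one formula, so the target need not be saturated; its valuation must be
    non-trivial only because a cut may be unbounded on one side.

    Everything transferred is computed over F, which has no order or valuation of its own, only two
    embeddings inducing the same relations. Symmetric functions of roots and signed remainders are
    therefore built over F once, for both fields. To merge |x| <= 1 and |y| <= 1 into one polynomial
    condition, the sum of the x^(d-b) y^b is used: its terms may cancel in the residue field, and d
    is chosen to prevent this. *)

Lemma eq_sval_cid (T : Type) (P Q : T -> Prop) (exP : exists x, P x)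
    (exQ : exists x, Q x) : P = Q -> sval (cid exP) = sval (cid exQ).
Proof. by move=> PQ; subst Q; rewrite (Prop_irrelevance exP exQ). Qed.

Lemma sat_free_vars (M : structure) (e e' : nat -> M) f :
  {in free_vars f, e =1 e'} -> sat e f <-> sat e' f.
Proof.
have evE (e1 e2 : nat -> M) t :
    {in term_vars t, e1 =1 e2} -> eval e1 t = eval e2 t.
  elim: t => [n|||t IHt|t IHt u IHu|t IHt u IHu] //= e12.
  - by apply: e12; rewrite inE.
  - by rewrite IHt.
  - by rewrite IHt ?IHu // => n nu; apply: e12; rewrite mem_cat nu ?orbT.
  - by rewrite IHt ?IHu // => n nu; apply: e12; rewrite mem_cat nu ?orbT.
have updE n g (e1 e2 : nat -> M) a :
    {in [seq k <- free_vars g | k != n], e1 =1 e2} ->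
    {in free_vars g, update e1 n a =1 update e2 n a}.
  move=> e12 k kg; rewrite /update; case: eqVneq => // kn.
  by apply: e12; rewrite mem_filter kn.
elim: f e e' => [t u|t u|t u|f IHf|f IHf g IHg|f IHf g IHg|f IHf g IHg|n f IHf|n f IHf] e e' /= ee'.
1-3: by rewrite !(evE e e') // => n nu; apply: ee'; rewrite mem_cat nu ?orbT.
- by rewrite (IHf e e').
1-3: by rewrite (IHf e e') ?(IHg e e') // => n nu; apply: ee';
  rewrite mem_cat nu ?orbT.
1,2: have fE a := IHf _ _ (updE n f e e' a ee').
- by split=> -[a /fE]; exists a.
- by split=> fa a; apply/fE.
Qed.

(** * Ultraproducts of structures *)

Section Ultraproduct.
Local Open Scope classical_set_scope.
Variables (I : Type) (U : set_system I) (M : I -> structure).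
Hypothesis U_ultra : UltraFilter U.

Let U_filter : Filter U. Proof. exact: filter_filter. Qed.

Let ultraN (A : set I) : U (~` A) <-> ~ U A.
Proof.
split=> [UN UA|UA]; last by have [] := in_ultra_setVsetC A U_ultra.
by have /filter_ex[i []] : U (~` A `&` A) by apply: filterI.
Qed.

Definition prod_eq (f g : forall i, M i) : Prop := U [set i | f i = g i].

Let prod_eq_refl f : prod_eq f f.
Proof. by apply: filterS filterT => i _. Qed.

Let prod_eq_sym f g : prod_eq f g -> prod_eq g f.
Proof. by apply: filterS => i /=. Qed.

Let prod_eq_trans f g h : prod_eq f g -> prod_eq g h -> prod_eq f h.
Proof. by apply: filterS2 => i /= ->. Qed.

(** The quotient by [prod_eq] is encoded by canonical representatives, because [sat] reads [FEq] as
    Leibniz equality. By [eq_sval_cid] the choice depends only on the class. *)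
Definition prod_repr (f : forall i, M i) : forall i, M i :=
  sval (cid (ex_intro (prod_eq f) f (prod_eq_refl f))).

Let prod_reprP f : prod_eq f (prod_repr f).
Proof. by rewrite /prod_repr; case: cid. Qed.

Let eq_prod_repr f g : prod_eq f g -> prod_repr f = prod_repr g.
Proof.
move=> fg; apply/eq_sval_cid/funext => h; apply/propext.
by split; apply: prod_eq_trans => //; apply: prod_eq_sym.
Qed.

Definition ultraproduct_carrier := {f : forall i, M i | prod_repr f = f}.

Lemma prod_repr_idem f : prod_repr (prod_repr f) = prod_repr f.
Proof. by apply: eq_prod_repr; apply: prod_eq_sym. Qed.

Definition to_ultraproduct (f : forall i, M i) : ultraproduct_carrier :=
  exist _ (prod_repr f) (prod_repr_idem f).

Definition ultraproduct : structure := @Structure ultraproduct_carrier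
  (fun x y => to_ultraproduct (fun i => s_add (sval x i) (sval y i)))
  (fun x y => to_ultraproduct (fun i => s_mul (sval x i) (sval y i)))
  (fun x => to_ultraproduct (fun i => s_opp (sval x i)))
  (fun x y => U [set i | s_le (sval x i) (sval y i)])
  (fun x y => U [set i | s_lev (sval x i) (sval y i)])
  (to_ultraproduct (fun i => s_zero))
  (to_ultraproduct (fun i => s_one)).

Definition component (e : nat -> ultraproduct) (i : I) : nat -> M i :=
  fun k => sval (e k) i.

Let ultraproduct_eqP (x y : ultraproduct) : x = y <-> prod_eq (sval x) (sval y).
Proof.
split=> [->//|]; case: x y => [f fE] [g gE] /= fg; apply: eq_exist.
by rewrite -fE -gE; apply: eq_prod_repr.
Qed.

Lemma eval_ultraproduct (e : nat -> ultraproduct) t :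
  U [set i | sval (eval e t) i = eval (component e i) t].
Proof.
have reprS (f g : forall i, M i) : U [set i | f i = g i] ->
    U [set i | prod_repr f i = g i].
  by move=> fg; apply: prod_eq_trans fg; apply: prod_eq_sym.
elim: t => [n|||t IHt|t IHt u IHu|t IHt u IHu] /=.
- by apply: filterS filterT.
- by apply: reprS; apply: filterS filterT => i.
- by apply: reprS; apply: filterS filterT => i.
- by apply: reprS; apply: filterS IHt => i /= ->.
- by apply: reprS; apply: filterS2 IHt IHu => i /= -> ->.
- by apply: reprS; apply: filterS2 IHt IHu => i /= -> ->.
Qed.

Theorem los (e : nat -> ultraproduct) f :
  sat e f <-> U [set i | sat (component e i) f].
Proof.
have UT : U setT by exact: filterT.
have compU e' n (a : ultraproduct) i : component (update e' n a) i =
    update (component e' i) n (sval a i).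
  by apply/funext => k; rewrite /component /update; case: (k == n).
have exP (e' : nat -> ultraproduct) n (P : forall i, (nat -> M i) -> Prop) :
    (exists a, U [set i | P i (component (update e' n a) i)]) <->
    U [set i | exists a, P i (update (component e' i) n a)].
  split=> [[a]|UP]; first by apply: filterS => i /=; rewrite compU; exists (sval a i).
  (* Witnesses are chosen componentwise; the default [s_zero] occurs only outside a set of [U]. *)
  pose w i := if pselect (exists a, P i (update (component e' i) n a)) is left h
    then sval (cid h) else s_zero.
  exists (to_ultraproduct w); have := prod_reprP w; rewrite /prod_eq => wE.
  apply: filterS2 wE UP => i /=; rewrite compU /= => <-; rewrite /w.
  by case: pselect => // h _; case: cid.
have atom (e' : nat -> ultraproduct) (R : forall i, M i -> M i -> Prop) t u :
    U [set i | R i (sval (eval e' t) i) (sval (eval e' u) i)] <->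
    U [set i | R i (eval (component e' i) t) (eval (component e' i) u)].
  have te := eval_ultraproduct e' t; have ue := eval_ultraproduct e' u.
  by split=> H; move: te ue H; apply: filterS3 => i /= -> ->.
elim: f e => [t u|t u|t u|f IHf|f IHf g IHg|f IHf g IHg|f IHf g IHg|n f IHf|n f IHf] e.
- by rewrite /= ultraproduct_eqP; apply: (atom _ (fun i => eq)).
- exact: (atom _ (fun i => @s_le (M i))).
- exact: (atom _ (fun i => @s_lev (M i))).
- by rewrite /= IHf // -ultraN.
- rewrite /= IHf // IHg //; split=> [[]|]; first exact: filterI.
  by move=> fg; split; apply: filterS fg => i [].
- rewrite /= IHf // IHg //; split=> [[Uf|Ug]|fg].
    by apply: filterS Uf => i fi; left.
    by apply: filterS Ug => i gi; right.
  have [Uf|/ultraN Uf] := pselect (U [set i | sat (component e i) f]); first by left.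
  by right; apply: filterS2 fg Uf => i /= [].
- rewrite /= IHf // IHg //; split=> [fg|fg Uf]; last first.
    by apply: filterS2 fg Uf => i /=; apply.
  have [/fg|/ultraN Uf] := pselect (U [set i | sat (component e i) f]).
    by apply: filterS => i gi _.
  by apply: filterS Uf => i /= nf /nf.
- rewrite /= -(exP e n (fun i e' => sat e' f)).
  by split=> -[a /IHf]; exists a.
- have -> : [set i | sat (component e i) (FAll n f)] =
      ~` [set i | exists a, ~ sat (update (component e i) n a) f].
    apply/funext => i; apply/propext; split=> /= [fi [a]//|fi a].
    by apply: contrapT => na; apply: fi; exists a.
  rewrite ultraN -(exP e n (fun i e' => ~ sat e' f)).
  have UN a : U [set i | ~ sat (component (update e n a) i) f] <->
      ~ sat (update e n a) f by rewrite IHf; apply: ultraN.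
  split=> /= [fe [a /UN]|fe a]; first by apply.
  by apply: contrapT => /UN na; apply: fe; exists a.
Qed.

(** The representative of the class of [e k] equals [e k] only on a set of [U] depending on [k]; a
    formula has finitely many free variables, so finitely many such sets are intersected. *)
Corollary los_family (e : nat -> forall i, M i) f :
  sat (fun k => to_ultraproduct (e k) : ultraproduct) f <-> U [set i | sat (e^~ i) f].
Proof.
have eqU : U [set i | {in free_vars f,
    component (fun k => to_ultraproduct (e k) : ultraproduct) i =1 e^~ i}].
  elim: (free_vars f) => [|k ks IHks].
    by apply: filterS filterT => i _ k; rewrite in_nil.
  have := prod_eq_sym (prod_reprP (e k)); rewrite /prod_eq => kE.
  apply: filterS2 kE IHks => i /= ki ksi l.
  by rewrite inE => /orP[/eqP->|/ksi].
rewrite los; split=> H; move: eqU H; apply: filterS2 => i /= /sat_free_vars ->//.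
Qed.
End Ultraproduct.

(** * Elimination of one quantifier by compactness *)

Fixpoint agree_on (fs : seq formula) (M : structure) (e : nat -> M)
    (N : structure) (e' : nat -> N) : Prop :=
  if fs is f :: fs then (sat e f <-> sat e' f) /\ agree_on fs e e' else True.

Lemma agree_onP fs (M : structure) (e : nat -> M) (N : structure)
    (e' : nat -> N) f :
  agree_on fs e e' -> List.In f fs -> sat e f <-> sat e' f.
Proof. by elim: fs => //= g fs IHfs [gE /IHfs fsE] [<-|]. Qed.

Definition qf_over (V : seq nat) (f : formula) : Prop :=
  quantifier_free f /\ {subset free_vars f <= V}.

Definition transfers_exists (T : theory) : Prop :=
  forall (M N : structure), is_model T M -> is_model T N ->
  forall (V : seq nat) (e : nat -> M) (e' : nat -> N),
    (forall f, qf_over V f -> sat e f <-> sat e' f) ->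
  forall n g, quantifier_free g -> {subset free_vars (FEx n g) <= V} ->
    sat e (FEx n g) -> sat e' (FEx n g).

(** On [C] the truth of [psi] depends only on the truth values of [fs], so [psi] is a Boolean
    combination of them. The class [C] is a parameter so that the induction can restrict it to where
    the head formula holds or fails; with no formula left, [psi] is constant on [C]. *)
Lemma finite_separation (V : seq nat) (psi : formula) (fs : seq formula)
    (C : forall M : structure, (nat -> M) -> Prop) :
    (forall f, List.In f fs -> qf_over V f) ->
    (forall (M N : structure) (e : nat -> M) (e' : nat -> N),
       C M e -> C N e' -> agree_on fs e e' -> sat e psi -> sat e' psi) ->
  exists2 h, qf_over V h & forall M e, C M e -> sat e h <-> sat e psi.
Proof.
elim: fs C => [|f fs IHfs] C fsV sep.
  have [[M [e [Ce Me]]]|none] :=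
    pselect (exists (M : structure) (e : nat -> M), C M e /\ sat e psi).
    exists (FEq TZero TZero) => // N e' Ce'; split=> // _.
    exact: (sep M N e e').
  exists (FNot (FEq TZero TZero)) => // N e' Ce' /=; split=> [//|Ne'].
  by case: none; exists N, e'.
have [f_qf fV] := fsV f (or_introl erefl).
have fsV' g : List.In g fs -> qf_over V g by move=> gfs; apply: fsV; right.
have [//|M N e e' [Ce Cf] [Ce' Cf'] fse|h1 [h1_qf h1V] h1P] :=
    IHfs (fun M e => C M e /\ sat e f).
  by apply: sep.
have [//|M N e e' [Ce Cf] [Ce' Cf'] fse|h2 [h2_qf h2V] h2P] :=
    IHfs (fun M e => C M e /\ ~ sat e f).
  by apply: sep.
exists (FOr (FAnd f h1) (FAnd (FNot f) h2)).
  split=> /=; first by rewrite f_qf h1_qf h2_qf.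
  by move=> k; rewrite !mem_cat => /orP[/orP[/fV|/h1V]|/orP[/fV|/h2V]].
move=> M e Ce /=; have [fe|fe] := pselect (sat e f).
  have := h1P M e (conj Ce fe); tauto.
have := h2P M e (conj Ce fe); tauto.
Qed.

Section Criterion.
Local Open Scope classical_set_scope.
Variable T : theory.

(** If no [h] works, every finite list of quantifier-free formulas has a pair of models agreeing on
    the list but not on the existential formula. Along an ultrafilter containing every set
    [above fs], the ultraproducts of the two members agree on all quantifier-free formulas over [V],
    and transfer is contradicted. *)
Lemma eliminate_exists n g : transfers_exists T -> quantifier_free g ->
  exists2 h, qf_over (free_vars (FEx n g)) h
    & entails T (FIff h (FEx n g)).
Proof.
move=> tr g_qf; set V := free_vars _.
apply: contrapT => noh.
pose D := {fs : seq formula | forall f, List.In f fs -> qf_over V f}.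
have sep (fs : D) : exists x : {M : structure & nat -> M} * {M : structure & nat -> M},
    [/\ is_model T (projT1 x.1), is_model T (projT1 x.2),
        agree_on (sval fs) (projT2 x.1) (projT2 x.2),
        sat (projT2 x.1) (FEx n g) & ~ sat (projT2 x.2) (FEx n g)].
  case: fs => fs fsV /=; apply: contrapT => nsep; apply: noh.
  have [M N e e' CM CN fse Me|h hV hP] :=
      @finite_separation V (FEx n g) fs (fun M _ => is_model T M) fsV.
    apply: contrapT => Ne'; apply: nsep.
    by exists (existT _ M e, existT _ N e').
  by exists h => // M TM e /=; have := hP M e TM; split; tauto.
pose x fs := sval (cid (sep fs)).
have xP fs := svalP (cid (sep fs)).
pose above (fs : D) := [set gs : D | forall f, List.In f (sval fs) -> List.In f (sval gs)].
have F_filter : ProperFilter (filter_from setT above).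
  apply: filter_from_proper; last by move=> fs _; exists fs.
  apply: filter_fromT_filter; last move=> [fs fsP] [gs gsP].
    have nilP f : List.In f [::] -> qf_over V f by [].
    by exists (exist _ [::] nilP).
  have fgP f : List.In f (fs ++ gs) -> qf_over V f.
    by move/List.in_app_iff => [/fsP|/gsP].
  exists (exist _ (fs ++ gs) fgP) => hs /= fgh.
  by split=> f /= ?; apply: fgh; apply/List.in_app_iff; [left|right].
have [U [U_ultra FU]] := ultraFilterLemma F_filter.
have U_filter : Filter U := filter_filter.
pose e1 k : ultraproduct (fun fs => projT1 (x fs).1) U_ultra :=
  to_ultraproduct _ (fun fs => projT2 (x fs).1 k).
pose e2 k : ultraproduct (fun fs => projT1 (x fs).2) U_ultra :=
  to_ultraproduct _ (fun fs => projT2 (x fs).2 k).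
have sat1 f : sat e1 f <-> U [set fs | sat (projT2 (x fs).1) f].
  exact: (los_family _ (fun k fs => projT2 (x fs).1 k)).
have sat2 f : sat e2 f <-> U [set fs | sat (projT2 (x fs).2) f].
  exact: (los_family _ (fun k fs => projT2 (x fs).2 k)).
have model1 : is_model T (ultraproduct (fun fs => projT1 (x fs).1) U_ultra).
  move=> f Tf e; apply/los; apply: filterS filterT => fs _ /=.
  by have [M1 _ _ _ _] := xP fs; apply: M1.
have model2 : is_model T (ultraproduct (fun fs => projT1 (x fs).2) U_ultra).
  move=> f Tf e; apply/los; apply: filterS filterT => fs _ /=.
  by have [_ M2 _ _ _] := xP fs; apply: M2.
have agree f : qf_over V f -> sat e1 f <-> sat e2 f.
  move=> fV; rewrite sat1 sat2.
  have fP h : List.In h [:: f] -> qf_over V h by case=> [<-|[]].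
  have Uf : U (above (exist _ [:: f] fP)) by apply: FU; exists (exist _ [:: f] fP).
  split=> H; move: Uf H; apply: filterS2 => fs /= ffs;
    have [_ _ /agree_onP fsE _ _] := xP fs;
    by move/fsE: (ffs f (or_introl erefl)); tauto.
have := tr _ _ model1 model2 V e1 e2 agree n g g_qf (fun k kV => kV).
rewrite sat1 sat2 => H.
have /H U2 : U [set fs | sat (projT2 (x fs).1) (FEx n g)].
  by apply: filterS filterT => fs _; have [] := xP fs.
have [fs gfs] := filter_ex U2.
by have [_ _ _ _ []] := xP fs.
Qed.

Theorem admits_QE_of_transfers : transfers_exists T -> admits_QE T.
Proof.
move=> tr; suff H : forall f, exists2 h, qf_over (free_vars f) h & entails T (FIff f h).
  by move=> f; have [h [hqf hV] hP] := H f; exists h; split.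
have exP n f : (exists2 h, qf_over (free_vars f) h & entails T (FIff f h)) ->
    exists2 h, qf_over (free_vars (FEx n f)) h & entails T (FIff (FEx n f) h).
  move=> [h [h_qf hV] hP]; have [k [k_qf kV] kP] := eliminate_exists n tr h_qf.
  exists k.
    split=> // j /kV /=; rewrite !mem_filter => /andP[-> /=]; exact: hV.
  move=> M TM e; have /= kE := kP M TM e.
  have fh : sat e (FEx n f) <-> sat e (FEx n h).
    by split=> -[a fa]; exists a; have /= := hP M TM (update e n a); tauto.
  rewrite /= in fh *; tauto.
elim=> [t u|t u|t u|f [f' [f_qf fV] fP]|f [f' [f_qf fV] fP] g [g' [g_qf gV] gP]
  |f [f' [f_qf fV] fP] g [g' [g_qf gV] gP]|f [f' [f_qf fV] fP] g [g' [g_qf gV] gP]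
  |n f IHf|n f [f' [f_qf fV] fP]].
- by exists (FEq t u); [split|move=> M _ e; split].
- by exists (FLe t u); [split|move=> M _ e; split].
- by exists (FLev t u); [split|move=> M _ e; split].
- exists (FNot f') => // M TM e; have /= := fP M TM e; tauto.
1-3: have fgV : {subset free_vars f' ++ free_vars g' <= free_vars f ++ free_vars g}
  by move=> k; rewrite !mem_cat => /orP[/fV->|/gV->]; rewrite ?orbT.
- exists (FAnd f' g'); first by split; rewrite //= f_qf.
  by move=> M TM e; have /= := fP M TM e; have /= := gP M TM e; tauto.
- exists (FOr f' g'); first by split; rewrite //= f_qf.
  by move=> M TM e; have /= := fP M TM e; have /= := gP M TM e; tauto.
- exists (FImp f' g'); first by split; rewrite //= f_qf.
  by move=> M TM e; have /= := fP M TM e; have /= := gP M TM e; tauto.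
- exact: exP.
- have [|h [h_qf hV] hP] := exP n (FNot f).
    by exists (FNot f') => // M TM e; have /= := fP M TM e; tauto.
  exists (FNot h) => // M TM e; have /= hE := hP M TM e; split.
    by move=> fe /(proj2 hE)[a]; apply; apply: fe.
  by move=> he a; apply: contrapT => na; apply/he/(proj1 hE); exists a.
Qed.
End Criterion.

Local Open Scope ring_scope.

(** * Symmetric functions of the roots of a polynomial *)

(** The value [a] is fixed before [K], [i] and [r]: the expression of [Q] in elementary symmetric
    polynomials is evaluated at the coefficients of [p], so [a] is shared by all fields in which [p]
    splits. *)
Lemma symmetric_descent (F : fieldType) n (p : {poly F}) (Q : {mpoly F[n]}) :
    Q \is symmetric ->
  exists a : F, forall (K : fieldType) (i : {rmorphism F -> K}) (r : n.-tuple K),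
    map_poly i p = \prod_(c <- r) ('X - c%:P) -> mmap i (tnth r) Q = i a.
Proof.
move=> /sym_fundamental[t [<- _]].
(* Viete's formula for the elementary symmetric function of degree [k.+1] of the roots. *)
exists t.@[fun k => (-1) ^+ k.+1 * p`_(n - k.+1)] => K i r pr.
elim/mpolyind: t => [|c m t _ _ IHt]; first by rewrite comp_mpoly0 mmap0 meval0 rmorph0.
rewrite comp_mpolyD mmapD mevalD rmorphD {}IHt; congr (_ + _).
rewrite comp_mpolyZ comp_mpolyX mmapZ mevalZ rmorphM; congr (_ * _).
rewrite mevalX !rmorph_prod; apply: eq_bigr => k _.
rewrite !rmorphXn; congr (_ ^+ _); rewrite tnth_mktuple.
rewrite rmorphM rmorph_sign -coef_map pr.
have /= -> := mroots_coeff r (@Ordinal n.+1 k.+1 (ltn_ord k)).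
rewrite signrMK !mesymE !raddf_sum; apply: eq_bigr => h _.
by rewrite /= mmapX mevalX.
Qed.

Lemma symmetric_poly_descent (F : fieldType) n (p : {poly F})
    (Q : {poly {mpoly F[n]}}) :
    (forall s, map_poly (msym s) Q = Q) ->
  exists q : {poly F}, forall (K : fieldType) (i : {rmorphism F -> K}) (r : n.-tuple K),
    map_poly i p = \prod_(c <- r) ('X - c%:P) ->
    map_poly (mmap i (tnth r)) Q = map_poly i q.
Proof.
move=> Qsym; have coefQ k : Q`_k \is symmetric.
  by apply/issymP => s; rewrite -[in RHS](Qsym s) coef_map.
pose a k := sval (cid (symmetric_descent p (coefQ k))).
have aP k := svalP (cid (symmetric_descent p (coefQ k))).
exists (\poly_(k < size Q) a k) => K i r pr; apply/polyP => k.
rewrite !coef_map coef_poly; case: ltnP => [_|Qk]; first exact: aP.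
by rewrite nth_default // !raddf0.
Qed.

Lemma msym_mpolyXU n (R : comNzRingType) (s : 'S_n) k :
  msym s 'X_k = 'X_(s k) :> {mpoly R[n]}.
Proof. by rewrite /msym mmapX mmap1U. Qed.

(** For [p] monic of degree [n], [q] is the characteristic polynomial of multiplication by [g]
    modulo [p]; its coefficients are symmetric in the roots of [p]. *)
Lemma charpoly_descent (F : fieldType) n (p g : {poly F}) :
  exists q : {poly F}, forall (K : fieldType) (i : {rmorphism F -> K}) (r : n.-tuple K),
    map_poly i p = \prod_(c <- r) ('X - c%:P) ->
    map_poly i q = \prod_(c <- r) ('X - (map_poly i g).[c]%:P).
Proof.
pose G k := (map_poly (@mpolyC n F) g).['X_k].
have mapG (R : comNzRingType) (f : {rmorphism {mpoly F[n]} -> R}) k :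
    f (G k) = (map_poly (f \o @mpolyC n F) g).[f 'X_k].
  by rewrite -horner_map -map_poly_comp.
have [s|q qP] := @symmetric_poly_descent F n p (\prod_(k < n) ('X - (G k)%:P)).
  rewrite rmorph_prod /= [RHS](reindex_inj (@perm_inj _ s)) /=; apply: eq_bigr => k _.
  rewrite rmorphB /= map_polyX map_polyC; congr (_ - _%:P).
  rewrite -[LHS]/(msym s (G k)) (mapG _ (msym s)) /= msym_mpolyXU; congr _.[_].
  by apply: eq_map_poly => c /=; rewrite /msym mmapC.
exists q => K i r pr; rewrite -(qP K i r pr) rmorph_prod big_tuple.
apply: eq_bigr => k _; rewrite rmorphB /= map_polyX map_polyC; congr (_ - _%:P).
rewrite -[LHS]/(mmap i (tnth r) (G k)) (mapG _ (mmap i (tnth r))) /= mmapX mmap1U; congr _.[_].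
by apply: eq_map_poly => c /=; rewrite mmapC.
Qed.

(** Permuting the roots permutes the pairs of positions, so the product is symmetric. Pairs of
    positions rather than of roots keep track of multiplicities. *)
Lemma pair_sum_descent (F : fieldType) n (p : {poly F}) (t : F) :
  exists q : {poly F}, forall (K : fieldType) (i : {rmorphism F -> K}) (r : n.-tuple K),
    map_poly i p = \prod_(c <- r) ('X - c%:P) ->
    map_poly i q = \prod_(A : {set 'I_n} | #|A| == 2)
      ('X - (\sum_(k in A) tnth r k + i t * \prod_(k in A) tnth r k)%:P).
Proof.
pose G (A : {set 'I_n}) : {mpoly F[n]} :=
  \sum_(k in A) 'X_k + t%:MP * \prod_(k in A) 'X_k.
have [s|q qP] := @symmetric_poly_descent F n p (\prod_(A : {set 'I_n} | #|A| == 2) ('X - (G A)%:P)).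
  rewrite rmorph_prod /= [RHS](reindex_inj (imset_inj (@perm_inj _ s))) /=.
  apply: eq_big => [A|A _]; first by rewrite card_imset //; apply: perm_inj.
  rewrite rmorphB /= map_polyX map_polyC; congr (_ - _%:P).
  rewrite -[LHS]/(msym s (G A)) /G rmorphD rmorphM rmorph_sum rmorph_prod /=.
  rewrite !big_imset; try by move=> x y _ _ /perm_inj.
  congr (_ + _ * _); first by apply: eq_bigr => k _; apply: msym_mpolyXU.
    by rewrite /msym mmapC.
  by apply: eq_bigr => k _; apply: msym_mpolyXU.
exists q => K i r pr; rewrite -(qP K i r pr) rmorph_prod.
apply: eq_bigr => A _; rewrite rmorphB /= map_polyX map_polyC; congr (_ - _%:P).
rewrite -[LHS]/(mmap i (tnth r) (G A)) /G rmorphD rmorphM rmorph_sum rmorph_prod /= mmapC.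
congr (_ + _ * _).
  by apply: eq_bigr => k _; rewrite mmapX mmap1U.
by apply: eq_bigr => k _; rewrite mmapX mmap1U.
Qed.

(** * Real closed fields from square roots and roots of odd-degree polynomials *)

Lemma irreducible_factor (F : fieldType) (p : {poly F}) : (1 < size p)%N ->
  exists q, [/\ irreducible_poly q, q \is monic & q %| p].
Proof.
elim/ltn_ind: (size p) {-2}p (erefl (size p)) => n IHn {}p pn p_gt1.
have p_neq0 : p != 0 by rewrite -size_poly_gt0 ltnW.
have [irr_p|nirr] := pselect (irreducible_poly p).
  have eqp : (lead_coef p)^-1 *: p %= p.
    by rewrite eqp_scale ?invr_eq0 ?lead_coef_eq0.
  exists ((lead_coef p)^-1 *: p); split; last by rewrite (eqp_dvdl _ eqp).
    split=> [|q q1]; first by rewrite (eqp_size eqp); case: irr_p.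
    rewrite (eqp_dvdr _ eqp) => qp; apply: eqp_trans (irr_p.2 q q1 qp) _.
    by rewrite eqp_sym.
  by rewrite monicE lead_coefZ mulVf ?lead_coef_eq0.
have [q [q1 qp qNp]] : exists q : {poly F}, [/\ size q != 1, q %| p & ~~ (q %= p)].
  apply: contrapT => nq; apply: nirr; split=> // q q1 qp.
  by apply: contrapT => /negP qNp; apply: nq; exists q.
have q_neq0 : q != 0 by apply: contraNneq p_neq0 => q0; rewrite -dvd0p -q0.
have q_gt1 : (1 < size q)%N.
  by rewrite ltn_neqAle eq_sym q1 size_poly_gt0.
have q_lt : (size q < n)%N.
  by rewrite -pn ltn_neqAle dvdp_leq // andbT dvdp_size_eqp.
have [r [irr_r r_monic rq]] := IHn _ q_lt q erefl q_gt1.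
by exists r; split=> //; apply: dvdp_trans rq qp.
Qed.

(** Kronecker's construction: the root is the class of [X] modulo an irreducible factor. *)
Lemma root_extension (F : fieldType) (p : {poly F}) : (1 < size p)%N ->
  exists (K : fieldType) (i : {rmorphism F -> K}) x, root (map_poly i p) x.
Proof.
move=> /irreducible_factor[q [irr_q q_monic /dvdpP[s ->]]].
pose hI : monic_irreducible_poly q := (irr_q, q_monic).
pose K : fieldType := {poly %/ q with hI}.
pose i : {rmorphism F -> K} := qpolyC q.
exists K, i, ('qX : K); rewrite rmorphM rootM /= orbC.
have -> // : root (map_poly i q) ('qX : K).
have evalE f : (map_poly i f).['qX : K] = in_qpoly q f.
  rewrite -[in RHS](comp_polyXr f) /comp_poly -horner_map -map_poly_comp.
  congr (_.[_]); apply: eq_map_poly => c; apply/val_inj => /=.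
  rewrite /mk_monic; case: ifP => _; rewrite Pdiv.CommonRing.rmodp_small //.
    by rewrite (leq_ltn_trans (size_polyC_leq1 _)) // irr_q.1.
  by rewrite size_polyX (leq_ltn_trans (size_polyC_leq1 _)).
rewrite /root evalE.
by apply/eqP/val_inj => /=; rewrite mk_monicE // Pdiv.RingMonic.rmodpp.
Qed.

Lemma splitting_field (F : fieldType) n (p : {poly F}) :
    p \is monic -> size p = n.+1 ->
  exists (K : fieldType) (i : {rmorphism F -> K}) (r : n.-tuple K),
    map_poly i p = \prod_(c <- r) ('X - c%:P).
Proof.
elim: n F p => [|n IHn] F p p_monic sp.
  exists F, idfun, [tuple]; rewrite big_nil map_poly_id //.
  have /size_poly1P[c _ pc] : size p == 1 by rewrite sp.
  by move: p_monic; rewrite pc monicE lead_coefC => /eqP->.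
have [|K [i [x]]] := root_extension (p := p); first by rewrite sp.
move=> /factor_theorem[q pE].
have q_monic : q \is monic.
  by rewrite -(monicMr _ (monicXsubC x)) -pE map_monic.
have sq : size q = n.+1.
  have := size_map_poly i p; rewrite pE sp size_Mmonic ?monicXsubC //.
    by rewrite size_XsubC addn2 => -[].
  exact: monic_neq0.
have [L [j [r qE]]] := IHn K q q_monic sq.
exists L, (j \o i : {rmorphism F -> L}), [tuple of j x :: r].
by rewrite map_poly_comp pE rmorphM /= qE rmorphB /= map_polyX map_polyC /= big_cons mulrC.
Qed.

(** * Factors of degree one and two, from hypotheses that mention no order *)

Section RealClosedAlgebra.
Variable F : fieldType.
Hypothesis sqr_or_opp : forall a : F, exists c, a = c ^+ 2 \/ a = - c ^+ 2.
Hypothesis sqrD : forall a b : F, exists c, a ^+ 2 + b ^+ 2 = c ^+ 2.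
Hypothesis sqr_neqN1 : forall a : F, a ^+ 2 != -1.
Hypothesis odd_root : forall p : {poly F}, ~~ odd (size p) -> p != 0 ->
  exists x, root p x.

(** Every natural number is a square, being a sum of squares; [n.+1 = 0] would make -1 a square. *)
Let natr_neq0 n : n.+1%:R != 0 :> F.
Proof.
have [c cn] : exists c, n%:R = c ^+ 2 :> F.
  elim: n => [|n [c cn]]; first by exists 0; rewrite expr0n.
  by have [d dE] := sqrD c 1; exists d; rewrite -dE expr1n -natr1 cn.
by rewrite -natr1 addr_eq0 cn sqr_neqN1.
Qed.

Section Complex.
Variables (K : fieldType) (i : {rmorphism F -> K}) (w : K).
Hypothesis sqr_w : w ^+ 2 = -1.

(** The field F(w) as a predicate on [K], where the roots live, so that no second field structure is
    needed. *)
Definition complex_in (z : K) := exists a b, z = i a + w * i b.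

Let complex_eq0 a b : i a + w * i b = 0 -> a = 0 /\ b = 0.
Proof.
have [->|b0] := eqVneq b 0.
  by rewrite rmorph0 mulr0 addr0 => /eqP; rewrite fmorph_eq0 => /eqP.
move=> /eqP; rewrite addr_eq0 => /eqP ab.
have : i ((a / b) ^+ 2) = -1.
  rewrite rmorphXn rmorphM fmorphV /= ab mulNr mulfK ?fmorph_eq0 //.
  by rewrite sqrrN.
rewrite -(rmorphN1 i) => /fmorph_inj/eqP; by rewrite (negPf (sqr_neqN1 _)).
Qed.

Let complex_sub z z' : complex_in z -> complex_in z' -> complex_in (z - z').
Proof.
move=> [a [b ->]] [c [d ->]]; exists (a - c), (b - d).
by rewrite !rmorphB /=; ring.
Qed.

Let complex_add z z' : complex_in z -> complex_in z' -> complex_in (z + z').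
Proof.
move=> [a [b ->]] [c [d ->]]; exists (a + c), (b + d).
by rewrite !rmorphD /=; ring.
Qed.

Let complex_mul z z' : complex_in z -> complex_in z' -> complex_in (z * z').
Proof.
move=> [a [b ->]] [c [d ->]]; exists (a * c - b * d), (a * d + b * c).
rewrite rmorphB rmorphD !rmorphM /=.
rewrite -[X in X - _ + _]addr0; ring: sqr_w.
Qed.

Let complex_scalar a : complex_in (i a).
Proof. by exists a, 0; rewrite rmorph0 mulr0 addr0. Qed.

(** The root is [d + w b / (2 d)], where d^2 = (a + e) / 2 and e^2 = a^2 + b^2. Without an order the
    sign of e is found as follows: (a + c) / 2 and (a - c) / 2 have product -b^2 / 4, so if both
    were opposites of squares, -1 would be a square. *)
Let complex_sqrt z : complex_in z -> exists2 s, complex_in s & s ^+ 2 = z.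
Proof.
move=> [a [b ->]]; have [->|b0] := eqVneq b 0.
  rewrite rmorph0 mulr0 addr0; have [c [->|->]] := sqr_or_opp a.
    by exists (i c); rewrite ?rmorphXn.
  exists (w * i c); first by exists 0, c; rewrite rmorph0 add0r.
  by rewrite exprMn sqr_w rmorphN rmorphXn mulN1r.
have two0 : 2%:R != 0 :> F := natr_neq0 1.
have [c cE] := sqrD a b.
have [e [d dE]] : exists e d, e ^+ 2 = c ^+ 2 /\ (a + e) / 2%:R = d ^+ 2.
  have [d [dE|dE]] := sqr_or_opp ((a + c) / 2%:R); first by exists c, d.
  have [f [fE|fE]] := sqr_or_opp ((a - c) / 2%:R).
    by exists (- c), f; rewrite sqrrN.
  have bE : (d * f * 2%:R / b) ^+ 2 = -1.
    apply: (@mulfI _ (b ^+ 2)); first by rewrite expf_neq0.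
    have -> : b ^+ 2 * (d * f * 2%:R / b) ^+ 2 = (- d ^+ 2) * (- f ^+ 2) * 2%:R ^+ 2.
      by field.
    rewrite -dE -fE mulrN1.
    have -> : (a + c) / 2%:R * ((a - c) / 2%:R) * 2%:R ^+ 2 = a ^+ 2 - c ^+ 2 by field.
    by rewrite -cE; ring.
  by have := sqr_neqN1 (d * f * 2%:R / b); rewrite bE eqxx.
move: dE => [eE dE].
have d0 : d != 0.
  apply: contra_neq b0 => d0; move/eqP: dE; rewrite d0 expr0n /= mulf_eq0.
  rewrite invr_eq0 (negPf two0) orbF addr_eq0 => /eqP ae.
  have bE : b ^+ 2 = c ^+ 2 - a ^+ 2 by rewrite -cE; ring.
  by apply/eqP; rewrite -sqrf_eq0 bE -eE ae sqrrN subrr.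
exists (i d + w * i (b / d / 2%:R)); first by exists d, (b / d / 2%:R).
set f := b / d / 2%:R.
have -> : (i d + w * i f) ^+ 2 = i (d ^+ 2 - f ^+ 2) + w * i (2%:R * d * f).
  by rewrite rmorphB !rmorphM ?rmorphXn rmorph_nat /=; ring: sqr_w.
congr (i _ + w * i _); last by rewrite /f; field; rewrite ?two0 ?d0.
apply: (@mulfI _ (d ^+ 2 * 2%:R ^+ 2)); first by rewrite mulf_neq0 ?expf_neq0.
have -> : d ^+ 2 * 2%:R ^+ 2 * (d ^+ 2 - f ^+ 2) =
    (d ^+ 2) ^+ 2 * 2%:R ^+ 2 - b ^+ 2 by rewrite /f; field; rewrite ?two0 ?d0.
rewrite -dE (_ : b ^+ 2 = e ^+ 2 - a ^+ 2); first by field.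
by rewrite eE -cE; ring.
Qed.

(** The discriminant (x - y)^2 of the quadratic polynomial with roots [x] and [y] is complex, so
    [complex_sqrt] and the usual formula apply. *)
Let complex_quadratic x y : complex_in (x + y) -> complex_in (x * y) -> complex_in x.
Proof.
move=> xy_sum xy_prod.
have two0 : 2%:R != 0 :> K by rewrite -(rmorph_nat i) fmorph_eq0 natr_neq0.
have [s s_in sE] : exists2 s, complex_in s & s ^+ 2 = (x - y) ^+ 2.
  have [|s s_in sE] := @complex_sqrt ((x + y) * (x + y) - i 4%:R * (x * y)).
    by apply: complex_sub; apply: complex_mul.
  by exists s => //; rewrite sE rmorph_nat; ring.
have half t : complex_in t -> complex_in (i 2%:R^-1 * t) by apply: complex_mul.
have /orP[/eqP sx|/eqP sx] : (s == x - y) || (s == - (x - y)).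
  by rewrite -eqf_sqr sE.
  have -> : x = i 2%:R^-1 * (x + y + s).
    by rewrite sx fmorphV rmorph_nat; field.
  by apply: half; apply: complex_add.
have -> : x = i 2%:R^-1 * (x + y - s).
  by rewrite sx fmorphV rmorph_nat; field.
by apply: half; apply: complex_sub.
Qed.

(** For [b != 0], the minimal polynomial over [F] of [a + w b]. *)
Definition quad (a b : F) : {poly F} := ('X - a%:P) ^+ 2 + (b ^+ 2)%:P.

Lemma horner_quad a b x : (quad a b).[x] = (x - a) ^+ 2 + b ^+ 2.
Proof. by rewrite /quad !hornerE. Qed.

Lemma size_quad a b : size (quad a b) = 3.
Proof.
rewrite /quad size_polyDl ?size_sqr ?size_exp_XsubC //.
by rewrite (leq_ltn_trans (size_polyC_leq1 _)).
Qed.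

Lemma monic_quad a b : quad a b \is monic.
Proof.
rewrite monicE lead_coefDl ?lead_coef_exp ?lead_coefXsubC ?expr1n //.
by rewrite size_exp_XsubC (leq_ltn_trans (size_polyC_leq1 _)).
Qed.

Lemma horner_map_quad a b x : (map_poly i (quad a b)).[x] = (x - i a) ^+ 2 + i b ^+ 2.
Proof.
rewrite /quad rmorphD /= map_polyC /= hornerD hornerC; congr (_ + _); last by rewrite rmorphXn.
by rewrite rmorphXn rmorphB /= map_polyX map_polyC /= !hornerE.
Qed.

Definition has_real_factor (p : {poly F}) :=
  (exists a, root p a) \/ (exists a b, b != 0 /\ quad a b %| p).

(** The remainder modulo [quad a b] has degree at most one and vanishes at [a + w b]; as 1 and [w]
    are independent over [F], it is zero. *)
Let complex_root_real_factor p x : complex_in x -> root (map_poly i p) x ->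
  has_real_factor p.
Proof.
move=> [a [b ->]] px; have [b0|b0] := eqVneq b 0.
  left; exists a; move: px; rewrite b0 rmorph0 mulr0 addr0.
  by rewrite /root horner_map fmorph_eq0.
right; exists a, b; split=> //; apply/modp_eq0P.
set m := p %% quad a b; have sm : (size m <= 2)%N.
  have := ltn_modp p (quad a b).
  by rewrite (monic_neq0 (monic_quad a b)) size_quad.
have mE : m = m`_1 *: 'X + (m`_0)%:P.
  apply/polyP => -[|[|k]]; rewrite coefD coefZ coefX coefC /=.
  - by rewrite mulr0 add0r.
  - by rewrite mulr1 addr0.
  by rewrite mulr0 addr0 nth_default // (leq_trans sm).
have : (map_poly i m).[i a + w * i b] = 0.
  move: px; rewrite /root (divp_eq p (quad a b)) rmorphD rmorphM /= -/m.
  rewrite hornerD hornerM horner_map_quad.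
  have -> : (i a + w * i b - i a) ^+ 2 + i b ^+ 2 = 0 by ring: sqr_w.
  by rewrite mulr0 add0r => /eqP.
rewrite mE rmorphD /= map_polyZ /= map_polyX map_polyC /= !hornerE.
have -> : i m`_1 * (i a + w * i b) + i m`_0 =
    i (m`_1 * a + m`_0) + w * i (m`_1 * b).
  by rewrite rmorphD !rmorphM /=; ring.
move=> /complex_eq0[ea /eqP]; rewrite mulf_eq0 (negPf b0) orbF => /eqP m1.
by move: ea; rewrite m1 mul0r add0r => ->; rewrite scale0r add0r.
Qed.

Let real_factor_complex_root p : has_real_factor p ->
  exists2 x, complex_in x & root (map_poly i p) x.
Proof.
move=> [[a pa]|[a [b [b0 qp]]]].
  by exists (i a); rewrite ?complex_scalar // /root horner_map fmorph_eq0.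
exists (i a + w * i b); first by exists a, b.
case/dvdpP: qp => q ->; rewrite rmorphM rootM /=; apply/orP; right.
by rewrite /root horner_map_quad; apply/eqP; ring: sqr_w.
Qed.

(* Laplace: with x_1, ..., x_n the roots of p, the polynomial with roots
   x_j + x_k + t x_j x_k is real and its degree n (n - 1) / 2 is less divisible
   by 2; two values of t giving the same pair {j, k} make x_j + x_k and
   x_j x_k complex. *)
Lemma laplace_step n (p : {poly F}) (r : n.-tuple K) :
    map_poly i p = \prod_(c <- r) ('X - c%:P) ->
    (forall q : {poly F}, q \is monic -> size q = 'C(n, 2).+1 -> has_real_factor q) ->
  has_real_factor p.
Proof.
move=> pr IH.
pose z t (A : {set 'I_n}) := \sum_(k in A) tnth r k + t%:R * \prod_(k in A) tnth r k.
have zP t : exists A : {set 'I_n}, #|A| == 2 /\ complex_in (z t A).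
  have [q qE] := @pair_sum_descent F n p t%:R.
  have {}qE : map_poly i q = \prod_(A : {set 'I_n} | #|A| == 2) ('X - (z t A)%:P).
    by rewrite (qE K i r) //; apply: eq_bigr => A _; rewrite rmorph_nat.
  rewrite -big_filter in qE; set As := [seq _ <- _ | _] in qE.
  have [|x x_in] := @real_factor_complex_root q.
    apply: IH; first by rewrite -(map_monic i) qE monic_prod_XsubC.
    rewrite -(size_map_poly i) qE size_prod_XsubC -[in RHS](card_ord n) -card_draws.
    congr _.+1; rewrite -(card_uniqP (filter_uniq _ (index_enum_uniq _))).
    by apply: eq_card => A; rewrite mem_filter mem_index_enum andbT inE.
  rewrite qE /root horner_prod prodf_seq_eq0.
  move=> /hasP[A]; rewrite mem_filter => /andP[A2 _].
  by rewrite /= !hornerE subr_eq0 => /eqP xE; exists A; rewrite -xE.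
pose A t := sval (cid (zP t)).
have AP t : #|A t| == 2 /\ complex_in (z t (A t)) := svalP (cid (zP t)).
have [t [t' [tt' AE]]] : exists t t', (t < t')%N /\ A t = A t'.
  pose N := #|{: {set 'I_n}}|; pose f (k : 'I_N.+1) := A k.
  have /injectivePn[k [l kl fkl]] : ~~ injectiveb f.
    apply/negP => /injectiveP/leq_card; by rewrite card_ord ltnn.
  case: (ltngtP k l) => [kl'|lk|/val_inj klE].
  - by exists k, l.
  - by exists l, k.
  - by rewrite klE eqxx in kl.
have [A2 zt] := AP t; have [_ zt'] := AP t'; rewrite -AE in zt'.
move: A2 zt zt'; rewrite /z; set B := A t => /cards2P[j [k [jk BE]]].
rewrite {}BE.
rewrite !big_setU1 ?inE // !big_set1 /=.
set S := tnth r j + tnth r k; set P := tnth r j * tnth r k => zt zt'.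
have tt'0 : (t' - t)%N%:R != 0 :> F.
  by rewrite -subn_gt0 in tt'; case: (_ - _)%N tt' => // d _; apply: natr_neq0.
have P_in : complex_in P.
  have -> : P = i (t' - t)%N%:R^-1 * ((S + t'%:R * P) - (S + t%:R * P)).
    rewrite opprD addrACA subrr add0r -mulrBl -natrB ?(ltnW tt') // mulrA.
    by rewrite fmorphV rmorph_nat mulVf ?mul1r // -(rmorph_nat i) fmorph_eq0.
  by apply: complex_mul; [apply: complex_scalar|apply: complex_sub].
have S_in : complex_in S.
  have -> : S = (S + t%:R * P) - i t%:R * P by rewrite rmorph_nat addrK.
  by apply: complex_sub => //; apply: complex_mul => //; apply: complex_scalar.
apply: (@complex_root_real_factor p (tnth r j)).
  exact: complex_quadratic S_in P_in.
by rewrite pr root_prod_XsubC mem_tnth.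
Qed.
End Complex.

(** Induction on the exponent of 2 in the degree [n]: exponent 0 is the odd case, and for even [n]
    the exponent of ['C(n, 2)] is one less. *)
Lemma real_factor (p : {poly F}) : (1 < size p)%N -> has_real_factor p.
Proof.
move=> p_gt1; have p0 : p != 0 by rewrite -size_poly_gt0 ltnW.
suff main : forall k (q : {poly F}) n,
    q \is monic -> size q = n.+1 -> (0 < n)%N -> logn 2 n = k -> has_real_factor q.
  have lp0 : (lead_coef p)^-1 != 0 by rewrite invr_eq0 lead_coef_eq0.
  have : has_real_factor ((lead_coef p)^-1 *: p).
    apply: (main _ _ (size p).-1) => //.
    - by rewrite monicE lead_coefZ mulVf ?lead_coef_eq0.
    - by rewrite size_scale // prednK // ltnW.
    - by rewrite -subn1 subn_gt0.
  case=> [[a pa]|[a [b [b0 qp]]]]; [left|right].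
    by exists a; rewrite rootZ in pa.
  by exists a, b; rewrite dvdpZr in qp.
elim=> [|k IHk] q n q_monic sq n0 nk.
  left; apply: odd_root; last by rewrite monic_neq0.
  rewrite sq /= negbK; apply: contraT => /=; rewrite -dvdn2 => n2.
  by have := logn_gt0 2 n; rewrite nk mem_primes n0 n2.
have [K0 [i0 [r qr]]] := splitting_field q_monic sq.
(* The Laplace argument needs a square root of -1 in the same field as the roots. *)
have [|K [i [w]]] := @root_extension K0 ('X^2 + 1%:P); first by rewrite size_XnaddC.
rewrite rmorphD /= map_polyXn map_polyC /= rmorph1 /root !hornerE addr_eq0 => /eqP w2.
pose j : {rmorphism F -> K} := i \o i0.
pose rK := [tuple of map i r].
have qrK : map_poly j q = \prod_(c <- rK) ('X - c%:P).
  rewrite map_poly_comp qr rmorph_prod big_map; apply: eq_bigr => c _.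
  by rewrite rmorphB /= map_polyX map_polyC.
apply: (@laplace_step K j w w2 n q rK qrK) => s s_monic ss.
have n2 : (2 %| n)%N by apply: contraLR isT => n2; move: nk; rewrite lognE (negPf n2) !andbF.
have n_even : odd n = false by apply: negbTE; rewrite -dvdn2.
have n1 : (1 < n)%N by apply: dvdn_leq.
have Cn : ('C(n, 2) * 2 = n * n.-1)%N.
  by rewrite bin2 muln2 even_halfK // oddM n_even.
apply: (IHk s 'C(n, 2)) => //; first by rewrite bin_gt0.
have := congr1 (logn 2) Cn; rewrite !lognM ?bin_gt0 //; last by rewrite -subn1 subn_gt0.
have -> : logn 2 n.-1 = 0%N.
  by rewrite lognE dvdn2 -subn1 oddB // n_even !andbF.
by rewrite nk addn1 addn0 => -[].
Qed.

Lemma real_poly_ind (P : {poly F} -> Prop) :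
    (forall c, P c%:P) -> (forall p a, P p -> P (p * ('X - a%:P))) ->
    (forall p a b, b != 0 -> P p -> P (p * quad a b)) ->
  forall p, P p.
Proof.
move=> PC PX PQ p; elim/ltn_ind: (size p) {-2}p (erefl (size p)) => n IHn {}p pn.
have [p1|p_gt1] := leqP (size p) 1; first by rewrite (size1_polyC p1).
have p0 : p != 0 by rewrite -size_poly_gt0 ltnW.
case: (real_factor p_gt1) => [[a]|[a [b [b0]]]].
  rewrite -dvdp_XsubCl => /dvdpP[q qE]; rewrite qE in p0 pn *; apply: PX.
  apply: (IHn (size q)) => //; rewrite -pn size_Mmonic ?monicXsubC //.
    by rewrite size_XsubC addn2.
  by apply: contraNneq p0 => ->; rewrite mul0r.
move=> /dvdpP[q qE]; rewrite qE in p0 pn *; apply: PQ => //.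
apply: (IHn (size q)) => //; rewrite -pn size_Mmonic ?monic_quad ?size_quad //.
  by rewrite addn3.
by apply: contraNneq p0 => ->; rewrite mul0r.
Qed.
End RealClosedAlgebra.

(** The sign condition is weakened to [p.[a] * p.[b] <= 0], which passes to cofactors: [quad] is
    positive for [b != 0], and a linear factor either has its root in the interval or has the same
    sign at both ends. *)
Lemma real_closed_of_roots (R : realFieldType) :
    (forall a : R, 0 <= a -> exists b, a = b ^+ 2) ->
    (forall p : {poly R}, ~~ odd (size p) -> p != 0 -> exists x, root p x) ->
  Num.real_closed_axiom R.
Proof.
move=> sqr odd_root p a b ab.
have: p.[a] <= 0 <= p.[b] -> p.[a] * p.[b] <= 0 by case/andP; apply: mulr_le0_ge0.
move=> /[apply]; elim/real_poly_ind: p a b ab.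
- move=> c; have [c0|/ltW c0] := leP 0 c.
    by have [b ->] := sqr c c0; exists b; left.
  by have [|b bE] := sqr (- c); rewrite ?oppr_ge0 //; exists b; right; rewrite -bE opprK.
- by move=> a b; have [|c ->] := sqr (a ^+ 2 + b ^+ 2);
    rewrite ?addr_ge0 ?sqr_ge0 //; exists c.
- by move=> a; rewrite gt_eqF // (lt_le_trans _ (sqr_ge0 a)) ?oppr_lt0.
- exact: odd_root.
- move=> c a b ab; rewrite !hornerE -expr2 => c0.
  have {}c0 : c == 0 by rewrite -sqrf_eq0 eq_le c0 sqr_ge0.
  by exists a; rewrite ?lexx ?ab // /root !hornerE.
- move=> p c IHp a b ab; rewrite !hornerM !hornerXsubC mulrACA => H.
  have [ac|ca] := leP a c; have [cb|bc] := leP c b.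
  + by exists c; rewrite ?ac ?cb // rootM root_XsubC eqxx orbT.
  + have [||x xab px] := IHp a b => //.
      have h : 0 < (a - c) * (b - c) by rewrite nmulr_lgt0 subr_lt0 // (le_lt_trans ab).
      by rewrite -(pmulr_lle0 _ h).
    by exists x; rewrite // rootM px.
  + have [||x xab px] := IHp a b => //.
      have h : 0 < (a - c) * (b - c) by rewrite pmulr_rgt0 subr_gt0 // (lt_le_trans ca).
      by rewrite -(pmulr_lle0 _ h).
    by exists x; rewrite // rootM px.
  + by have := lt_le_trans (lt_trans bc ca) ab; rewrite ltxx.
- move=> p c d d0 IHp a b ab; rewrite !hornerM !horner_quad mulrACA => H.
  have h x : 0 < (x - c) ^+ 2 + d ^+ 2.
    by rewrite ltr_wpDl ?sqr_ge0 // exprn_even_gt0.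
  have [||x xab px] := IHp a b => //.
    by rewrite -(pmulr_lle0 _ (mulr_gt0 (h a) (h b))).
  by exists x; rewrite // rootM px.
Qed.

(** * Maximal partial isomorphisms *)

Section PartialIso.
Variables (K L : fieldType) (leK vK : rel K) (leL vL : rel L).
Hypothesis leK_scale : forall x y c, c != 0 -> leK (x * c ^+ 2) (y * c ^+ 2) = leK x y.
Hypothesis leL_scale : forall x y c, c != 0 -> leL (x * c ^+ 2) (y * c ^+ 2) = leL x y.
Hypothesis vK_scale : forall x y c, c != 0 -> vK (x * c ^+ 2) (y * c ^+ 2) = vK x y.
Hypothesis vL_scale : forall x y c, c != 0 -> vL (x * c ^+ 2) (y * c ^+ 2) = vL x y.
Hypothesis vK0 : forall x, vK x 0 = (x == 0).
Hypothesis vL0 : forall x, vL x 0 = (x == 0).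

(** Graphs of isomorphisms between subrings. That they are single-valued and injective follows from
    [phom_v], because only 0 has norm at most that of 0. *)
Record partial_hom (Q : K -> L -> Prop) : Prop := PartialHom {
  phom1 : Q 1 1;
  phomB : forall x x' y y', Q x x' -> Q y y' -> Q (x - y) (x' - y');
  phomM : forall x x' y y', Q x x' -> Q y y' -> Q (x * y) (x' * y');
  phom_le : forall x x' y y', Q x x' -> Q y y' -> leK x y = leL x' y';
  phom_v : forall x x' y y', Q x x' -> Q y y' -> vK x y = vL x' y' }.

Record partial_iso (P : K -> L -> Prop) : Prop := PartialIso {
  piso_hom : partial_hom P;
  pisoV : forall x x', P x x' -> P x^-1 x'^-1 }.

Lemma phom0 Q : partial_hom Q -> Q 0 0.
Proof.
move=> HQ; rewrite -(subrr 1) -[X in Q _ X](subrr 1).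
exact: phomB (phom1 HQ) (phom1 HQ).
Qed.

Lemma phom_eq0 Q x x' : partial_hom Q -> Q x x' -> (x == 0) = (x' == 0).
Proof. by move=> HQ xx'; rewrite -vK0 -vL0; apply: (phom_v HQ) (phom0 HQ). Qed.

Lemma phom_inj Q x x' y y' : partial_hom Q -> Q x x' -> Q y y' ->
  (x == y) = (x' == y').
Proof.
by move=> HQ xx' yy'; rewrite -subr_eq0 -[RHS]subr_eq0 (phom_eq0 HQ (phomB HQ xx' yy')).
Qed.

Definition fraction_graph (Q : K -> L -> Prop) (x : K) (x' : L) : Prop :=
  exists a a' b b', [/\ Q a a', Q b b', b != 0, x = a / b & x' = a' / b'].

(** Fractions are compared after multiplication by the square of the product of their denominators:
    the denominators themselves might reverse an ordering. *)
Lemma fraction_iso Q : partial_hom Q -> partial_iso (fraction_graph Q).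
Proof.
move=> HQ.
have nz b b' : Q b b' -> b != 0 -> b' != 0 by move=> /(phom_eq0 HQ)->.
have rel (R : rel K) (R' : rel L) :
    (forall x y c, c != 0 -> R (x * c ^+ 2) (y * c ^+ 2) = R x y) ->
    (forall x y c, c != 0 -> R' (x * c ^+ 2) (y * c ^+ 2) = R' x y) ->
    (forall x x' y y', Q x x' -> Q y y' -> R x y = R' x' y') ->
    forall x x' y y', fraction_graph Q x x' -> fraction_graph Q y y' -> R x y = R' x' y'.
  move=> scale scale' RQ x x' y y' [a [a' [b [b' [aa' bb' b0 -> ->]]]]].
  move=> [c [c' [d [d' [cc' dd' d0 -> ->]]]]].
  have b'0 := nz _ _ bb' b0; have d'0 := nz _ _ dd' d0.
  rewrite -(scale _ _ (b * d)) ?mulf_neq0 // -(scale' _ _ (b' * d')) ?mulf_neq0 //.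
  have -> : a / b * (b * d) ^+ 2 = a * b * (d * d) by field; rewrite b0.
  have -> : c / d * (b * d) ^+ 2 = c * d * (b * b) by field; rewrite d0.
  have -> : a' / b' * (b' * d') ^+ 2 = a' * b' * (d' * d') by field; rewrite b'0.
  have -> : c' / d' * (b' * d') ^+ 2 = c' * d' * (b' * b') by field; rewrite d'0.
  by apply: RQ; repeat apply: (phomM HQ).
split; last first.
  move=> _ _ [a [a' [b [b' [aa' bb' b0 -> ->]]]]].
  have [a0|a0] := eqVneq a 0.
    have := phom_eq0 HQ aa'; rewrite a0 eqxx => /esym/eqP->.
    exists 0, 0, 1, 1; rewrite !mul0r !invr0 oner_eq0.
    by split=> //; [apply: phom0|apply: phom1].
  by exists b, b', a, a'; rewrite !invf_div.
split.
- exists 1, 1, 1, 1; rewrite !divr1 oner_eq0; split=> //; exact: phom1.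
- move=> x x' y y' [a [a' [b [b' [aa' bb' b0 -> ->]]]]].
  move=> [c [c' [d [d' [cc' dd' d0 -> ->]]]]].
  have b'0 := nz _ _ bb' b0; have d'0 := nz _ _ dd' d0.
  exists (a * d - c * b), (a' * d' - c' * b'), (b * d), (b' * d'); split.
  + by apply: (phomB HQ); apply: (phomM HQ).
  + exact: (phomM HQ).
  + by rewrite mulf_neq0.
  + by field; rewrite b0 d0.
  + by field; rewrite b'0 d'0.
- move=> x x' y y' [a [a' [b [b' [aa' bb' b0 -> ->]]]]].
  move=> [c [c' [d [d' [cc' dd' d0 -> ->]]]]].
  exists (a * c), (a' * c'), (b * d), (b' * d'); rewrite !mulf_div mulf_neq0 //.
  by split=> //; apply: (phomM HQ).
- exact: rel (phom_le HQ).
- exact: rel (phom_v HQ).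
Qed.

Lemma sub_fraction_graph Q x x' : partial_hom Q -> Q x x' -> fraction_graph Q x x'.
Proof.
move=> HQ xx'; exists x, x', 1, 1; rewrite !divr1 oner_eq0; split=> //.
exact: phom1.
Qed.

Section Domain.
Variables (P : K -> L -> Prop) (HP : partial_iso P).

Definition piso_dom : {pred K} := fun x => `[< exists x', P x x' >].

Lemma piso_dom_closed : divring_closed piso_dom.
Proof.
split.
- by apply/asboolP; exists 1; apply: phom1 (piso_hom HP).
- move=> x y /asboolP[x' xx'] /asboolP[y' yy']; apply/asboolP.
  by exists (x' - y'); apply: (phomB (piso_hom HP)).
- move=> x y /asboolP[x' xx'] /asboolP[y' yy']; apply/asboolP.
  by exists (x' / y'); apply: (phomM (piso_hom HP)) xx' (pisoV HP yy').
Qed.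

HB.instance Definition _ := GRing.isDivringClosed.Build K piso_dom piso_dom_closed.

Record piso_field := PisoField { piso_val :> K; _ : piso_val \in piso_dom }.
HB.instance Definition _ := [isSub for piso_val].
HB.instance Definition _ := [Choice of piso_field by <:].
HB.instance Definition _ := [SubChoice_isSubIntegralDomain of piso_field by <:].
HB.instance Definition _ := [SubIntegralDomain_isSubField of piso_field by <:].

Lemma piso_field_ex (a : piso_field) : exists x', P (val a) x'.
Proof. by case: a => x /= /asboolP. Qed.

Definition piso_map (a : piso_field) : L := sval (cid (piso_field_ex a)).

Lemma piso_mapP a : P (val a) (piso_map a).
Proof. exact: svalP (cid (piso_field_ex a)). Qed.

Lemma piso_map_uniq a x' : P (val a) x' -> piso_map a = x'.
Proof. by move=> ax'; apply/eqP; rewrite -(phom_inj (piso_hom HP) (piso_mapP a) ax'). Qed.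

Lemma piso_map_zmod : zmod_morphism piso_map.
Proof.
by move=> a b; apply: piso_map_uniq; apply: (phomB (piso_hom HP)); apply: piso_mapP.
Qed.

Lemma piso_map_monoid : monoid_morphism piso_map.
Proof.
split; first by apply: piso_map_uniq; apply: (phom1 (piso_hom HP)).
by move=> a b; apply: piso_map_uniq; apply: (phomM (piso_hom HP)); apply: piso_mapP.
Qed.

HB.instance Definition _ := GRing.isZmodMorphism.Build piso_field L piso_map piso_map_zmod.
HB.instance Definition _ := GRing.isMonoidMorphism.Build piso_field L piso_map piso_map_monoid.

Lemma partial_iso_field :
  exists (F : fieldType) (i : {rmorphism F -> K}) (j : {rmorphism F -> L}),
    forall x x', P x x' <-> exists a, x = i a /\ x' = j a.
Proof.
exists piso_field, val, piso_map => x x'; split=> [xx'|[a [-> ->]]]; last exact: piso_mapP.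
have xP : x \in piso_dom by apply/asboolP; exists x'.
by exists (PisoField xP); split=> //; apply/esym/piso_map_uniq.
Qed.
End Domain.

Lemma maximal_partial_iso P0 : partial_iso P0 ->
  exists P, [/\ partial_iso P, forall x x', P0 x x' -> P x x'
    & forall P', partial_iso P' -> (forall x x', P x x' -> P' x x') ->
        forall x x', P' x x' -> P x x'].
Proof.
move=> HP0.
pose graph (A : set (K * L)) x x' := A (x, x').
pose good (A : set (K * L)) := A = set0 \/
  partial_iso (graph A) /\ (forall x x', P0 x x' -> A (x, x')).
have [C Cgood Ctot|A [Agood Amax]] := @Zorn_bigcup (K * L) good.
  have [[A CA [HA AP0]]|none] := pselect (exists2 A, C A &
    partial_iso (graph A) /\ (forall x x', P0 x x' -> A (x, x'))); last first.
    left; apply/seteqP; split=> // u [A CA Au]; exfalso.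
    case: (Cgood A CA) => [A0|HA]; first by rewrite A0 in Au.
    by apply: none; exists A.
  right; split; last by move=> x x' xx'; exists A => //; apply: AP0.
  have join u u' : bigcup C id u -> bigcup C id u' ->
      exists B, [/\ C B, partial_iso (graph B), B u & B u'].
    have isoC B w : C B -> B w -> partial_iso (graph B).
      by move=> CB Bw; case: (Cgood B CB) => [B0|[]//]; rewrite B0 in Bw.
    move=> [B CB Bu] [B' CB' Bu']; case: (Ctot B B' CB CB') => BB'.
      by exists B'; split=> //; [apply: isoC Bu'|apply: BB'].
    by exists B; split=> //; [apply: isoC Bu|apply: BB'].
  split; last first.
    move=> x x' xx'; have [B [CB HB xB _]] := join _ _ xx' xx'.
    by exists B => //; apply: (pisoV HB).
  split.
  - by exists A => //; apply: (phom1 (piso_hom HA)).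
  - move=> x x' y y' xx' yy'; have [B [CB HB xB yB]] := join _ _ xx' yy'.
    by exists B => //; apply: (phomB (piso_hom HB)) xB yB.
  - move=> x x' y y' xx' yy'; have [B [CB HB xB yB]] := join _ _ xx' yy'.
    by exists B => //; apply: (phomM (piso_hom HB)) xB yB.
  - move=> x x' y y' xx' yy'; have [B [CB HB xB yB]] := join _ _ xx' yy'.
    exact: (phom_le (piso_hom HB)) xB yB.
  - move=> x x' y y' xx' yy'; have [B [CB HB xB yB]] := join _ _ xx' yy'.
    exact: (phom_v (piso_hom HB)) xB yB.
pose A0 : set (K * L) := fun u => P0 u.1 u.2.
have A0good : good A0 by right.
case: Agood => [AE|[HA AP0]].
  have A0A : (A `<` A0)%classic.
    rewrite AE; split=> // /(_ (1, 1)); apply; exact: phom1 (piso_hom HP0).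
  by case: (Amax _ A0A).
exists (graph A); split=> // P' HP' AP' x x' xx'.
apply: contrapT => nA; pose A' : set (K * L) := fun u => P' u.1 u.2.
have AA' : (A `<` A')%classic.
  by split=> [[y y'] /AP'//|/(_ (x, x') xx')].
by apply: (Amax _ AA'); right; split=> // y y' /AP0/AP'.
Qed.

(** The last clause is maximality in the form used later: if [r] and [r'] satisfy the same relations
    over [F], the values of polynomials at them form a partial homomorphism, whose fractions extend
    the isomorphism. *)
Theorem maximal_iso_field Q : partial_hom Q ->
  exists (F : fieldType) (i : {rmorphism F -> K}) (j : {rmorphism F -> L}),
  [/\ forall x x', Q x x' -> exists a, x = i a /\ x' = j a,
      forall a b, leK (i a) (i b) = leL (j a) (j b),
      forall a b, vK (i a) (i b) = vL (j a) (j b)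
    & forall r r',
        (forall g h : {poly F},
           leK (map_poly i g).[r] (map_poly i h).[r] =
             leL (map_poly j g).[r'] (map_poly j h).[r'] /\
           vK (map_poly i g).[r] (map_poly i h).[r] =
             vL (map_poly j g).[r'] (map_poly j h).[r']) ->
        exists a, r = i a].
Proof.
move=> HQ; have [P [HP QP Pmax]] := maximal_partial_iso (fraction_iso HQ).
have [F [i [j Pij]]] := partial_iso_field HP.
have ijP a : P (i a) (j a) by apply/Pij; exists a.
exists F, i, j; split.
- by move=> x x' xx'; apply/Pij/QP/sub_fraction_graph.
- by move=> a b; apply: (phom_le (piso_hom HP)).
- by move=> a b; apply: (phom_v (piso_hom HP)).
move=> r r' rr'.
pose Q' x x' := exists g : {poly F}, x = (map_poly i g).[r] /\ x' = (map_poly j g).[r'].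
have HQ' : partial_hom Q'.
  split.
  - by exists 1; rewrite !rmorph1 !hornerE.
  - move=> _ _ _ _ [g [-> ->]] [h [-> ->]]; exists (g - h).
    by rewrite !rmorphB /= !hornerE.
  - move=> _ _ _ _ [g [-> ->]] [h [-> ->]]; exists (g * h).
    by rewrite !rmorphM /= !hornerE.
  - by move=> _ _ _ _ [g [-> ->]] [h [-> ->]]; case: (rr' g h).
  - by move=> _ _ _ _ [g [-> ->]] [h [-> ->]]; case: (rr' g h).
have [|a [->]] := proj1 (Pij r r'); last by exists a.
apply: (Pmax _ (fraction_iso HQ')).
  move=> x x' /Pij[a [-> ->]]; apply: sub_fraction_graph => //.
  by exists a%:P; rewrite !map_polyC !hornerC.
apply: sub_fraction_graph => //.
by exists 'X; rewrite !map_polyX !hornerX.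
Qed.
End PartialIso.

(** * Valuations as relations *)

(* [v x y] stands for |x| <= |y|, so [~~ v y x] stands for |x| < |y|. *)
Record valuation_rel (K : fieldType) (v : rel K) : Prop := ValuationRel {
  vrel_trans : forall y x z, v x y -> v y z -> v x z;
  vrel_total : forall x y, v x y || v y x;
  vrel_0 : forall x, v 0 x;
  vrel_le0 : forall x, v x 0 -> x = 0;
  vrel_mulr : forall x y z, v x y -> v (x * z) (y * z);
  vrel_add : forall x y, v x y -> v (x + y) y }.

Section ValuationTheory.
Variables (K : fieldType) (v : rel K).
Hypothesis vP : valuation_rel v.

Lemma vxx x : v x x.
Proof. by case/orP: (vrel_total vP x x). Qed.
Hint Resolve vxx : core.

Lemma vxx_trans y x z : v x y -> v y z -> v x z. Proof. exact: vrel_trans vP y x z. Qed.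

Lemma vltW x y : ~~ v y x -> v x y.
Proof. by move=> nyx; have := vrel_total vP x y; rewrite (negPf nyx) orbF. Qed.

Lemma vlt_le_trans y x z : ~~ v y x -> v y z -> ~~ v z x.
Proof. by move=> nyx yz; apply: contra nyx; apply: vxx_trans. Qed.

Lemma vle_lt_trans y x z : v x y -> ~~ v z y -> ~~ v z x.
Proof. by move=> xy; apply: contra => zx; apply: vxx_trans zx xy. Qed.

Lemma vx0 x : v x 0 = (x == 0).
Proof. by apply/idP/eqP => [/(vrel_le0 vP)//|->]. Qed.

Lemma vmulr_mono x y z : z != 0 -> v (x * z) (y * z) = v x y.
Proof.
move=> z0; apply/idP/idP => [/(vrel_mulr vP z^-1)|]; last exact: (vrel_mulr vP).
by rewrite !mulfK.
Qed.

Lemma vmull_mono x y z : z != 0 -> v (z * x) (z * y) = v x y.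
Proof. by rewrite !(mulrC z); apply: vmulr_mono. Qed.

Lemma vmul x y z t : v x y -> v z t -> v (x * z) (y * t).
Proof.
move=> xy zt; apply: (@vxx_trans (y * z)); first exact: (vrel_mulr vP).
by rewrite !(mulrC y); apply: (vrel_mulr vP).
Qed.

Lemma vmul_lt x y z t : t != 0 -> ~~ v y x -> v z t -> ~~ v (y * t) (x * z).
Proof.
move=> t0 xy zt; apply: (@vle_lt_trans (x * t)); first exact: vmul.
by rewrite vmulr_mono.
Qed.

Lemma vexp x y n : v x y -> v (x ^+ n) (y ^+ n).
Proof. by move=> xy; elim: n => [|n IHn]; rewrite ?expr0 // !exprS; apply: vmul. Qed.

Lemma vexp_lt x y n : ~~ v y x -> ~~ v (y ^+ n.+1) (x ^+ n.+1).
Proof.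
move=> xy; elim: n => [|n IHn]; rewrite ?expr1 // exprS [x ^+ _]exprS.
apply: vmul_lt => //; last exact/vexp/vltW.
by rewrite expf_neq0 //; apply: contraNneq xy => ->; apply: vrel_0 vP _.
Qed.

Lemma vexp_mono x y n : (0 < n)%N -> v (x ^+ n) (y ^+ n) = v x y.
Proof.
case: n => // n _; apply/idP/idP => [|/vexp//].
by apply: contraLR => /vexp_lt.
Qed.

Lemma vN1 : v (-1) 1 && v 1 (-1).
Proof.
have H x y : v x y -> v (- x) (- y).
  by move/(vrel_mulr vP (-1)); rewrite !mulrN1.
by case/orP: (vrel_total vP 1 (-1)) => h; have := H _ _ h; rewrite opprK h => ->.
Qed.

Lemma vNl x y : v (- x) y = v x y.
Proof.
have /andP[N1 N1'] := vN1; apply/idP/idP; apply: vxx_trans.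
  by rewrite -[X in v X _]mul1r -mulN1r; apply: (vrel_mulr vP).
by rewrite -[X in v _ X]mul1r -mulN1r; apply: (vrel_mulr vP).
Qed.

Lemma vNr x y : v x (- y) = v x y.
Proof.
have /andP[N1 N1'] := vN1; apply/idP/idP => /vxx_trans; apply.
  by rewrite -[X in v _ X]mul1r -mulN1r; apply: (vrel_mulr vP).
by rewrite -[X in v X _]mul1r -mulN1r; apply: (vrel_mulr vP).
Qed.

Lemma vadd x y z : v x z -> v y z -> v (x + y) z.
Proof.
move=> xz yz; case/orP: (vrel_total vP x y) => [xy|yx].
  exact: vxx_trans (vrel_add vP xy) yz.
by rewrite addrC; apply: vxx_trans (vrel_add vP yx) xz.
Qed.

Lemma vsub x y z : v x z -> v y z -> v (x - y) z.
Proof. by move=> xz yz; apply: vadd => //; rewrite vNl. Qed.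

Lemma vadd_lt x y z : ~~ v z x -> ~~ v z y -> ~~ v z (x + y).
Proof.
move=> xz yz; case/orP: (vrel_total vP x y) => [xy|yx].
  exact: vle_lt_trans (vrel_add vP xy) yz.
by rewrite addrC; apply: vle_lt_trans (vrel_add vP yx) xz.
Qed.

Lemma vadd_dominant x y : ~~ v y x ->
  forall z, (v (x + y) z = v y z) * (v z (x + y) = v z y).
Proof.
move=> xy; have xyy : v (x + y) y by apply: (vrel_add vP); apply: vltW.
have yxy : v y (x + y).
  apply: contraT => yxy; have /(vadd_lt yxy) : ~~ v y (- x) by rewrite vNr.
  by rewrite addrAC subrr add0r vxx.
move=> z; split; first by apply/idP/idP; apply: vxx_trans.
by apply/idP/idP => /vxx_trans; apply.
Qed.

Lemma vsum I (r : seq I) (P : pred I) (f : I -> K) z :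
  (forall i, P i -> v (f i) z) -> v (\sum_(i <- r | P i) f i) z.
Proof. by move=> fz; elim/big_ind: _ => // [|x y]; [apply: vrel_0 vP _|apply: vadd]. Qed.

Lemma vsum_lt I (r : seq I) (P : pred I) (f : I -> K) z : z != 0 ->
  (forall i, P i -> ~~ v z (f i)) -> ~~ v z (\sum_(i <- r | P i) f i).
Proof.
move=> z0 fz; elim/big_ind: _ => // [|x y]; first by rewrite vx0.
exact: vadd_lt.
Qed.

Lemma vprod I (r : seq I) (P : pred I) (f g : I -> K) :
  (forall i, P i -> v (f i) (g i)) ->
  v (\prod_(i <- r | P i) f i) (\prod_(i <- r | P i) g i).
Proof. by move=> fg; elim/big_ind2: _ => // *; apply: vmul. Qed.

Lemma vinv x y : x != 0 -> y != 0 -> v x^-1 y^-1 = v y x.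
Proof.
move=> x0 y0; rewrite -(@vmulr_mono _ _ (x * y)) ?mulf_neq0 //.
by rewrite mulKf // mulrC mulfK.
Qed.

Lemma vneq0 x y : ~~ v y x -> y != 0.
Proof. by apply: contraNneq => ->; apply: vrel_0 vP _. Qed.
End ValuationTheory.

(** * Algebraic extensions inside algebraically closed valued fields *)

(** The last clause is an inverse modulo [q] with coefficients in [F], so it can be evaluated at any
    root of [q], in any field containing [F]. *)
Lemma minimal_polynomial (F K : fieldType) (i : {rmorphism F -> K}) r (p : {poly F}) :
    p != 0 -> root (map_poly i p) r ->
  exists q : {poly F}, [/\ q \is monic, root (map_poly i q) r,
    forall h, root (map_poly i h) r -> q %| h
    & forall h, ~~ root (map_poly i h) r -> exists u s, u * h + s * q = 1].
Proof.
move=> p0 pr.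
pose good n := `[< exists q : {poly F}, [/\ q != 0, root (map_poly i q) r & size q = n] >].
have ex_good : exists n, good n by exists (size p); apply/asboolP; exists p.
case: (ex_minnP ex_good) => n /asboolP[q [q0 qr sq]] n_min.
have lq0 : (lead_coef q)^-1 != 0 by rewrite invr_eq0 lead_coef_eq0.
set m := (lead_coef q)^-1 *: q.
have m_monic : m \is monic by rewrite monicE lead_coefZ mulVf ?lead_coef_eq0.
have m0 : m != 0 := monic_neq0 m_monic.
have sm : size m = n by rewrite size_scale.
have mr : root (map_poly i m) r by rewrite map_polyZ rootZ ?fmorph_eq0.
have min h : h != 0 -> root (map_poly i h) r -> (n <= size h)%N.
  by move=> h0 hr; apply: n_min; apply/asboolP; exists h.
have mdvd h : root (map_poly i h) r -> m %| h.
  move=> hr; apply/modp_eq0P/eqP; apply: contraT => mod0.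
  have := ltn_modp h m; rewrite m0 ltnNge sm min //.
  move: hr; rewrite {1}(divp_eq h m) rmorphD rmorphM /= /root hornerD hornerM.
  by rewrite (rootP mr) mulr0 add0r.
exists m; split=> // h hr.
have /Bezout_coprimepP[[s u] /= /eqpP[[c d] /= /andP[c0 d0]]] : coprimep m h.
  rewrite /coprimep; set g := gcdp m h.
  have /dvdpP[e eE] : g %| m by apply: dvdp_gcdl.
  have g0 : g != 0 by rewrite gcdp_eq0 (negPf m0).
  have e0 : e != 0 by apply: contraNneq m0 => e0; rewrite eE e0 mul0r.
  move: (mr); rewrite eE rmorphM rootM /= => /orP[er|gr].
    have := min _ e0 er; rewrite -sm eE size_mul //.
    move: g0 e0; rewrite -!size_poly_gt0 => g0 e0 le_e.
    by move: (size e) (size g) g0 e0 le_e => a b; lia.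
  case/negP: hr; have /dvdpP[k ->] : g %| h by apply: dvdp_gcdr.
  by rewrite rmorphM rootM gr orbT.
move=> E; exists (d^-1 *: (c *: u)), (d^-1 *: (c *: s)).
rewrite -!scalerAl -!scalerDr addrC E scalerA mulVf ?scale1r //.
Qed.

(** * Counting the roots of norm at most one *)

Section NewtonIndex.
Variables (K : fieldType) (v : rel K).
Hypothesis vP : valuation_rel v.
Let vxx := vxx vP.

(* The degree of the reduction of the primitive multiple of p. *)
Definition newton_index (p : {poly K}) (k : nat) : Prop :=
  (forall l, v p`_l p`_k) /\ (forall l, (k < l)%N -> ~~ v p`_k p`_l).

Lemma newton_index_uniq p k l : newton_index p k -> newton_index p l -> k = l.
Proof.
move=> [k1 k2] [l1 l2]; case: (ltngtP k l) => // [/k2|/l2].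
  by rewrite l1.
by rewrite k1.
Qed.

(** If |y| <= 1, the factor reduces to a polynomial of degree one and the index grows by one;
    otherwise its constant coefficient dominates and the index stays. The Boolean [v y 1] is read as
    0 or 1. *)
Lemma newton_indexMXsubC p k y : newton_index p k ->
  newton_index (p * ('X - y%:P)) (v y 1 + k).
Proof.
move=> [k1 k2].
have pk0 : p`_k != 0 by apply: (vneq0 vP); apply: (k2 k.+1).
have cE l : (p * ('X - y%:P))`_l = (if l is m.+1 then p`_m else 0) - p`_l * y.
  by rewrite mulrBr coefB coefMX coefMC; case: l.
have py l : v y 1 -> v (p`_l * y) p`_l.
  by move=> y1; rewrite -[X in v _ X]mulr1; apply: (vmul vP).
case y1 : (v y 1); rewrite ?add1n ?add0n.
  have lt : ~~ v p`_k (- (p`_k.+1 * y)).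
    by rewrite (vNr vP); apply: (vle_lt_trans vP (py _ y1)); apply: k2.
  have topl x : v (p * ('X - y%:P))`_k.+1 x = v p`_k x.
    by rewrite cE addrC (vadd_dominant vP lt).
  have topr x : v x (p * ('X - y%:P))`_k.+1 = v x p`_k.
    by rewrite cE addrC (vadd_dominant vP lt).
  split=> [l|[//|l] kl].
    rewrite topr cE; apply: (vsub vP); first by case: l => [|l] //; apply: (vrel_0 vP).
    exact: (vxx_trans vP (py l y1)).
  rewrite topl cE; apply: (vadd_lt vP); first exact: k2.
  by rewrite (vNr vP); apply: (vle_lt_trans vP (py _ y1)); apply: k2; apply: ltnW.
have y0 : y != 0 by apply: contraFneq y1 => ->; apply: (vrel_0 vP).
have y_gt1 l : p`_l != 0 -> ~~ v (p`_l * y) p`_l.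
  by move=> pl0; rewrite -[X in v _ X]mulr1 (vmull_mono vP) // y1.
have lt : ~~ v (- (p`_k * y)) (if k is m.+1 then p`_m else 0).
  rewrite (vNl vP); apply: (vle_lt_trans vP _ (y_gt1 k pk0)).
  by case: k {k2 pk0} k1 => [|m] k1; [apply: (vrel_0 vP)|apply: k1].
have top x : (v (p * ('X - y%:P))`_k x = v (p`_k * y) x) *
    (v x (p * ('X - y%:P))`_k = v x (p`_k * y)).
  by rewrite cE !(vadd_dominant vP lt) (vNl vP) (vNr vP).
split=> [l|l kl].
  rewrite top cE; apply: (vsub vP); last exact: (vrel_mulr vP).
  apply: (vxx_trans vP _ (vltW vP (y_gt1 k pk0))).
  by case: l => [|m]; [apply: (vrel_0 vP)|apply: k1].
rewrite top cE; apply: (vadd_lt vP).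
  apply: (vle_lt_trans vP _ (y_gt1 k pk0)).
  by case: l {kl} => [|m]; [apply: (vrel_0 vP)|apply: k1].
by rewrite (vNr vP) (vmulr_mono vP) //; apply: k2.
Qed.

Lemma newton_index_prod (r : seq K) :
  newton_index (\prod_(c <- r) ('X - c%:P)) (count (fun c => v c 1) r).
Proof.
elim: r => [|c r IHr] /=; last first.
  by rewrite big_cons mulrC; apply: newton_indexMXsubC.
rewrite big_nil; split=> [l|[//|l] _]; rewrite !coef1 /=.
  by case: l => [|l] //=; apply: (vrel_0 vP).
by rewrite (vx0 vP) oner_eq0.
Qed.

(** The complete homogeneous symmetric polynomial of degree [d] in two variables, i.e. 1 + u + ... +
    u^d made homogeneous. *)
Definition geom_form (R : comNzRingType) d (x y : R) : R :=
  \sum_(b < d.+1) x ^+ (d - b) * y ^+ b.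

Lemma geom_formC (R : comNzRingType) d (x y : R) : geom_form d x y = geom_form d y x.
Proof.
rewrite /geom_form (reindex_inj rev_ord_inj) /=; apply: eq_bigr => b _.
by rewrite subSS subKn 1?mulrC // -ltnS.
Qed.

Lemma rmorph_geom_form (R S : comNzRingType) (f : {rmorphism R -> S}) d x y :
  f (geom_form d x y) = geom_form d (f x) (f y).
Proof.
by rewrite rmorph_sum; apply: eq_bigr => b _; rewrite rmorphM !rmorphXn.
Qed.

(* For |x| = |y| > 1 the form has norm |x|^d unless 1 + u + ... + u^d, with
   u = y / x, is not a unit, which is avoided when d + 1 = 1 modulo some L. *)
Lemma geom_form_integral (x y : K) : exists2 L, (0 < L)%N &
  forall k, (0 < k)%N -> v (geom_form (k * L)%N x y) 1 = v x 1 && v y 1.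
Proof.
have int1 z n : v z 1 -> v (z ^+ n) 1 by move=> /(vexp vP n); rewrite expr1n.
have [/andP[x1 y1]|] := boolP (v x 1 && v y 1).
  exists 1%N => // k _; apply: (vsum vP) => b _.
  by rewrite -[1]mulr1; apply: (vmul vP); apply: int1.
wlog yx : x y / v y x => [H nxy|].
  case/orP: (vrel_total vP x y) => [xy|yx]; last exact: H.
  have [|L L0 LP] := H y x xy; first by rewrite andbC.
  by exists L => // k k0; rewrite geom_formC LP.
move=> nxy; have x1 : ~~ v x 1.
  by apply: contra nxy => x1; rewrite x1 (vxx_trans vP yx).
have x0 : x != 0 by apply: contraNneq x1 => ->; apply: (vrel_0 vP).
pose u := y / x; have u1 : v u 1.
  by rewrite -(divff x0) /u; apply: (vrel_mulr vP).
pose s n := \sum_(b < n) u ^+ b.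
have s1 n : v (s n) 1 by apply: (vsum vP) => b _; apply: int1.
suff [L L0 LP] : exists2 L, (0 < L)%N & forall k, v 1 (s (k * L)%N.+1).
  exists L => // k k0; apply/negbTE.
  have -> : geom_form (k * L)%N x y = x ^+ (k * L)%N * s (k * L)%N.+1.
    rewrite mulr_sumr; apply: eq_bigr => b _.
    have -> : x ^+ (k * L)%N = x ^+ (k * L - b) * x ^+ b.
      by rewrite -exprD subnK // -ltnS.
    by rewrite expr_div_n; field; rewrite expf_neq0.
  have : ~~ v (x ^+ (k * L)%N) 1.
    by rewrite -[X in v _ X](expr1n _ (k * L)%N) (vexp_mono vP) // muln_gt0 k0.
  apply: contra; apply: (vxx_trans vP).
  by rewrite -[X in v X _]mulr1 (vmull_mono vP) ?expf_neq0.
(* If |s m| < 1, then also |s (k * m)| < 1, and [s (k * m).+1 = 1 + u * s (k * m)] has norm 1, so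
   [L = m] works; if there is no such [m], every [L] works. *)
have [[m m0 sm]|none] := pselect (exists2 m, (0 < m)%N & ~~ v 1 (s m)).
  exists m => // k; have smk : ~~ v 1 (s (k * m)%N).
    elim: k => [|k IHk]; first by rewrite /s big_ord0 (vx0 vP) oner_eq0.
    rewrite mulSn /s big_split_ord /=; apply: (vadd_lt vP) => //.
    rewrite (eq_bigr (fun b : 'I_(k * m)%N => u ^+ m * u ^+ b)); last first.
      by move=> b _; rewrite exprD.
    rewrite -mulr_sumr; apply: (vle_lt_trans vP _ IHk).
    by rewrite -[X in v _ X]mul1r; apply: (vrel_mulr vP); apply: int1.
  rewrite /s big_ord_recl expr0 addrC (vadd_dominant vP) //.
  rewrite (eq_bigr (fun b : 'I_(k * m)%N => u * u ^+ b)); last first.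
    by move=> b _; rewrite lift0 exprS.
  rewrite -mulr_sumr; apply: (vle_lt_trans vP _ smk).
  by rewrite -[X in v _ X]mul1r; apply: (vrel_mulr vP).
exists 1%N => // k; apply: contrapT => /negP nk; apply: none.
by exists (k * 1)%N.+1.
Qed.

(** Since all multiples of [L] are allowed, the product of the values found for finitely many pairs
    serves them all. *)
Lemma geom_form_integral_seq (l : seq (K * K)) : exists2 L, (0 < L)%N &
  forall k, (0 < k)%N ->
    {in l, forall u, v (geom_form (k * L)%N u.1 u.2) 1 = v u.1 1 && v u.2 1}.
Proof.
elim: l => [|u l [L L0 LP]]; first by exists 1%N.
have [M M0 MP] := geom_form_integral u.1 u.2.
exists (M * L)%N => [|k k0 w]; first by rewrite muln_gt0 M0.
rewrite inE => /orP[/eqP->|wl].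
  by rewrite mulnA mulnAC MP // muln_gt0 k0.
by rewrite mulnA LP // muln_gt0 k0.
Qed.
End NewtonIndex.

Lemma split_closed (K : fieldType) :
    (forall p : {poly K}, (1 < size p)%N -> exists x, root p x) ->
  forall (p : {poly K}) n, p \is monic -> size p = n.+1 ->
    exists r : n.-tuple K, p = \prod_(c <- r) ('X - c%:P).
Proof.
move=> closedK p n; elim: n p => [|n IHn] p p_monic sp.
  exists [tuple]; rewrite big_nil.
  have /size_poly1P[c _ pc] : size p == 1 by rewrite sp.
  by move: p_monic; rewrite pc monicE lead_coefC => /eqP->.
have [|x /factor_theorem[q pE]] := closedK p; first by rewrite sp.
have q_monic : q \is monic.
  by rewrite -(monicMr _ (monicXsubC x)) -pE.
have [|r qE] := IHn q q_monic.
  move: sp; rewrite pE size_Mmonic ?monicXsubC ?monic_neq0 //.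
  by rewrite size_XsubC addn2 => -[].
by exists [tuple of x :: r]; rewrite pE big_cons mulrC -qE.
Qed.

Section AlgebraicStep.
Variables (F K L : fieldType) (i : {rmorphism F -> K}) (j : {rmorphism F -> L}).
Variables (vK : rel K) (vL : rel L).
Hypotheses (vKP : valuation_rel vK) (vLP : valuation_rel vL).
Hypothesis vij : forall a b, vK (i a) (i b) = vL (j a) (j b).

Section Count.
Variables (n : nat) (p : {poly F}) (r : n.-tuple K) (s : n.-tuple L).
Hypothesis pr : map_poly i p = \prod_(c <- r) ('X - c%:P).
Hypothesis ps : map_poly j p = \prod_(c <- s) ('X - c%:P).

(** Both counts are the Newton index of an image of one polynomial over [F], and the index depends
    only on comparisons between coefficients, which [i] and [j] respect. *)
Let count_integral (g : {poly F}) :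
  count (fun c => vK (map_poly i g).[c] 1) r =
  count (fun c => vL (map_poly j g).[c] 1) s.
Proof.
have [q qP] := charpoly_descent n p g.
have := newton_index_prod vKP [seq (map_poly i g).[c] | c <- r].
have := newton_index_prod vLP [seq (map_poly j g).[c] | c <- s].
rewrite !big_map -(qP _ _ _ pr) -(qP _ _ _ ps) !count_map => sq rq.
apply/esym; apply: (newton_index_uniq sq) => /=.
split=> l; rewrite !coef_map -vij -!coef_map; first exact: (proj1 rq).
exact: (proj2 rq).
Qed.

Let merge_integral (gs : seq {poly F}) : exists G : {poly F},
  {in r, forall c, vK (map_poly i G).[c] 1 = all (fun g => vK (map_poly i g).[c] 1) gs} /\
  {in s, forall c, vL (map_poly j G).[c] 1 = all (fun g => vL (map_poly j g).[c] 1) gs}.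
Proof.
elim: gs => [|g gs [G [Gr Gs]]].
  by exists 0; split=> c _ /=; rewrite rmorph0 horner0 ?(vrel_0 vKP) ?(vrel_0 vLP).
have [dK dK0 dKP] := geom_form_integral_seq vKP
  [seq ((map_poly i g).[c], (map_poly i G).[c]) | c <- r].
have [dL dL0 dLP] := geom_form_integral_seq vLP
  [seq ((map_poly j g).[c], (map_poly j G).[c]) | c <- s].
(* The degree is a multiple of both [dK] and [dL], so one polynomial works in both fields. *)
exists (geom_form (dK * dL)%N g G); split=> c cin /=.
  rewrite -Gr // !rmorph_geom_form.
  have -> (x y : {poly K}) : (geom_form (dK * dL)%N x y).[c] = geom_form (dL * dK)%N x.[c] y.[c].
    by rewrite mulnC; apply: (rmorph_geom_form (horner_eval c)).
  by rewrite (dKP _ dL0 (_, _)) //; apply: (map_f (fun c => (_, _)) cin).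
rewrite -Gs // !rmorph_geom_form.
have -> (x y : {poly L}) : (geom_form (dK * dL)%N x y).[c] = geom_form (dK * dL)%N x.[c] y.[c].
  exact: (rmorph_geom_form (horner_eval c)).
by rewrite (dLP _ dK0 (_, _)) //; apply: (map_f (fun c => (_, _)) cin).
Qed.

(** Negated conditions are removed one by one: the points satisfying [gs] but not [h] are those
    satisfying [gs] less those satisfying [h :: gs]. The remaining positive conditions merge into
    one. *)
Lemma count_pattern (gs hs : seq {poly F}) :
  count (fun c => all (fun g => vK (map_poly i g).[c] 1) gs &&
                  all (fun h => ~~ vK (map_poly i h).[c] 1) hs) r =
  count (fun c => all (fun g => vL (map_poly j g).[c] 1) gs &&
                  all (fun h => ~~ vL (map_poly j h).[c] 1) hs) s.
Proof.
elim: hs gs => [|h hs IHhs] gs /=.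
  have [G [Gr Gs]] := merge_integral gs.
  rewrite (@eq_in_count _ _ (fun c => vK (map_poly i G).[c] 1)); last first.
    by move=> c cr; rewrite /= andbT Gr.
  rewrite count_integral; apply: eq_in_count => c cs.
  by rewrite /= andbT Gs.
have splitC (T : Type) (a b e : pred T) (l : seq T) :
    count (fun c => a c && e c) l =
    (count (fun c => (b c && a c) && e c) l + count (fun c => a c && (~~ b c && e c)) l)%N.
  elim: l => //= c l ->; case: (a c) => /=; rewrite ?andbF //.
  by case: (b c) => /=; lia.
have := IHhs gs; have := IHhs (h :: gs) => /= E1.
rewrite (splitC _ _ (fun c => vK (map_poly i h).[c] 1)).
rewrite (splitC _ _ (fun c => vL (map_poly j h).[c] 1)) E1.
by move/addnI.
Qed.
End Count.

(** Otherwise every root [s] of the minimal polynomial in [L] disagrees with [r] on some condition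
    |G s| <= 1. The pattern of [r] for these finitely many conditions is realised in [K] but by no
    root in [L], against [count_pattern]. *)
Theorem closed_algebraic_step (r : K) (p : {poly F}) :
    (forall p : {poly K}, (1 < size p)%N -> exists x, root p x) ->
    (forall p : {poly L}, (1 < size p)%N -> exists x, root p x) ->
    p != 0 -> root (map_poly i p) r ->
  exists s : L, forall g h : {poly F},
    vK (map_poly i g).[r] (map_poly i h).[r] =
    vL (map_poly j g).[s] (map_poly j h).[s].
Proof.
move=> closedK closedL p0 pr.
have [q [q_monic qr qdvd qinv]] := minimal_polynomial p0 pr.
have [n sq] : exists n, size q = n.+1.
  by exists (size q).-1; rewrite prednK // size_poly_gt0 monic_neq0.
have [rs rsE] : exists rs : n.-tuple K, map_poly i q = \prod_(c <- rs) ('X - c%:P).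
  by apply: split_closed => //; rewrite ?map_monic ?size_map_poly.
have [ss ssE] : exists ss : n.-tuple L, map_poly j q = \prod_(c <- ss) ('X - c%:P).
  by apply: split_closed => //; rewrite ?map_monic ?size_map_poly.
apply: contrapT => nosol.
have bad s : s \in ss -> exists G : {poly F},
    vK (map_poly i G).[r] 1 != vL (map_poly j G).[s] 1.
  move=> s_in; have qs : root (map_poly j q) s by rewrite ssE root_prod_XsubC.
  have [g [h ghP]] : exists g h : {poly F},
      vK (map_poly i g).[r] (map_poly i h).[r] !=
      vL (map_poly j g).[s] (map_poly j h).[s].
    apply: contrapT => all_eq; apply: nosol; exists s => g h.
    by apply/eqP; apply: contraT => gh; case: all_eq; exists g, h.
  have zero f : root (map_poly i f) r -> (map_poly j f).[s] = 0.
    by move=> /qdvd/dvdpP[f' ->]; rewrite rmorphM /= hornerM (rootP qs) mulr0.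
  have inv f : ~~ root (map_poly i f) r -> exists u,
      (map_poly i u).[r] * (map_poly i f).[r] = 1 /\
      (map_poly j u).[s] * (map_poly j f).[s] = 1.
    move=> /qinv[u [w E]]; exists u.
    have := congr1 (fun p => (map_poly i p).[r]) E.
    have := congr1 (fun p => (map_poly j p).[s]) E.
    rewrite !(rmorphD, rmorphM, rmorph1) /= !(hornerD, hornerM, hornerC).
    by rewrite (rootP qs) (rootP qr) !mulr0 !addr0.
  have nz f : ~~ root (map_poly i f) r -> (map_poly j f).[s] != 0.
    move=> /inv[u [_ us]]; apply: contraTneq isT => f0.
    by move/eqP: us; rewrite f0 mulr0 eq_sym oner_eq0.
  have [hr|hr] := boolP (root (map_poly i h) r).
    move: ghP; rewrite (rootP hr) (zero h hr) (vx0 vKP) (vx0 vLP).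
    have [gr|gr] := boolP (root (map_poly i g) r).
      by rewrite (rootP gr) (zero g gr) !eqxx.
    by rewrite (negPf (nz g gr)) (negPf (gr : _ != 0)).
  (* Multiplying by the inverse of [h] modulo the minimal polynomial turns a comparison with [h]
     into one with 1. *)
  have [u [ur us]] := inv h hr; exists (g * u).
  rewrite !rmorphM /= !hornerM.
  have cancel (E : fieldType) (v : rel E) : valuation_rel v -> forall a b c : E,
      b * c = 1 -> v (a * b) 1 = v a c.
    move=> vP a b c bc; rewrite -bc mulrC (vmull_mono vP) //.
    by apply: contraTneq isT => b0; move/eqP: bc; rewrite b0 mul0r eq_sym oner_eq0.
  by rewrite (cancel _ _ vKP _ _ _ ur) (cancel _ _ vLP _ _ _ us).
pose G s := if pselect (s \in ss) is left h then sval (cid (bad s h)) else 0.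
have GP s : s \in ss -> vK (map_poly i (G s)).[r] 1 != vL (map_poly j (G s)).[s] 1.
  by move=> s_in; rewrite /G; case: pselect => // h; case: cid.
pose good := [pred g : {poly F} | vK (map_poly i g).[r] 1].
have := count_pattern rsE ssE [seq g <- map G ss | good g] [seq g <- map G ss | ~~ good g].
have -> : count (fun c => all (fun g => vL (map_poly j g).[c] 1) [seq g <- map G ss | good g] &&
    all (fun h => ~~ vL (map_poly j h).[c] 1) [seq g <- map G ss | ~~ good g]) ss = 0%N.
  apply/eqP; rewrite -leqn0 leqNgt -has_count; apply/hasPn => s s_in.
  apply/negP => /andP[/allP pos /allP neg]; case/negP: (GP s s_in).
  have Gs : G s \in map G ss by apply: map_f.
  have [gG|gG] := boolP (good (G s)).
    by rewrite (pos (G s)) ?mem_filter ?gG // (gG : vK _ _).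
  have := neg (G s); rewrite mem_filter gG Gs => /(_ isT)/negPf->.
  by rewrite (negPf (gG : ~~ vK _ _)).
apply/eqP; rewrite -lt0n -has_count; apply/hasP; exists r.
  by rewrite -root_prod_XsubC -rsE.
by apply/andP; split; apply/allP => g; rewrite mem_filter => /andP[].
Qed.
End AlgebraicStep.

(** * Transcendental extensions inside algebraically closed valued fields *)

Section SameNorm.
Variables (K : fieldType) (v : rel K).
Hypothesis vP : valuation_rel v.

Definition veq x y := v x y && v y x.

Lemma veq_refl x : veq x x. Proof. by rewrite /veq (vxx vP). Qed.

Lemma veq_sym x y : veq x y = veq y x. Proof. by rewrite /veq andbC. Qed.

Lemma veq_trans y x z : veq x y -> veq y z -> veq x z.
Proof.
move=> /andP[xy yx] /andP[yz zy].
by rewrite /veq (vxx_trans vP xy yz) (vxx_trans vP zy yx).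
Qed.

Lemma veq_v x x' y y' : veq x x' -> veq y y' -> v x y = v x' y'.
Proof.
move=> /andP[xx x'x] /andP[yy y'y]; apply/idP/idP => xy.
  exact: (vxx_trans vP (vxx_trans vP x'x xy)).
exact: (vxx_trans vP (vxx_trans vP xx xy)).
Qed.

Lemma veq_mul x x' y y' : veq x x' -> veq y y' -> veq (x * y) (x' * y').
Proof. by move=> /andP[? ?] /andP[? ?]; rewrite /veq !(vmul vP). Qed.

Lemma veq_prod I (r : seq I) (P : pred I) (f g : I -> K) :
  (forall i, P i -> veq (f i) (g i)) ->
  veq (\prod_(i <- r | P i) f i) (\prod_(i <- r | P i) g i).
Proof.
by move=> fg; elim/big_ind2: _ => // *; [apply: veq_refl|apply: veq_mul].
Qed.

Lemma v_max (T : eqType) (f : T -> K) (l : seq T) : l != [::] ->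
  exists2 m, m \in l & {in l, forall x, v (f x) (f m)}.
Proof.
elim: l => // a [_ _|b l IHl _].
  by exists a; rewrite ?mem_seq1 // => x; rewrite mem_seq1 => /eqP->; apply: (vxx vP).
have [//|m m_in mP] := IHl; case/orP: (vrel_total vP (f a) (f m)) => am.
  exists m; first by rewrite inE m_in orbT.
  by move=> x; rewrite inE => /orP[/eqP->//|/mP].
exists a; first by rewrite inE eqxx.
move=> x; rewrite inE => /orP[/eqP->|/mP xm]; first exact: (vxx vP).
exact: (vxx_trans vP xm).
Qed.
End SameNorm.

Lemma v_min (K : fieldType) (v : rel K) (vP : valuation_rel v)
    (T : eqType) (f : T -> K) (l : seq T) : l != [::] ->
  exists2 m, m \in l & {in l, forall x, v (f m) (f x)}.
Proof.
elim: l => // a [_ _|b l IHl _].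
  by exists a; rewrite ?mem_seq1 // => x; rewrite mem_seq1 => /eqP->; apply: (vxx vP).
have [//|m m_in mP] := IHl; case/orP: (vrel_total vP (f m) (f a)) => am.
  exists m; first by rewrite inE m_in orbT.
  by move=> x; rewrite inE => /orP[/eqP->//|/mP].
exists a; first by rewrite inE eqxx.
move=> x; rewrite inE => /orP[/eqP->|/mP xm]; first exact: (vxx vP).
exact: (vxx_trans vP am).
Qed.

(** * Realising a cut of the value group *)

Section MonomialTransfer.
Variables (F K L : fieldType) (i : {rmorphism F -> K}) (j : {rmorphism F -> L}).
Variables (vK : rel K) (vL : rel L).
Hypotheses (vKP : valuation_rel vK) (vLP : valuation_rel vL).
Hypothesis vij : forall a b, vK (i a) (i b) = vL (j a) (j b).
Hypothesis rootF : forall (a : F) k, (0 < k)%N -> exists t, veq vK (i (t ^+ k)) (i a).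
Hypothesis sqrtL : forall a : L, exists t, veq vL (t ^+ 2) a.
Hypothesis nontrivialL : exists w : L, ~~ vL w 1.

(** If |s| is the norm of some [t], then [e = j t]. Otherwise |s| lies in a gap: between two
    neighbours [e] is their geometric mean, and beyond all of [ts] it is obtained by a factor [w] of
    norm above 1, for which the valuation has to be non-trivial. *)
Lemma same_cut (ts : seq F) (s : K) : s != 0 -> {in ts, forall t, t != 0} ->
  exists2 e : L, e != 0 & {in ts, forall t,
    vK s (i t) = vL e (j t) /\ vK (i t) s = vL (j t) e}.
Proof.
move=> s0 ts0; have [[t [t_in st ts']]|noeq] :=
    pselect (exists t, [/\ t \in ts, vK s (i t) & vK (i t) s]).
  exists (j t); first by rewrite fmorph_eq0 ts0.
  move=> t' _; rewrite -!vij.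
  by split; apply: (veq_v vKP); rewrite ?(veq_refl vKP) // /veq st ts'.
have notboth t : t \in ts -> vK (i t) s -> ~~ vK s (i t).
  by move=> t_in ts'; apply/negP => st; apply: noeq; exists t.
pose lo := [seq t <- ts | vK (i t) s]; pose up := [seq t <- ts | ~~ vK (i t) s].
suff [e e0 [eP1 eP2]] : exists2 e : L, e != 0 &
    {in lo, forall t, ~~ vL e (j t)} /\ {in up, forall t, ~~ vL (j t) e}.
  exists e => // t t_in; have [ts'|ts'] := boolP (vK (i t) s).
    have t_lo : t \in lo by rewrite mem_filter ts' t_in.
    by rewrite (negPf (notboth t t_in ts')) (negPf (eP1 t t_lo)) (vltW vLP (eP1 t t_lo)).
  have t_up : t \in up by rewrite mem_filter ts' t_in.
  by rewrite (negPf (eP2 t t_up)) (vltW vKP ts') (vltW vLP (eP2 t t_up)).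
have [w w1] := nontrivialL.
have w0 : w != 0 by apply: (vneq0 vLP w1).
have up_lt t : t \in up -> ~~ vK (i t) s by rewrite mem_filter => /andP[].
have lo_lt t : t \in lo -> ~~ vK s (i t).
  by rewrite mem_filter => /andP[ts' t_in]; apply: notboth.
have lo0 t : t \in lo -> j t != 0.
  by rewrite mem_filter fmorph_eq0 => /andP[_ /ts0].
have up0 t : t \in up -> j t != 0.
  by rewrite mem_filter fmorph_eq0 => /andP[_ /ts0].
have [loE|lo_n] := eqVneq lo [::]; have [upE|up_n] := eqVneq up [::].
- by exists 1; rewrite ?oner_eq0 // loE upE.
- have [u u_in uP] := v_min vLP j up_n.
  exists (j u / w); first by rewrite mulf_neq0 ?invr_eq0 ?up0.
  rewrite loE; split=> // t /uP ut; apply: (vlt_le_trans vLP _ ut).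
  by rewrite -(vmulr_mono vLP _ _ w0) divfK // -[X in vL _ X]mulr1 (vmull_mono vLP) ?up0.
- have [l l_in lP] := v_max vLP j lo_n.
  exists (j l * w); first by rewrite mulf_neq0 ?lo0.
  rewrite upE; split=> // t /lP tl; apply: (vle_lt_trans vLP tl).
  by rewrite -[X in vL _ X]mulr1 (vmull_mono vLP) ?lo0.
have [u u_in uP] := v_min vLP j up_n; have [l l_in lP] := v_max vLP j lo_n.
have lu : ~~ vL (j u) (j l).
  by rewrite -vij; apply: (vlt_le_trans vKP (lo_lt l l_in)); apply: (vltW vKP); apply: up_lt.
have [e eE] := sqrtL (j u * j l).
have le : ~~ vL e (j l).
  rewrite -(vexp_mono vLP _ _ (isT : (0 < 2)%N)) (veq_v vLP eE (veq_refl vLP _)).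
  by rewrite expr2 (vmulr_mono vLP) ?lo0.
have eu : ~~ vL (j u) e.
  rewrite -(vexp_mono vLP _ _ (isT : (0 < 2)%N)) (veq_v vLP (veq_refl vLP _) eE).
  by rewrite expr2 (vmull_mono vLP) ?up0.
exists e; first exact: (vneq0 vLP le).
split=> t.
  by move=> /lP tl; apply: (vle_lt_trans vLP tl).
by move=> /uP ut; apply: (vlt_le_trans vLP eu).
Qed.

(** For [n <> m] the comparison only depends on how |s| compares with |t|, where [t] is, up to norm,
    a root of [A / B] or [B / A]; in the degenerate cases [t = 1] is a dummy. Roots up to norm
    suffice, so negative elements of an ordered field do no harm. *)
Lemma monomial_threshold (s : K) (A B : F) n m : s != 0 ->
  exists2 t, t != 0 & forall e : L, e != 0 ->
    vK s (i t) = vL e (j t) -> vK (i t) s = vL (j t) e ->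
    vK (i A * s ^+ n) (i B * s ^+ m) = vL (j A * e ^+ n) (j B * e ^+ m).
Proof.
move=> s0; have [->|A0] := eqVneq A 0.
  exists 1; first exact: oner_neq0.
  by move=> e e0 _ _; rewrite !rmorph0 !mul0r (vrel_0 vKP) (vrel_0 vLP).
have [->|B0] := eqVneq B 0.
  exists 1; first exact: oner_neq0.
  move=> e e0 _ _; rewrite !rmorph0 !mul0r (vx0 vKP) (vx0 vLP).
  by rewrite !mulf_eq0 !fmorph_eq0 !expf_eq0 (negPf s0) (negPf e0) !andbF.
have scale (E : fieldType) (v : rel E) (vP : valuation_rel v) (f : {rmorphism F -> E})
    (x : E) k t a b : a != 0 -> veq v (f (t ^+ k.+1)) (f (b / a)) ->
    v (f a * x ^+ k.+1) (f b) = v x (f t) /\ v (f b) (f a * x ^+ k.+1) = v (f t) x.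
  move=> a0 tE; have fb : f b = f a * f (b / a).
    by rewrite -rmorphM mulrC divfK.
  rewrite fb !(vmull_mono vP) ?fmorph_eq0 //.
  rewrite -(vexp_mono vP (f t) x (ltn0Sn k)) -(vexp_mono vP x (f t) (ltn0Sn k)) -rmorphXn.
  by split; apply: (veq_v vP); rewrite ?(veq_refl vP) // veq_sym.
have veqL t a : veq vK (i t) (i a) -> veq vL (j t) (j a) by rewrite /veq !vij.
have shift (E : fieldType) (x a : E) k l : a * x ^+ (k + l) = a * x ^+ l * x ^+ k.
  by rewrite addnC exprD mulrA.
case: (ltngtP n m) => [nm|mn|->].
- have [t tE] := rootF (A / B) (ltn0Sn (m - n).-1).
  exists t => [|e e0 st ts].
    apply/negP => /eqP t0; move/andP: tE => [_]; rewrite t0 expr0n /= rmorph0 (vx0 vKP).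
    by rewrite fmorph_eq0 mulf_eq0 invr_eq0 (negPf A0) (negPf B0).
  have mE : m = (n + (m - n).-1.+1)%N by rewrite prednK ?subnKC ?subn_gt0 // ltnW.
  rewrite mE !shift (vmulr_mono vKP) ?expf_neq0 // (vmulr_mono vLP) ?expf_neq0 //.
  have [_ ->] := scale _ _ vKP i s _ _ _ _ B0 tE.
  by have [_ ->] := scale _ _ vLP j e _ _ _ _ B0 (veqL _ _ tE).
- have [t tE] := rootF (B / A) (ltn0Sn (n - m).-1).
  exists t => [|e e0 st ts].
    apply/negP => /eqP t0; move/andP: tE => [_]; rewrite t0 expr0n /= rmorph0 (vx0 vKP).
    by rewrite fmorph_eq0 mulf_eq0 invr_eq0 (negPf A0) (negPf B0).
  have nE : n = (m + (n - m).-1.+1)%N by rewrite prednK ?subnKC ?subn_gt0 // ltnW.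
  rewrite nE !shift (vmulr_mono vKP) ?expf_neq0 // (vmulr_mono vLP) ?expf_neq0 //.
  have [-> _] := scale _ _ vKP i s _ _ _ _ A0 tE.
  by have [-> _] := scale _ _ vLP j e _ _ _ _ A0 (veqL _ _ tE).
exists 1; first exact: oner_neq0.
by move=> e e0 _ _; rewrite (vmulr_mono vKP) ?expf_neq0 // (vmulr_mono vLP) ?expf_neq0.
Qed.

Theorem monomial_transfer (s : K) (qs : seq (F * F * nat * nat)) : s != 0 ->
  exists2 e : L, e != 0 & {in qs, forall q, let: (A, B, n, m) := q in
    vK (i A * s ^+ n) (i B * s ^+ m) = vL (j A * e ^+ n) (j B * e ^+ m)}.
Proof.
move=> s0.
pose t (q : F * F * nat * nat) := let: (A, B, n, m) := q in
  s2val (cid2 (monomial_threshold A B n m s0)).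
have [|e e0 eP] := @same_cut (map t qs) s s0.
  by move=> _ /mapP[[[[A B] n] m] _ ->] /=; case: (cid2 _).
exists e => // q q_in; have := eP (t q) (map_f t q_in).
case: q {q_in} => [[[A B] n] m] /= [E1 E2].
exact: (s2valP' (cid2 (monomial_threshold A B n m s0))).
Qed.
End MonomialTransfer.

(** A residue avoiding finitely many others. The factors [u - y], for [y] in [ys] or 0, have product
    -1. If |u| > 1, each would have norm |u|; so all have norm at most 1, and hence exactly 1. *)
Lemma generic_unit (L : fieldType) (v : rel L) (vP : valuation_rel v) :
    (forall p : {poly L}, (1 < size p)%N -> exists x, root p x) ->
  forall ys : seq L, {in ys, forall y, v y 1} ->
  exists u, veq v u 1 /\ {in ys, forall y, veq v (u - y) 1}.
Proof.
move=> closedL ys ysP; pose zs := 0 :: ys.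
have zsP : {in zs, forall y, v y 1}.
  by move=> y; rewrite inE => /orP[/eqP->|/ysP//]; apply: (vrel_0 vP).
have sz : size (\prod_(y <- zs) ('X - y%:P) + 1%:P) = (size zs).+1.
  rewrite size_polyDl size_prod_XsubC //.
  by rewrite (leq_ltn_trans (size_polyC_leq1 _)).
have [|u] := closedL (\prod_(y <- zs) ('X - y%:P) + 1%:P); first by rewrite sz.
rewrite /root hornerD hornerC horner_prod addr_eq0 => /eqP uE.
have {}uE : \prod_(y <- zs) (u - y) = -1.
  by rewrite -uE; apply: eq_bigr => y _; rewrite !hornerE.
have u1 : v u 1.
  apply: contraT => u1; have : ~~ v (\prod_(y <- zs) (u - y)) 1.
    rewrite big_cons subr0 big_seq.
    have ge1 : v 1 (\prod_(y <- ys | y \in ys) (u - y)).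
      have one : \prod_(y <- ys | y \in ys) 1 = 1 :> L by apply: big1.
      rewrite -[X in v X _]one.
      apply: (vprod vP) => y /ysP y1; have uy : ~~ v u (- y).
        by rewrite (vNr vP); apply: (vle_lt_trans vP y1).
      by rewrite addrC (vadd_dominant vP uy); apply: (vltW vP).
    apply: contra (u1) => h; apply: (vxx_trans vP _ h).
    by rewrite -[X in v X _]mulr1 (vmull_mono vP) // (vneq0 vP u1).
  by rewrite uE (vNl vP) (vxx vP).
have le1 y : y \in zs -> v (u - y) 1.
  by move=> /zsP y1; apply: (vsub vP).
have ge1 y : y \in zs -> v 1 (u - y).
  move=> y_in; apply: contraT => uy.
  have : ~~ v 1 (\prod_(y <- zs) (u - y)).
    rewrite (big_rem y) // -[X in v X _]mulr1; apply: (vmul_lt vP) => //.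
      exact: oner_neq0.
    have one : \prod_(z <- rem y zs | z \in rem y zs) 1 = 1 :> L by apply: big1.
    rewrite big_seq -[X in v _ X]one.
    by apply: (vprod vP) => z z_in; apply: le1 (mem_rem z_in).
  by rewrite uE (vNr vP) (vxx vP).
exists u; split=> [|y y_in].
  by have := ge1 0; rewrite inE eqxx subr0 /veq u1 => ->.
by rewrite /veq le1 ?ge1 // inE y_in orbT.
Qed.

(** Coefficient and exponent depend on [near] and [c0] only, so points of two fields with the same
    [near] get the same monomial. *)
Lemma veq_horner_split (F E : fieldType) (v : rel E) (vP : valuation_rel v)
    (f : {rmorphism F -> E}) (near : pred F) (rs : seq F) (lc c0 : F) (x e : E) :
    {in rs, forall c, veq v (x - f c) (if near c then e else f (c0 - c))} ->
  veq v (map_poly f (lc *: \prod_(c <- rs) ('X - c%:P))).[x]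
    (f (lc * \prod_(c <- rs | ~~ near c) (c0 - c)) * e ^+ count near rs).
Proof.
move=> xP; rewrite map_polyZ hornerZ rmorphM -mulrA; apply: (veq_mul vP).
  exact: veq_refl.
rewrite !rmorph_prod horner_prod big_seq.
apply: (veq_trans vP (y := \prod_(c <- rs | c \in rs) (if near c then e else f (c0 - c)))).
  have XE c : (map_poly f ('X - c%:P)).[x] = x - f c.
    by rewrite rmorphB /= map_polyX map_polyC !hornerE.
  by apply: (veq_prod vP) => c /xP; rewrite XE.
rewrite -big_seq (bigID near) /= mulrC.
rewrite (eq_bigr (fun c => f (c0 - c))); last by move=> c /negPf->.
rewrite [X in _ * X](eq_bigr (fun=> e)) => [|c ->//].
by rewrite big_const_seq iter_mulr_1; apply: veq_refl.
Qed.

Section ClosedStep.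
Variables (F K L : fieldType) (i : {rmorphism F -> K}) (j : {rmorphism F -> L}).
Variables (vK : rel K) (vL : rel L).
Hypotheses (vKP : valuation_rel vK) (vLP : valuation_rel vL).
Hypothesis vij : forall a b, vK (i a) (i b) = vL (j a) (j b).
Hypothesis closedF : forall p : {poly F}, (1 < size p)%N -> exists x, root p x.
Hypothesis closedL : forall p : {poly L}, (1 < size p)%N -> exists x, root p x.
Hypothesis nontrivialL : exists w : L, ~~ vL w 1.

Let root_of (E : fieldType) (cE : forall p : {poly E}, (1 < size p)%N -> exists x, root p x)
  (a : E) k : (0 < k)%N -> exists t, t ^+ k = a.
Proof.
move=> k0; have [|t] := cE ('X^k - a%:P); first by rewrite size_XnsubC.
by rewrite /root !hornerE subr_eq0 => /eqP; exists t.
Qed.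

Let split_poly (f : {poly F}) : exists rs : seq F,
  f = lead_coef f *: \prod_(c <- rs) ('X - c%:P).
Proof.
have [->|f0] := eqVneq f 0; first by exists [::]; rewrite lead_coef0 scale0r.
have lf : lead_coef f != 0 by rewrite lead_coef_eq0.
have [||rs rsE] := @split_closed F closedF ((lead_coef f)^-1 *: f) (size f).-1.
- by rewrite monicE lead_coefZ mulVf.
- by rewrite size_scale ?invr_eq0 // prednK // size_poly_gt0.
by exists rs; rewrite -rsE scalerA mulfV ?scale1r.
Qed.

(** The point is [c0 + e u]. The norm of [e] lies in the right cut, but |c0 - c| = |e| may occur for
    near [c]; the generic unit [u] rules out cancellation there. *)
Theorem closed_transcendental_step (b : K) (fs : seq {poly F}) :
    (forall a, b != i a) ->
  exists b' : L, {in fs &, forall f g,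
    vK (map_poly i f).[b] (map_poly i g).[b] = vL (map_poly j f).[b'] (map_poly j g).[b']}.
Proof.
move=> bNF.
pose rs f := sval (cid (split_poly f)).
have rsE f : f = lead_coef f *: \prod_(c <- rs f) ('X - c%:P) := svalP (cid (split_poly f)).
pose C := 0 :: flatten [seq rs f | f <- fs].
have rsC f c : f \in fs -> c \in rs f -> c \in C.
  by move=> f_in c_in; rewrite inE; apply/orP; right; apply/flatten_mapP; exists f.
have [c0 c0_in c0_min] := @v_min K vK vKP F (fun c => b - i c) C isT.
pose s := b - i c0; have s0 : s != 0 by rewrite subr_eq0.
pose near c := vK (i (c0 - c)) s.
pose A f := lead_coef f * \prod_(c <- rs f | ~~ near c) (c0 - c).
pose n f := count near (rs f).
(* The first block compares the values of the polynomials; the second ensures that [e] defines the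
   same near points as [s]. *)
pose qs := [seq (A f, A g, n f, n g) | f <- fs, g <- fs] ++
  [seq (c0 - c, 1, 0%N, 1%N) | c <- C].
have [||e e0 eP] := @monomial_transfer F K L i j vK vL vKP vLP vij _ _ nontrivialL s qs s0.
- by move=> a k k0; have [t <-] := root_of closedF a k0; exists t; rewrite (veq_refl vKP).
- by move=> a; have [t <-] := root_of closedL a (isT : (0 < 2)%N); exists t; rewrite (veq_refl vLP).
have nearE c : c \in C -> vL (j (c0 - c)) e = near c.
  move=> c_in; have := eP (c0 - c, 1, 0%N, 1%N).
  rewrite mem_cat map_f ?orbT // => /(_ isT).
  by rewrite !expr0 !expr1 !mulr1 !rmorph1 !mul1r.
have [|u [u1 uP]] := @generic_unit L vL vLP closedL [seq - j (c0 - c) / e | c <- C & near c].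
  move=> _ /mapP[c + ->]; rewrite mem_filter => /andP[cn c_in].
  by rewrite -(vmulr_mono vLP _ _ e0) divfK // mul1r (vNl vLP) nearE.
exists (j c0 + e * u) => f g f_in g_in.
have evalK h : h \in fs -> veq vK (map_poly i h).[b] (i (A h) * s ^+ n h).
  move=> h_in; rewrite {1}(rsE h); apply: (veq_horner_split vKP) => c c_rs.
  have c_in := rsC h c h_in c_rs.
  have bE : b - i c = s + i (c0 - c) by rewrite rmorphB /s; ring.
  rewrite /near; case: ifP => cs.
    rewrite /veq (c0_min c c_in) andbT bE.
    by apply: (vadd vKP) => //; apply: (vxx vKP).
  by rewrite bE /veq !(vadd_dominant vKP (negbT cs)) (vxx vKP).
have evalL h : h \in fs -> veq vL (map_poly j h).[j c0 + e * u] (j (A h) * e ^+ n h).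
  move=> h_in; rewrite {1}(rsE h); apply: (veq_horner_split vLP) => c c_rs.
  have c_in := rsC h c h_in c_rs.
  have bE : j c0 + e * u - j c = e * u + j (c0 - c) by rewrite rmorphB; ring.
  have eu : veq vL (e * u) e.
    by rewrite -[X in veq _ _ X]mulr1; apply: (veq_mul vLP) => //; apply: veq_refl.
  case: ifP => cs.
    have -> : j c0 + e * u - j c = e * (u - - j (c0 - c) / e).
      by rewrite bE; field.
    rewrite -[X in veq _ _ X]mulr1; apply: (veq_mul vLP); first exact: veq_refl.
    by apply: uP; apply: (map_f (fun c => - j (c0 - c) / e)); rewrite mem_filter cs c_in.
  rewrite bE; have lt : ~~ vL (j (c0 - c)) (e * u).
    by rewrite (veq_v vLP (veq_refl vLP _) eu) nearE // cs.
  by rewrite /veq !(vadd_dominant vLP lt) (vxx vLP).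
rewrite (veq_v vKP (evalK f f_in) (evalK g g_in)).
rewrite (veq_v vLP (evalL f f_in) (evalL g g_in)).
apply: (eP (A f, A g, n f, n g)).
by rewrite mem_cat allpairs_f.
Qed.
End ClosedStep.

(** * Algebraic extensions inside real closed valued fields *)

Section SignTransfer.
Variables (F : fieldType) (K L : rcfType) (i : {rmorphism F -> K}) (j : {rmorphism F -> L}).
Hypothesis leij : forall a b, (i a <= i b) = (j a <= j b).

Let sgz_ij a : sgz (i a) = sgz (j a).
Proof.
have lt a' b' : (i a' < i b') = (j a' < j b').
  by rewrite !lt_neqAle !(inj_eq (fmorph_inj _)) leij.
have := lt 0 a; have := lt a 0; rewrite !rmorph0.
by do 2!case: sgzP => ?; rewrite ?ltxx //; do ?[move=> ->|move/esym].
Qed.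

(** The Cauchy index is computed by signed Euclidean division: the remainders come from [F], and
    each step contributes a quantity depending only on sizes and on signs of leading
    coefficients. *)
Lemma cindexR_transfer (p q : {poly F}) :
  cindexR (map_poly i q) (map_poly i p) = cindexR (map_poly j q) (map_poly j p).
Proof.
have cross (f : {poly F}) : crossR (map_poly i f) = crossR (map_poly j f).
  rewrite /crossR /variation /sgp_pinfty /sgp_minfty !size_map_poly !lead_coef_map.
  have sgM (E : rcfType) (h : {rmorphism F -> E}) k (c : F) :
      (Num.sg ((-1) ^+ k * h c) * Num.sg (h c) < 0) = (h ((-1) ^+ k * c * c) < 0).
    by rewrite -sgrM sgr_lt0 !rmorphM rmorphXn rmorphN1.
  have neg c : (i c < 0) = (j c < 0) by rewrite -sgz_lt0 sgz_ij sgz_lt0.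
  by rewrite !sgM !sgz_sgr sgz_ij neg.
elim/ltn_ind: (size q) {-2}q p (erefl (size q)) => n IHn {}q p sq.
have [->|q0] := eqVneq q 0; first by rewrite !rmorph0 !cindexR0p.
(* The next signed pseudo-remainder, computed over [F]. *)
pose m : {poly F} := - (lead_coef q ^+ Pdiv.CommonRing.rscalp p q) *: Pdiv.CommonRing.rmodp p q.
have next (E : rcfType) (h : {rmorphism F -> E}) :
    next_mod (map_poly h p) (map_poly h q) = map_poly h m.
  rewrite /next_mod /m /Pdiv.CommonRing.rscalp /Pdiv.CommonRing.rmodp redivp_map /=.
  by rewrite map_polyZ /= rmorphN rmorphXn lead_coef_map.
rewrite !(cindexR_rec (map_poly _ p)) !next -!rmorphM /= cross; congr (_ + _).
apply: (IHn (size m)) => //; rewrite -sq.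
by rewrite (leq_ltn_trans (size_scale_leq _ _)) // Pdiv.CommonRing.ltn_rmodp.
Qed.

(** By the Sturm-Tarski theorem each sum is the Cauchy index of [g] times the derivative of [p],
    over [p]. *)
Lemma tarski_query_transfer (p g : {poly F}) :
  \sum_(x <- rootsR (map_poly i p)) sgz (map_poly i g).[x] =
  \sum_(x <- rootsR (map_poly j p)) sgz (map_poly j g).[x].
Proof.
rewrite -!/(taq _ _) !taq_taqR /taqR !changes_mods_cindex.
by rewrite !deriv_map -!rmorphM /= cindexR_transfer.
Qed.

(** For a sign s, twice the indicator of [s = sigma] is s^2 + sigma s if [sigma] is 1 or -1, and 2 -
    2 s^2 if it is 0. The products thus expand into Tarski queries; the extra factor [q] absorbs the
    powers of [g] in the induction. *)
Lemma sign_pattern_transfer (p q : {poly F}) (l : seq ({poly F} * int)) :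
    {in l, forall u, u.2 \in [:: -1; 0; 1]} ->
  \sum_(x <- rootsR (map_poly i p)) sgz (map_poly i q).[x] *
    \prod_(u <- l) (sgz (map_poly i u.1).[x] == u.2)%:R =
  \sum_(x <- rootsR (map_poly j p)) sgz (map_poly j q).[x] *
    \prod_(u <- l) (sgz (map_poly j u.1).[x] == u.2)%:R :> int.
Proof.
elim: l q => [|[g sigma] l IHl] q lP.
  under eq_bigr do rewrite big_nil mulr1.
  by under [RHS]eq_bigr do rewrite big_nil mulr1; apply: tarski_query_transfer.
have {}IHl f : _ := IHl f (fun u ul => lP u (mem_behead (s := _ :: _) ul)).
have /= := lP (g, sigma) (mem_head _ _); rewrite !inE => sP.
pose S (E : rcfType) (h : {rmorphism F -> E}) f : int :=
  \sum_(x <- rootsR (map_poly h p)) sgz (map_poly h f).[x] *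
    \prod_(u <- l) (sgz (map_poly h u.1).[x] == u.2)%:R.
pose T (E : rcfType) (h : {rmorphism F -> E}) : int :=
  \sum_(x <- rootsR (map_poly h p)) sgz (map_poly h q).[x] *
    \prod_(u <- (g, sigma) :: l) (sgz (map_poly h u.1).[x] == u.2)%:R.
have TE (E : rcfType) (h : {rmorphism F -> E}) : 2%:R * T E h =
    if sigma == 0 then 2%:R * S E h q - 2%:R * S E h (q * g ^+ 2)
    else S E h (q * g ^+ 2) + sigma * S E h (q * g).
  have sg2 (s : int) : s \in [:: -1; 0; 1] -> 2%:R * (s == sigma)%:R =
      if sigma == 0 then 2%:R - 2%:R * s ^+ 2 else s ^+ 2 + sigma * s.
    by rewrite !inE; case/or3P: sP => /eqP-> /or3P[]/eqP->.
  have sgE x : sgz (map_poly h g).[x] \in [:: -1; 0; 1].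
    by case: sgzP; rewrite !inE.
  pose R x : int := \prod_(u <- l) (sgz (map_poly h u.1).[x] == u.2)%:R.
  have step x : 2%:R * (sgz (map_poly h q).[x] *
        \prod_(u <- (g, sigma) :: l) (sgz (map_poly h u.1).[x] == u.2)%:R) =
      (if sigma == 0 then 2%:R - 2%:R * sgz (map_poly h g).[x] ^+ 2
       else sgz (map_poly h g).[x] ^+ 2 + sigma * sgz (map_poly h g).[x]) *
      (sgz (map_poly h q).[x] * R x).
    by rewrite big_cons -sg2 //= -/(R x); ring.
  rewrite /T /S [LHS]mulr_sumr (eq_bigr _ (fun x _ => step x)).
  have evE x k : sgz (map_poly h (q * g ^+ k)).[x] =
      sgz (map_poly h q).[x] * sgz (map_poly h g).[x] ^+ k.
    by rewrite rmorphM rmorphXn /= hornerM horner_exp sgzM sgzX.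
  case: ifP => _; rewrite !mulr_sumr -?sumrB -?big_split; apply: eq_bigr => x _.
    by rewrite evE /R; ring.
  have := evE x 1; rewrite expr1 => ->; rewrite evE expr1 /R /=; ring.
apply: (@mulfI _ (2%:R : int)) => //; rewrite -/(T K i) -/(T L j) !TE.
by rewrite /S !IHl.
Qed.

(** If some [G s] separated each root [s] in [L] from [r], the pattern of [r] for all of them would
    be counted at least once in [K] and never in [L]. *)
Lemma sign_type_transfer (p : {poly F}) (r : K) : p != 0 -> root (map_poly i p) r ->
  exists s : L, forall g : {poly F}, sgz (map_poly i g).[r] = sgz (map_poly j g).[s].
Proof.
move=> p0 pr; apply: contrapT => nosol.
have bad s : exists g : {poly F}, sgz (map_poly i g).[r] != sgz (map_poly j g).[s].
  apply: contrapT => all_eq; apply: nosol; exists s => g.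
  by apply/eqP; apply: contraT => gh; case: all_eq; exists g.
pose G s := sval (cid (bad s)).
have GP s : sgz (map_poly i (G s)).[r] != sgz (map_poly j (G s)).[s] := svalP (cid (bad s)).
pose l := [seq (G s, sgz (map_poly i (G s)).[r]) | s <- rootsR (map_poly j p)].
have lP : {in l, forall u, u.2 \in [:: -1; 0; 1]}.
  by move=> _ /mapP[s _ ->] /=; case: sgzP; rewrite !inE.
have := sign_pattern_transfer p 1 lP.
rewrite [RHS]big_seq [RHS]big1 => [|s s_in]; last first.
  rewrite (big_rem (G s, sgz (map_poly i (G s)).[r])) /=.
    by rewrite eq_sym (negPf (GP s)) mul0r mulr0.
  exact: (map_f (fun s => (G s, sgz (map_poly i (G s)).[r]))).
apply/eqP; rewrite gt_eqF //.
have r_in : r \in rootsR (map_poly i p).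
  by rewrite -roots_on_rootsR ?map_poly_eq0 // pr andbT in_itv.
rewrite (big_rem r) //= ltr_wpDr //.
  apply: sumr_ge0 => x _; rewrite rmorph1 hornerC sgz1 mul1r.
  by apply: prodr_ge0 => u _; apply: ler0n.
rewrite rmorph1 hornerC sgz1 mul1r big_map big1 // => s _ /=.
by rewrite eqxx.
Qed.
End SignTransfer.

Definition convex_rel (E : realFieldType) (v : rel E) :=
  forall x y : E, 0 <= x -> x <= y -> v x y.

Lemma newton_index_exists (K : fieldType) (v : rel K) (vP : valuation_rel v)
  (p : {poly K}) : p != 0 -> exists k, newton_index v p k.
Proof.
move=> p0; have sp : (0 < size p)%N by rewrite size_poly_gt0.
pose top k := (k < size p)%N && all (fun c => v c p`_k) p.
have topP k : top k -> forall l, v p`_l p`_k.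
  move=> /andP[_ /allP H] l; have [lp|pl] := ltnP l (size p).
    by apply: H; apply: mem_nth.
  by rewrite nth_default //; apply: (vrel_0 vP).
have ex_top : exists k, top k.
  have [|m /(nthP 0)[k kp <-] mP] := v_max vP id (l := polyseq p).
    by rewrite -size_eq0 -lt0n.
  by exists k; rewrite /top kp; apply/allP.
have top_size k : top k -> (k <= size p)%N by case/andP => /ltnW.
case: (ex_maxnP ex_top top_size) => k k_top k_max.
exists k; split=> [|l kl]; first exact: topP.
apply/negP => kl'; have /k_max : top l; last by rewrite leqNgt kl.
have pk0 : p`_k != 0.
  apply: contraTneq isT => pk0; have := topP k k_top (size p).-1.
  by rewrite pk0 (vx0 vP) -lead_coefE lead_coef_eq0 (negPf p0).
apply/andP; split.
  rewrite ltnNge; apply/negP => pl; move: kl'; rewrite (nth_default _ pl) (vx0 vP).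
  by rewrite (negPf pk0).
by apply/allP => c /(nthP 0)[m _ <-]; apply: (vxx_trans vP (topP k k_top m)).
Qed.

Lemma convex_normr (E : realFieldType) (v : rel E) (vP : valuation_rel v) :
  convex_rel v -> forall x y : E, `|x| <= `|y| -> v x y.
Proof.
move=> conv x y xy; have vn z w : (v `|z| w = v z w) * (v w `|z| = v w z).
  by case: (ger0P z) => _; rewrite ?(vNl vP) ?(vNr vP).
by rewrite -(vn x y).1 -(vn y `|x|).2; apply: conv.
Qed.

(* A root of norm at most 1 reduces to a root of the reduction of a primitive
   multiple of the polynomial, so it is bounded by the Cauchy bound of that. *)
Lemma integral_root_bound (F : fieldType) (E : realFieldType) (v : rel E)
    (f : {rmorphism F -> E}) (p : {poly F}) (y : E) :
    valuation_rel v -> convex_rel v -> p != 0 -> root (map_poly f p) y -> v y 1 ->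
  exists2 a, v (f a) 1 & `|y| <= f a.
Proof.
move=> vP conv p0 py y1.
have [|m [mmax mlt]] := newton_index_exists vP (p := map_poly f p); first by rewrite map_poly_eq0.
have int1 z n : v z 1 -> v (z ^+ n) 1 by move=> /(vexp vP n); rewrite expr1n.
have pm0 : p`_m != 0.
  by have := vneq0 vP (mlt m.+1 (ltnSn m)); rewrite coef_map fmorph_eq0.
pose c l := p`_l / p`_m.
have vc l x : v (f (c l)) x = v (f p`_l) (x * f p`_m).
  by rewrite -(vmulr_mono vP _ _ (_ : f p`_m != 0)) ?fmorph_eq0 // -rmorphM divfK.
have cv l : v (f (c l)) 1 by rewrite vc mul1r; have := mmax l; rewrite !coef_map.
have cv_lt l : (m < l)%N -> ~~ v 1 (f (c l)).
  move=> ml; have := mlt l ml; rewrite !coef_map.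
  apply: contra => h; rewrite -[X in v X _]mul1r.
  rewrite -[X in v _ X](divfK (_ : f p`_m != 0)) ?fmorph_eq0 //.
  by rewrite -fmorph_div; apply: (vrel_mulr vP).
(* [F] has no absolute value; [c l ^+ 2 + 1] bounds that of [c l] and still has norm at most 1. *)
pose a := 1 + \sum_(l < size p | (l < m)%N) (c l ^+ 2 + 1).
have a_ge1 : 1 <= f a.
  rewrite rmorphD rmorph1 lerDl rmorph_sum sumr_ge0 // => l _.
  by rewrite rmorphD rmorphXn rmorph1 addr_ge0 ?sqr_ge0.
exists a.
  rewrite rmorphD rmorph1; apply: (vadd vP); first exact: (vxx vP).
  rewrite rmorph_sum; apply: (vsum vP) => l _.
  by rewrite rmorphD rmorphXn rmorph1; apply: (vadd vP); rewrite ?(vxx vP) // int1.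
have [|y_big] := leP `|y| 1; first by move/le_trans; apply.
have sp : (m < size p)%N.
  by rewrite ltnNge; apply: contra pm0 => /(nth_default 0)->.
pose low := \sum_(l < size p | (l < m)%N) f (c l) * y ^+ l.
pose high := \sum_(l < size p | (m < l)%N) f (c l) * y ^+ l.
(* In [high] all coefficients have norm below 1, so by convexity its absolute value is at most 1,
   and the summand 1 of [a] accounts for it. *)
have E0 : y ^+ m + low + high = 0.
  apply: (@mulfI _ (f p`_m)); first by rewrite fmorph_eq0.
  rewrite mulr0 -(rootP py) horner_coef size_map_poly.
  have term l : (map_poly f p)`_l * y ^+ l = f p`_m * (f (c l) * y ^+ l).
    by rewrite coef_map [RHS]mulrA -rmorphM (mulrC p`_m) /c divfK.
  rewrite (eq_bigr _ (fun (l : 'I_(size p)) _ => term l)) -mulr_sumr; congr (_ * _).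
  rewrite (bigD1 (Ordinal sp)) //= /c divff // rmorph1 mul1r -addrA; congr (_ + _).
  rewrite (bigID (fun l : 'I_(size p) => (l < m)%N)) /=; congr (_ + _).
    by apply: eq_bigl => l; rewrite -(inj_eq val_inj) /= ltn_neqAle andbA andbb.
  by apply: eq_bigl => l; rewrite -(inj_eq val_inj) /= -leqNgt ltn_neqAle eq_sym.
have high_lt : ~~ v 1 high.
  apply: (vsum_lt vP) => [|l ml]; first exact: oner_neq0.
  apply: (vle_lt_trans vP _ (cv_lt l ml)).
  by rewrite -[X in v _ X]mulr1; apply: (vmul vP); [apply: (vxx vP)|apply: int1].
have high1 : `|high| <= 1.
  rewrite leNgt; apply: contra high_lt => h.
  by apply: (convex_normr vP conv); rewrite normr1 ltW.
have m_gt0 : (0 < m)%N.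
  rewrite lt0n; apply: contraNneq high_lt => m0; move: E0.
  rewrite /low big_pred0 ?addr0 => [/eqP|l]; last by rewrite m0.
  by rewrite m0 expr0 addrC addr_eq0 => /eqP->; rewrite (vNr vP) (vxx vP).
have y0 : 0 < `|y| by apply: lt_trans y_big.
have ymE : `|y| ^+ m = `|y| ^+ m.-1 * `|y| by rewrite -exprSr prednK.
suff : `|y| ^+ m <= `|y| ^+ m.-1 * f a by rewrite ymE ler_pM2l // exprn_gt0.
have -> : `|y| ^+ m = `|low + high|.
  by rewrite -normrX -[low + high]opprK -(_ : y ^+ m = - (low + high)) ?normrN //;
    apply/eqP; rewrite -addr_eq0 addrA E0.
apply: (le_trans (ler_normD _ _)).
rewrite rmorphD rmorph1 mulrDr mulr1 addrC lerD //.
  by apply: (le_trans high1); rewrite exprn_ege1 // ltW.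
rewrite rmorph_sum mulr_sumr /=; apply: (le_trans (ler_norm_sum _ _ _)).
apply: ler_sum => l lm; rewrite normrM normrX mulrC ler_pM ?exprn_ge0 //.
  by rewrite ler_weXn2l ?(ltW y_big) // -ltnS prednK.
rewrite rmorphD rmorphXn rmorph1 -real_normK ?num_real //.
set z := `|_|; rewrite -subr_ge0.
have -> : z ^+ 2 + 1 - z = (z - 2%:R^-1) ^+ 2 + 3%:R / 4%:R by field.
by rewrite addr_ge0 ?sqr_ge0 // divr_ge0.
Qed.

(** * Recovering a convex valuation from signs *)

Section RealAlgebraicStep.
Variables (F : fieldType) (K L : rcfType) (i : {rmorphism F -> K}) (j : {rmorphism F -> L}).
Variables (vK : rel K) (vL : rel L).
Hypotheses (vKP : valuation_rel vK) (vLP : valuation_rel vL).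
Hypotheses (convK : convex_rel vK) (convL : convex_rel vL).
Hypothesis leij : forall a b, (i a <= i b) = (j a <= j b).
Hypothesis vij : forall a b, vK (i a) (i b) = vL (j a) (j b).

(** The quotient g(r) / h(r) is algebraic of norm at most 1, hence bounded by some [a] of [F] of
    norm at most 1. So (a h)^2 - g^2 is non-negative at [r], and by equality of signs at [s];
    convexity turns this back into a comparison of norms. *)
Lemma sign_type_valuation (p : {poly F}) (r : K) (s : L) :
    p != 0 -> root (map_poly i p) r ->
    (forall g : {poly F}, sgz (map_poly i g).[r] = sgz (map_poly j g).[s]) ->
  forall g h : {poly F}, vK (map_poly i g).[r] (map_poly i h).[r] ->
    vL (map_poly j g).[s] (map_poly j h).[s].
Proof.
move=> p0 pr sgE g h gh.
have alg (q : {poly F}) : algebraicOver i (map_poly i q).[r].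
  apply/integral_algebraic/integral_horner.
    by move=> _ /(nthP 0)[k _ <-]; rewrite coef_map; apply: integral_id.
  by apply/integral_algebraic; exists p.
have zero (q : {poly F}) : ((map_poly i q).[r] == 0) = ((map_poly j q).[s] == 0).
  by rewrite -[LHS]sgz_eq0 -[RHS]sgz_eq0 sgE.
have [h0|h0] := eqVneq (map_poly i h).[r] 0.
  move: gh; rewrite h0 (vx0 vKP) zero => /eqP->.
  exact: (vrel_0 vLP).
pose y := (map_poly i g).[r] / (map_poly i h).[r].
have [q q0 qy] : algebraicOver i y by apply: algebraic_div.
have y1 : vK y 1 by rewrite -(vmulr_mono vKP _ _ h0) divfK // mul1r.
have [a a1 ya] := integral_root_bound vKP convK q0 qy y1.
have evE (E : rcfType) (f : {rmorphism F -> E}) x :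
    (map_poly f (a ^+ 2 *: h ^+ 2 - g ^+ 2)).[x] =
    (f a * (map_poly f h).[x]) ^+ 2 - (map_poly f g).[x] ^+ 2.
  rewrite rmorphB /= map_polyZ !rmorphXn /= hornerD hornerN hornerZ.
  by rewrite !horner_exp exprMn.
have : 0 <= sgz (map_poly i (a ^+ 2 *: h ^+ 2 - g ^+ 2)).[r].
  rewrite sgz_ge0 evE subr_ge0 -ler_sqrt ?sqr_ge0 // !sqrtr_sqr.
  rewrite -(divfK h0 (map_poly i g).[r]) normrM [leRHS]normrM ler_wpM2r //.
  by rewrite (le_trans ya) // ler_norm.
rewrite sgE sgz_ge0 evE subr_ge0.
move=> /(convL (sqr_ge0 _)); rewrite (vexp_mono vLP) // => H.
apply: (vxx_trans vLP H); rewrite -[X in vL _ X]mul1r; apply: (vrel_mulr vLP).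
by move: a1; rewrite -(rmorph1 i) vij rmorph1.
Qed.
End RealAlgebraicStep.

Theorem real_algebraic_step (F : fieldType) (K L : rcfType)
    (i : {rmorphism F -> K}) (j : {rmorphism F -> L}) (vK : rel K) (vL : rel L)
    (p : {poly F}) (r : K) :
    valuation_rel vK -> valuation_rel vL -> convex_rel vK -> convex_rel vL ->
    (forall a b, (i a <= i b) = (j a <= j b)) ->
    (forall a b, vK (i a) (i b) = vL (j a) (j b)) ->
    p != 0 -> root (map_poly i p) r ->
  exists s : L, forall g h : {poly F},
    ((map_poly i g).[r] <= (map_poly i h).[r]) = ((map_poly j g).[s] <= (map_poly j h).[s]) /\
    vK (map_poly i g).[r] (map_poly i h).[r] = vL (map_poly j g).[s] (map_poly j h).[s].
Proof.
move=> vKP vLP convK convL leij vij p0 pr.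
have [s sP] := sign_type_transfer leij p0 pr.
have ps : root (map_poly j p) s by rewrite /root -sgz_eq0 -sP sgz_eq0 -/(root _ _).
exists s => g h; split.
  rewrite -subr_ge0 -[RHS]subr_ge0 -[LHS]sgz_ge0 -[RHS]sgz_ge0.
  by have := sP (h - g); rewrite !rmorphB /= !hornerE => ->.
apply/idP/idP; first exact: (sign_type_valuation vKP vLP convK convL vij p0 pr sP).
by apply: (sign_type_valuation vLP vKP convL convK _ p0 ps) => // q; rewrite sP.
Qed.

(** * Transcendental extensions inside real closed valued fields *)

Lemma convex_sum_sqr (E : realFieldType) (v : rel E) (vP : valuation_rel v) :
  convex_rel v -> forall x y, veq v (x ^+ 2 + y ^+ 2) (if v x y then y ^+ 2 else x ^+ 2).
Proof.
move=> conv x y; case: ifP => xy; apply/andP; split.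
- by apply: (vadd vP); [rewrite (vexp_mono vP)|apply: (vxx vP)].
- by apply: conv; rewrite ?sqr_ge0 // lerDr sqr_ge0.
- by apply: (vadd vP); [apply: (vxx vP)|rewrite (vexp_mono vP) // (vltW vP) // xy].
- by apply: conv; rewrite ?sqr_ge0 // lerDl sqr_ge0.
Qed.

Lemma convex_sum_ge0 (E : realFieldType) (v : rel E) (vP : valuation_rel v) :
  convex_rel v -> forall x y, 0 <= x -> 0 <= y -> v y x -> veq v (x + y) x.
Proof.
move=> conv x y x0 y0 yx; apply/andP; split.
  by apply: (vadd vP) => //; apply: (vxx vP).
by apply: conv => //; rewrite lerDl.
Qed.

Lemma vlt_norm (E : realFieldType) (v : rel E) (vP : valuation_rel v) :
  convex_rel v -> forall x y, ~~ v y x -> `|x| < `|y|.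
Proof.
move=> conv x y; apply: contraR; rewrite -leNgt; exact: convex_normr.
Qed.

Lemma sgz_add_dominant (E : realFieldType) (x y : E) : `|x| < `|y| -> sgz (x + y) = sgz y.
Proof.
move=> xy; have [y0|y0|y0] := sgzP y.
- by move: xy; rewrite y0 normr0 normr_lt0.
- apply/eqP; rewrite sgz_cp0 -ltrBlDr sub0r; move: xy; rewrite (gtr0_norm y0).
  by rewrite ltr_norml => /andP[].
- apply/eqP; rewrite sgz_cp0 -ltrBrDr sub0r; move: xy; rewrite (ltr0_norm y0).
  by rewrite ltr_norml => /andP[_].
Qed.

Lemma horner_mapM (R S : comNzRingType) (h : {rmorphism R -> S}) (p q : {poly R}) x :
  (map_poly h (p * q)).[x] = (map_poly h p).[x] * (map_poly h q).[x].
Proof. by rewrite rmorphM /= hornerM. Qed.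

Section Factors.
Variable F : fieldType.

Definition of_factors (c : F) (ra : seq F) (qd : seq (F * F)) : {poly F} :=
  c *: (\prod_(a <- ra) ('X - a%:P) * \prod_(u <- qd) quad u.1 u.2).

(* Every factor of f is, up to norm, a monomial in the free parameter e, and
   which one only depends on the comparisons recorded by near and cmp. *)
Lemma monomial_value (leF : rel F) (near cmp : pred F) (d : F -> F)
    (c : F) (ra : seq F) (qd : seq (F * F)) :
  exists A n, forall (E : realFieldType) (v : rel E) (h : {rmorphism F -> E}) (x e : E),
    valuation_rel v -> convex_rel v -> (forall a b, v (h a) (h b) = leF a b) ->
    {in ra, forall a, veq v (x - h a) (if near a then e else h (d a))} ->
    {in qd, forall u, veq v (x - h u.1) (if near u.1 then e else h (d u.1)) /\
      v e (h u.2) = cmp u.2} ->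
    veq v (map_poly h (of_factors c ra qd)).[x] (h A * e ^+ n).
Proof.
elim: ra => [|a ra [A [n IH]]]; last first.
  exists (A * if near a then 1 else d a), (n + near a)%N.
  move=> E v h x e vP conv hv raP qdP.
  have -> : of_factors c (a :: ra) qd = of_factors c ra qd * ('X - a%:P).
    by rewrite /of_factors big_cons -!scalerAl; congr (_ *: _); ring.
  rewrite horner_mapM.
  have -> : h (A * if near a then 1 else d a) * e ^+ (n + near a) =
      h A * e ^+ n * (if near a then e else h (d a)).
    by case: (near a); rewrite ?addn0 ?addn1 ?mulr1 ?exprSr ?rmorphM; ring.
  apply: (veq_mul vP).
    by apply: IH => // b b_in; apply: raP; rewrite inE b_in orbT.
  rewrite rmorphB /= map_polyX map_polyC !hornerE.
  by apply: raP; rewrite inE eqxx.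
elim: qd => [|[a b] qd [A [n IH]]].
  exists c, 0%N => E v h x e vP *; rewrite /of_factors !big_nil !mulr1.
  by rewrite -mul_polyC mulr1 map_polyC hornerC; apply: veq_refl.
(* A quadratic factor contributes [e ^+ 2] when [x - a] has norm |e| and |e| > |b|, and a constant
   [k] otherwise. *)
pose sqr_e := near a && ~~ cmp b.
pose k := if near a then b ^+ 2 else if leF (d a) b then b ^+ 2 else d a ^+ 2.
exists (A * if sqr_e then 1 else k), (n + if sqr_e then 2 else 0)%N.
move=> E v h x e vP conv hv raP qdP.
have -> : of_factors c [::] ((a, b) :: qd) = of_factors c [::] qd * quad a b.
  by rewrite /of_factors !big_nil big_cons !mul1r -!scalerAl mulrC.
rewrite horner_mapM.
have -> : h (A * if sqr_e then 1 else k) * e ^+ (n + if sqr_e then 2 else 0) =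
    h A * e ^+ n * (if sqr_e then e ^+ 2 else h k).
  by case: sqr_e; rewrite ?addn0 ?exprD ?mulr1 ?rmorphM; ring.
apply: (veq_mul vP).
  by apply: IH => // u u_in; apply: qdP; rewrite inE u_in orbT.
have [/= xa eb] := qdP (a, b) (mem_head _ _).
rewrite horner_map_quad.
apply: (veq_trans vP (convex_sum_sqr vP conv _ _)).
have xb : v (x - h a) (h b) = v (if near a then e else h (d a)) (h b).
  exact: (veq_v vP xa (veq_refl vP _)).
have xa2 : veq v ((x - h a) ^+ 2) ((if near a then e else h (d a)) ^+ 2).
  by rewrite !expr2; apply: (veq_mul vP).
rewrite xb /sqr_e /k; move: xa2; case: (near a) => /= xa2.
  by rewrite eb; case: (cmp b) => //=; rewrite rmorphXn; apply: (veq_refl vP).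
by rewrite hv; case: (leF _ _); rewrite rmorphXn //; apply: (veq_refl vP).
Qed.

(** The quadratic factors are positive, so only the linear ones influence the sign. *)
Lemma sgz_of_factors (K L : realFieldType) (i : {rmorphism F -> K}) (j : {rmorphism F -> L})
    (x : K) (y : L) c ra qd :
    (forall a, sgz (i a) = sgz (j a)) ->
    {in ra, forall a, sgz (x - i a) = sgz (y - j a)} ->
    {in qd, forall u, u.2 != 0} ->
  sgz (map_poly i (of_factors c ra qd)).[x] = sgz (map_poly j (of_factors c ra qd)).[y].
Proof.
move=> sij raP qdP.
have sgM (E : realFieldType) (h : {rmorphism F -> E}) (p q : {poly F}) z :
    sgz (map_poly h (p * q)).[z] = sgz (map_poly h p).[z] * sgz (map_poly h q).[z].
  by rewrite horner_mapM sgzM.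
rewrite /of_factors -mul_polyC !sgM !map_polyC !hornerC /= sij; congr (_ * (_ * _)).
  elim: ra raP => [|a ra IHra] raP; first by rewrite !big_nil !rmorph1 !hornerC !sgz1.
  rewrite !big_cons !sgM !rmorphB /= !map_polyX !map_polyC !hornerE.
  rewrite raP ?inE ?eqxx // IHra // => b b_in; apply: raP.
  by rewrite inE b_in orbT.
have one (E : realFieldType) (h : {rmorphism F -> E}) z :
    sgz (map_poly h (\prod_(u <- qd) quad u.1 u.2)).[z] = 1.
  elim: qd qdP => [|u qd IHqd] qdP; first by rewrite big_nil rmorph1 hornerC sgz1.
  rewrite big_cons sgM IHqd => [|w w_in]; last by apply: qdP; rewrite inE w_in orbT.
  rewrite horner_map_quad mulr1 gtr0_sgz // ltr_wpDl ?sqr_ge0 //.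
  by rewrite exprn_even_gt0 //= fmorph_eq0 qdP // inE eqxx.
by rewrite !one.
Qed.
End Factors.

Section RealStep.
Variables (F : fieldType) (K L : rcfType) (i : {rmorphism F -> K}) (j : {rmorphism F -> L}).
Variables (vK : rel K) (vL : rel L).
Hypotheses (vKP : valuation_rel vK) (vLP : valuation_rel vL).
Hypotheses (convK : convex_rel vK) (convL : convex_rel vL).
Hypothesis leij : forall a b, (i a <= i b) = (j a <= j b).
Hypothesis vij : forall a b, vK (i a) (i b) = vL (j a) (j b).
Hypothesis relF : forall (p : {poly F}) r, p != 0 -> root (map_poly i p) r ->
  exists a, r = i a.
Hypothesis nontrivialL : exists w : L, ~~ vL w 1.

Let ltij a b : (i a < i b) = (j a < j b).
Proof. by rewrite !lt_neqAle !(inj_eq (fmorph_inj _)) leij. Qed.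

Let sgz_ij a : sgz (i a) = sgz (j a).
Proof.
have := ltij 0 a; have := ltij a 0; rewrite !rmorph0.
by do 2!case: sgzP => ?; rewrite ?ltxx //; do ?[move=> ->|move/esym].
Qed.

Let nth_root_K (x : K) k : 0 <= x -> (0 < k)%N -> exists2 t, 0 <= t & t ^+ k = x.
Proof.
move=> x0 k0; have [||t /andP[t0 _]] := @poly_ivt K ('X^k - x%:P) 0 (1 + x).
- by rewrite addr_ge0.
- rewrite !hornerE expr0n gtn_eqF // sub0r oppr_le0 x0 /= subr_ge0.
  apply: (@le_trans _ _ (1 + x)); first by rewrite lerDr.
  by rewrite ler_eXnr // lerDl.
by rewrite /root !hornerE subr_eq0 => /eqP; exists t.
Qed.

Let root_F (a : F) k : 0 <= i a -> (0 < k)%N -> exists t, t ^+ k = a.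
Proof.
move=> a0 k0; have [t _ tE] := nth_root_K a0 k0.
have [||s sE] := @relF ('X^k - a%:P) t.
- by rewrite monic_neq0 // monicXnsubC.
- by rewrite rmorphB /= map_polyXn map_polyC /root !hornerE tE subrr.
by exists s; apply: (fmorph_inj i); rewrite rmorphXn -sE tE.
Qed.

Let F_sqr_or_opp (a : F) : exists c, a = c ^+ 2 \/ a = - c ^+ 2.
Proof.
have [a0|/ltW a0] := leP 0 (i a).
  by have [c <-] := root_F a0 (isT : (0 < 2)%N); exists c; left.
have [|c cE] := @root_F (- a) 2 _ isT; first by rewrite rmorphN oppr_ge0.
by exists c; right; rewrite cE opprK.
Qed.

Let F_sqrD (a b : F) : exists c, a ^+ 2 + b ^+ 2 = c ^+ 2.
Proof.
have [|c <-] := @root_F (a ^+ 2 + b ^+ 2) 2 _ isT; last by exists c.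
by rewrite rmorphD !rmorphXn addr_ge0 ?sqr_ge0.
Qed.

Let F_sqr_neqN1 (a : F) : a ^+ 2 != -1.
Proof.
rewrite -(inj_eq (fmorph_inj i)) rmorphXn rmorphN1 gt_eqF //.
by rewrite (lt_le_trans _ (sqr_ge0 _)) // oppr_lt0.
Qed.

Let F_odd_root (p : {poly F}) : ~~ odd (size p) -> p != 0 -> exists x, root p x.
Proof.
move=> sp p0; have [|r pr] := @odd_poly_root K (map_poly i p); first by rewrite size_map_poly.
have [a aE] := relF p0 pr; exists a.
by move: pr; rewrite aE /root horner_map fmorph_eq0.
Qed.

(** [F] satisfies the hypotheses of [real_poly_ind], because roots in [K] of non-zero polynomials
    over [F] lie in [F]. *)
Let factorization (f : {poly F}) : exists c ra qd,
  f = of_factors c ra qd /\ {in qd, forall u, u.2 != 0}.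
Proof.
elim/(real_poly_ind F_sqr_or_opp F_sqrD F_sqr_neqN1 F_odd_root): f.
- by move=> c; exists c, [::], [::]; rewrite /of_factors !big_nil -mul_polyC !mulr1.
- move=> _ a [c [ra [qd [-> qdP]]]]; exists c, (a :: ra), qd; split=> //.
  by rewrite /of_factors big_cons -!scalerAl; congr (_ *: _); ring.
move=> _ a b b0 [c [ra [qd [-> qdP]]]]; exists c, ra, ((a, b) :: qd); split.
  by rewrite /of_factors big_cons -!scalerAl; congr (_ *: _); rewrite /=; ring.
by move=> u; rewrite inE => /orP[/eqP->|/qdP].
Qed.

Section Point.
Variables (b : K) (fs : seq {poly F}).

(* The norms of b - c, for c in C, are those of s or of constants d c of F; a
   point b' whose differences b' - c are described in the same way by e in
   place of s has the type of b, if s and e satisfy the same finitely many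
   comparisons between monomials. *)
Let transfer_at (near cmp : pred F) (d : F -> F) (C B : seq F) (s : K) : s != 0 ->
    (forall f, f \in fs -> exists c ra qd, [/\ f = of_factors c ra qd,
       {in qd, forall u, u.2 != 0}, {subset ra <= C},
       {subset map fst qd <= C} & {subset map snd qd <= B}]) ->
    {in C, forall c, veq vK (b - i c) (if near c then s else i (d c))} ->
    {in B, forall c, vK s (i c) = cmp c} ->
  exists qs : seq (F * F * nat * nat), forall (b' e : L),
    {in qs, forall q, let: (A, B, n, m) := q in
      vK (i A * s ^+ n) (i B * s ^+ m) = vL (j A * e ^+ n) (j B * e ^+ m)} ->
    {in C, forall c, sgz (b - i c) = sgz (b' - j c)} ->
    {in C, forall c, veq vL (b' - j c) (if near c then e else j (d c))} ->
    {in B, forall c, vL e (j c) = cmp c} ->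
    {in fs, forall f, sgz (map_poly i f).[b] = sgz (map_poly j f).[b']} /\
    {in fs &, forall f g,
      vK (map_poly i f).[b] (map_poly i g).[b] = vL (map_poly j f).[b'] (map_poly j g).[b']}.
Proof.
move=> s0 fsP CK BK.
pose leF a a' := vK (i a) (i a').
have mon f : exists An : F * nat, f \in fs ->
    veq vK (map_poly i f).[b] (i An.1 * s ^+ An.2) /\
    forall b' e : L,
      {in C, forall c, veq vL (b' - j c) (if near c then e else j (d c))} ->
      {in B, forall c, vL e (j c) = cmp c} ->
      veq vL (map_poly j f).[b'] (j An.1 * e ^+ An.2).
  have [f_in|] := boolP (f \in fs); last by exists (0, 0%N).
  have [c [ra [qd [-> _ raC qC qB]]]] := fsP f f_in.
  have [A [n AnP]] := monomial_value leF near cmp d c ra qd.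
  exists (A, n) => _; split=> [|b' e CL BL].
    apply: AnP => // [a /raC/CK//|u u_in]; split; first exact/CK/qC/map_f.
    exact/BK/qB/map_f.
  apply: AnP => // [a a'|a /raC/CL//|u u_in]; first by rewrite -vij.
  split; first exact/CL/qC/map_f.
  exact/BL/qB/map_f.
pose An f := sval (cid (mon f)); have AnP f : _ := svalP (cid (mon f)).
exists [seq ((An f).1, (An g).1, (An f).2, (An g).2) | f <- fs, g <- fs].
move=> b' e qsP sgC CL BL; split=> [f f_in|f g f_in g_in].
  have [c [ra [qd [-> qd0 raC _ _]]]] := fsP f f_in.
  by apply: sgz_of_factors => // a /raC/sgC.
have [fK fL] := AnP f f_in; have [gK gL] := AnP g g_in.
rewrite (veq_v vKP fK gK) (veq_v vLP (fL b' e CL BL) (gL b' e CL BL)).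
apply: (qsP ((An f).1, (An g).1, (An f).2, (An g).2)).
exact: (allpairs_f (fun f g => ((An f).1, (An g).1, (An f).2, (An g).2))).
Qed.

Let monomial_hyps :
  (forall (a : F) k, (0 < k)%N -> exists t, veq vK (i (t ^+ k)) (i a)) /\
  (forall a : L, exists t, veq vL (t ^+ 2) a).
Proof.
have veqN (E : fieldType) (v : rel E) (vP : valuation_rel v) x : veq v (- x) x.
  by rewrite /veq (vNl vP) (vNr vP) (vxx vP).
split=> [a k k0|a].
  have [a0|/ltW a0] := leP 0 (i a).
    by have [t <-] := root_F a0 k0; exists t; apply: veq_refl.
  have [|t tE] := @root_F (- a) k _ k0; first by rewrite rmorphN oppr_ge0.
  by exists t; rewrite tE rmorphN; apply: veqN.
exists (Num.sqrt `|a|); rewrite sqr_sqrtr //.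
by case: (ger0P a) => _; [apply: veq_refl|apply: veqN].
Qed.

Variables (C B : seq F).
Hypothesis fsP : forall f, f \in fs -> exists c ra qd, [/\ f = of_factors c ra qd,
  {in qd, forall u, u.2 != 0}, {subset ra <= C},
  {subset map fst qd <= C} & {subset map snd qd <= B}].

Definition same_type (b' : L) :=
  {in fs, forall f, sgz (map_poly i f).[b] = sgz (map_poly j f).[b']} /\
  {in fs &, forall f g,
    vK (map_poly i f).[b] (map_poly i g).[b] = vL (map_poly j f).[b'] (map_poly j g).[b']}.

(* c0 is a point of C nearest to b, and sigma = 1 or -1 tells on which side of
   c0 the point b lies; no point of C on that side is as near to c0 as b is, and
   b' is chosen of the form c0 + sigma |e|. *)
Lemma one_sided_type (c0 sigma : F) : c0 \in C -> sigma ^+ 2 = 1 ->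
    0 < i sigma * (b - i c0) ->
    {in C, forall c, vK (b - i c0) (b - i c)} ->
    {in C, forall c, vK (i (c0 - c)) (i sigma * (b - i c0)) -> 0 <= i (sigma * (c0 - c))} ->
  exists b', same_type b'.
Proof.
move=> c0_in sigma2 s_gt0 c0_min side.
set s := i sigma * (b - i c0); have s0 : s != 0 by rewrite gt_eqF.
pose near c := vK (i (c0 - c)) s; pose cmp c := vK s (i c).
have sgm (E : fieldType) (h : {rmorphism F -> E}) : h sigma * h sigma = 1.
  by rewrite -rmorphM -expr2 sigma2 rmorph1.
have sgmv (E : fieldType) (v : rel E) (h : {rmorphism F -> E}) (x : E) :
    valuation_rel v -> veq v (h sigma * x) x.
  move=> vP; have : (sigma == 1) || (sigma == -1) by rewrite -sqrf_eq1 sigma2.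
  case/orP => /eqP->; rewrite ?rmorph1 ?rmorphN1 ?mul1r ?mulN1r ?(veq_refl vP) //.
  by rewrite /veq (vNl vP) (vNr vP) (vxx vP).
have sb : b - i c0 = i sigma * s by rewrite /s mulrA sgm mul1r.
have bE c : b - i c = i sigma * s + i (c0 - c) by rewrite -sb rmorphB; ring.
have ss : veq vK (i sigma * s) s by apply: sgmv.
have CK : {in C, forall c, veq vK (b - i c) (if near c then s else i (c0 - c))}.
  move=> c c_in; rewrite /near; case: ifP => cs; last first.
    have lt : ~~ vK (i (c0 - c)) (i sigma * s).
      by rewrite (veq_v vKP (veq_refl vKP _) ss) cs.
    by rewrite bE /veq !(vadd_dominant vKP lt) (vxx vKP).
  apply: (veq_trans vKP _ ss); apply/andP; split.
    rewrite bE; apply: (vadd vKP); first exact: (vxx vKP).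
    by rewrite (veq_v vKP (veq_refl vKP _) ss).
  by rewrite -sb; apply: c0_min.
have [qs qsP] := transfer_at s0 fsP CK (fun c _ => erefl (cmp c)).
have [rootF sqrtL] := monomial_hyps.
(* The two added blocks make [e] agree with [s] on [near] over [C] and on [cmp] over [B]. *)
have [e e0 eP] := monomial_transfer vKP vLP vij rootF sqrtL nontrivialL
  (qs ++ [seq (c0 - c, 1, 0%N, 1%N) | c <- C] ++ [seq (1, c, 1%N, 0%N) | c <- B]) s0.
have eN : veq vL `|e| e.
  by case: (ger0P e) => _; rewrite /veq ?(vNl vLP) ?(vNr vLP) (vxx vLP).
have ePow n : veq vL (`|e| ^+ n) (e ^+ n).
  by elim: n => [|n IHn]; rewrite ?expr0 ?(veq_refl vLP) // !exprS (veq_mul vLP).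
have near_L c : c \in C -> vL (j (c0 - c)) `|e| = near c.
  move=> c_in; rewrite (veq_v vLP (veq_refl vLP _) eN).
  have := eP (c0 - c, 1, 0%N, 1%N); rewrite !mem_cat map_f ?orbT // => /(_ isT).
  by rewrite !expr0 !expr1 !mulr1 !rmorph1 !mul1r.
have cmp_L c : c \in B -> vL `|e| (j c) = cmp c.
  move=> c_in; rewrite (veq_v vLP eN (veq_refl vLP _)).
  have := eP (1, c, 1%N, 0%N).
  rewrite !mem_cat (map_f (fun c => (1, c, 1%N, 0%N))) ?orbT // => /(_ isT).
  by rewrite !expr0 !expr1 !mulr1 !rmorph1 !mul1r.
have e_gt0 : 0 < `|e| by rewrite normr_gt0.
exists (j c0 + j sigma * `|e|); apply: qsP cmp_L.
- move=> [[[A A'] n] m] q_in; have /= := eP (A, A', n, m).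
  rewrite mem_cat q_in => /(_ isT) ->.
  by apply: (veq_v vLP); apply: (veq_mul vLP); rewrite ?(veq_refl vLP) // veq_sym.
- move=> c c_in; have b'E : j c0 + j sigma * `|e| - j c = j sigma * `|e| + j (c0 - c).
    by rewrite rmorphB; ring.
  (* For far [c] the summand [c0 - c] dominates in norm, hence in absolute value; for near [c] it is
     zero or has the sign of [sigma], so nothing cancels. *)
  rewrite bE b'E; have [cs|cs] := boolP (near c); last first.
    have ltK : `|i sigma * s| < `|i (c0 - c)|.
      apply: (vlt_norm vKP convK); rewrite (veq_v vKP (veq_refl vKP _) ss).
      exact: cs.
    have ltL : `|j sigma * `|e| | < `|j (c0 - c)|.
      apply: (vlt_norm vLP convL).
      by rewrite (veq_v vLP (veq_refl vLP _) (sgmv _ _ j _ vLP)) near_L.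
    by rewrite !sgz_add_dominant // sgz_ij.
  have pos := side c c_in cs.
  have sgE (E : realFieldType) (h : {rmorphism F -> E}) (x : E) :
      0 < x -> 0 <= h (sigma * (c0 - c)) ->
      sgz (h sigma * x + h (c0 - c)) = sgz (h sigma).
    move=> x0 h0; have -> : h (c0 - c) = h sigma * h (sigma * (c0 - c)).
      by rewrite rmorphM mulrA sgm mul1r.
    by rewrite -mulrDr sgzM [sgz (_ + _)]gtr0_sgz ?mulr1 // ltr_wpDr.
  have posL : 0 <= j (sigma * (c0 - c)) by rewrite -(rmorph0 j) -leij rmorph0.
  by rewrite (sgE _ _ _ s_gt0 pos) (sgE _ _ _ e_gt0 posL) sgz_ij.
move=> c c_in; have b'E : j c0 + j sigma * `|e| - j c = j sigma * `|e| + j (c0 - c).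
  by rewrite rmorphB; ring.
have ee := sgmv _ _ j `|e| vLP.
rewrite b'E; case: ifP => cs; last first.
  have lt : ~~ vL (j (c0 - c)) (j sigma * `|e|).
    by rewrite (veq_v vLP (veq_refl vLP _) ee) near_L // cs.
  by rewrite /veq !(vadd_dominant vLP lt) (vxx vLP).
have -> : j (c0 - c) = j sigma * j (sigma * (c0 - c)).
  by rewrite rmorphM mulrA sgm mul1r.
rewrite -mulrDr; apply: (veq_trans vLP (sgmv _ _ j _ vLP)).
apply: (convex_sum_ge0 vLP convL); first exact: ltW.
  by rewrite -(rmorph0 j) -leij rmorph0; apply: side.
by rewrite rmorphM (veq_v vLP (sgmv _ _ j _ vLP) (veq_refl vLP _)) near_L.
Qed.

(** A point of [C] above [b] is too far from [b] to be near [l], by convexity; hence all near points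
    lie at or below [l], away from [b]. *)
Lemma type_from_below l : l \in C -> i l < b ->
    {in C, forall c, i c <= i l \/ b < i c /\ ~~ vK (b - i c) (b - i l)} ->
  exists b', same_type b'.
Proof.
move=> l_in lb lC; apply: (@one_sided_type l 1) => //.
- by rewrite expr1n.
- by rewrite rmorph1 mul1r subr_gt0.
- move=> c /lC[cl|[_ /(vltW vKP)//]].
  by apply: convK; rewrite ?subr_ge0 ?lerD2l ?lerN2 // ltW.
move=> c /lC[cl _|[bc lt]]; first by rewrite mul1r rmorphB subr_ge0.
rewrite rmorph1 mul1r rmorphB => near; case/negP: lt; apply: (vxx_trans vKP _ near).
rewrite -(vNl vKP) -(vNr vKP) !opprB.
by apply: convK; rewrite ?subr_ge0 ?lerD2l ?lerN2 // ltW.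
Qed.

Lemma type_from_above r : r \in C -> b < i r ->
    {in C, forall c, i r <= i c \/ i c < b /\ ~~ vK (b - i c) (b - i r)} ->
  exists b', same_type b'.
Proof.
move=> r_in br rC; apply: (@one_sided_type r (-1)) => //.
- by rewrite sqrrN expr1n.
- by rewrite rmorphN1 mulN1r opprB subr_gt0.
- move=> c /rC[rc|[_ /(vltW vKP)//]]; rewrite -(vNl vKP) -(vNr vKP) !opprB.
  by apply: convK; rewrite ?subr_ge0 ?lerD2r // ltW.
move=> c /rC[rc _|[cb lt]]; first by rewrite mulN1r rmorphN rmorphB opprB subr_ge0.
rewrite rmorphN1 mulN1r opprB rmorphB => near; case/negP: lt.
rewrite -(vNr vKP) opprB; apply: (vxx_trans vKP _ near).
by apply: convK; rewrite ?subr_ge0 ?lerD2r // ltW.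
Qed.

(** If [l] and [r] are equally far from [b] in norm, every |b - c| is |r - c| or |l - c|, the norm
    of an element of [F]. The midpoint of the gap has the same norms, as sums of non-negative
    elements do not cancel. *)
Lemma midpoint_type l r : i l < b -> b < i r -> veq vK (b - i l) (b - i r) ->
    {in C, forall c, i c <= i l \/ i r <= i c} ->
  exists b', same_type b'.
Proof.
move=> lb br lr lrC.
have add (E : realFieldType) (v : rel E) (x y z : E) : valuation_rel v -> convex_rel v ->
    0 <= x -> 0 <= y -> 0 <= z -> v z x -> veq v (x + y) (z + (x + y)).
  move=> vP conv x0 y0 z0 zx; apply/andP; split.
    by apply: conv; rewrite ?addr_ge0 // lerDr.
  apply: (vadd vP); last exact: (vxx vP).
  by apply: (vxx_trans vP zx); apply: conv; rewrite // lerDl.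
have veqN (E : fieldType) (v : rel E) (x y : E) : valuation_rel v -> veq v (- x) (- y) = veq v x y.
  by move=> vP; rewrite /veq !(vNl vP) !(vNr vP).
have lr_lt : i l < i r := lt_trans lb br.
pose d c := if i c <= i l then r - c else l - c.
have CK : {in C, forall c, veq vK (b - i c) (if pred0 c then 1 else i (d c))}.
  move=> c /lrC c_in; rewrite /= /d; case: ifP => cl.
    have -> : b - i c = (b - i l) + (i l - i c) by ring.
    have -> : i (r - c) = (i r - b) + ((b - i l) + (i l - i c)) by rewrite rmorphB; ring.
    apply: add => //; rewrite ?subr_ge0 // 1?ltW //.
    by rewrite -(vNl vKP) opprB; case/andP: lr.
  have rc : i r <= i c by case: c_in => //; rewrite cl.
  rewrite -veqN //.
  have -> : - (b - i c) = (i r - b) + (i c - i r) by ring.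
  have -> : - i (l - c) = (b - i l) + ((i r - b) + (i c - i r)) by rewrite rmorphB; ring.
  apply: add => //; rewrite ?subr_ge0 // 1?ltW //.
  by rewrite -(vNr vKP) opprB; case/andP: lr.
(* No free parameter is left: [near] is empty, and 1 stands for both [s] and [e]. *)
have [qs qsP] := @transfer_at pred0 (fun c => vK 1 (i c)) d C B 1 (oner_neq0 K) fsP CK
  (fun c _ => erefl (vK 1 (i c))).
pose u := (j r - j l) / 2%:R; have u_gt0 : 0 < u.
  by rewrite divr_gt0 // subr_gt0 -ltij.
have u0 := ltW u_gt0.
have ujr : j r = j l + u + u by rewrite /u; field.
exists (j l + u); apply: (qsP _ 1).
- move=> [[[A A'] n] m] _; rewrite !expr1n !mulr1; exact: vij.
- move=> c /lrC[cl|rc].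
    have b_gt0 : 0 < b - i c by rewrite subr_gt0 (le_lt_trans cl).
    have b'_gt0 : 0 < j l + u - j c.
      have -> : j l + u - j c = u + (j l - j c) by ring.
      by rewrite ltr_wpDr // subr_ge0 -leij.
    by rewrite !gtr0_sgz.
  have b_lt0 : b - i c < 0 by rewrite subr_lt0 (lt_le_trans br).
  have b'_lt0 : j l + u - j c < 0.
    have -> : j l + u - j c = - (u + (j c - j r)) by rewrite ujr; ring.
    by rewrite oppr_lt0 ltr_wpDr // subr_ge0 -leij.
  by rewrite !ltr0_sgz.
- move=> c /lrC c_in; rewrite /= /d; case: ifP => cl.
    have -> : j l + u - j c = u + (j l - j c) by ring.
    have -> : j (r - c) = u + (u + (j l - j c)) by rewrite rmorphB ujr; ring.
    by apply: add => //; rewrite ?(vxx vLP) // subr_ge0 -leij.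
  have rc : i r <= i c by case: c_in => //; rewrite cl.
  rewrite -veqN //.
  have -> : - (j l + u - j c) = u + (j c - j r) by rewrite ujr; ring.
  have -> : - j (l - c) = u + (u + (j c - j r)) by rewrite rmorphB ujr; ring.
  by apply: add => //; rewrite ?(vxx vLP) // subr_ge0 -leij.
by move=> c _; rewrite -(rmorph1 i) -(rmorph1 j) vij.
Qed.
End Point.

(** The neighbours of [b] in [C] decide. If one is missing, or one is strictly nearer in norm, the
    point is placed on one side of the remaining or nearer one; at equal norms the midpoint serves.
    Since 0 is in [C], some neighbour exists. *)
Theorem real_transcendental_step (b : K) (fs : seq {poly F}) : (forall a, b != i a) ->
  exists b' : L, {in fs &, forall f g,
    ((map_poly i f).[b] <= (map_poly i g).[b]) = ((map_poly j f).[b'] <= (map_poly j g).[b']) /\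
    vK (map_poly i f).[b] (map_poly i g).[b] = vL (map_poly j f).[b'] (map_poly j g).[b']}.
Proof.
(* With the differences added, order comparisons become signs. *)
move=> bNF; pose gs := fs ++ [seq g - f | f <- fs, g <- fs].
suff [b' [sgP vP]] : exists b', same_type b gs b'.
  exists b' => f g f_in g_in; split; last by apply: vP; rewrite mem_cat ?f_in ?g_in.
  have fg : g - f \in gs.
    by rewrite mem_cat (allpairs_f (fun f g => g - f)) ?orbT.
  rewrite -subr_ge0 -[RHS]subr_ge0 -[LHS]sgz_ge0 -[RHS]sgz_ge0.
  by have := sgP _ fg; rewrite !rmorphB /= !hornerD !hornerN => ->.
have facP f : exists D : F * seq F * seq (F * F), f = of_factors D.1.1 D.1.2 D.2 /\
    {in D.2, forall u, u.2 != 0}.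
  by have [c [ra [qd H]]] := factorization f; exists (c, ra, qd).
pose D f := sval (cid (facP f)); have DP f : _ := svalP (cid (facP f)).
pose C := 0 :: flatten [seq (D f).1.2 ++ map fst (D f).2 | f <- gs].
pose B := flatten [seq map snd (D f).2 | f <- gs].
have gsP f : f \in gs -> exists c ra qd, [/\ f = of_factors c ra qd,
    {in qd, forall u, u.2 != 0}, {subset ra <= C},
    {subset map fst qd <= C} & {subset map snd qd <= B}].
  move=> f_in; exists (D f).1.1, (D f).1.2, (D f).2; have [fE qd0] := DP f.
  split=> // c c_in; rewrite ?inE.
  - by apply/orP; right; apply/flatten_mapP; exists f; rewrite // mem_cat c_in.
  - by apply/orP; right; apply/flatten_mapP; exists f; rewrite // mem_cat c_in orbT.
  by apply/flatten_mapP; exists f.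
have maxP (E : realDomainType) (h : F -> E) (l : seq F) : l != [::] ->
    exists2 m, m \in l & {in l, forall c, h c <= h m}.
  elim: l => // a [_ _|a' l IHl _].
    by exists a; rewrite ?mem_seq1 // => c; rewrite mem_seq1 => /eqP->.
  have [//|m m_in mP] := IHl; have [am|ma] := leP (h a) (h m).
    exists m; first by rewrite inE m_in orbT.
    by move=> c; rewrite inE => /orP[/eqP->//|/mP].
  exists a; first by rewrite inE eqxx.
  move=> c; rewrite inE => /orP[/eqP->//|/mP cm].
  exact: le_trans cm (ltW ma).
have C_split c : i c < b \/ b < i c.
  by case: (ltgtP (i c) b) => [|bc|cb]; [left|right|have := bNF c; rewrite cb eqxx].
pose lo := [seq c <- C | i c < b]; pose up := [seq c <- C | b < i c].
have lo_in c : c \in C -> i c < b -> c \in lo by rewrite mem_filter => -> ->.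
have up_in c : c \in C -> b < i c -> c \in up by rewrite mem_filter => -> ->.
have lowest : lo = [::] \/ exists l, [/\ l \in C, i l < b &
    {in C, forall c, i c < b -> i c <= i l}].
  have [|lo0] := eqVneq lo [::]; [by left|right].
  have [l] := maxP _ i lo lo0; rewrite mem_filter => /andP[lb l_in] lP.
  by exists l; split=> // c c_in cb; apply: lP; apply: lo_in.
have highest : up = [::] \/ exists r, [/\ r \in C, b < i r &
    {in C, forall c, b < i c -> i r <= i c}].
  have [|up0] := eqVneq up [::]; [by left|right].
  have [r] := maxP _ (fun c => - i c) up up0; rewrite mem_filter => /andP[rb r_in] rP.
  by exists r; split=> // c c_in cb; rewrite -lerN2; apply: rP; apply: up_in.
case: lowest highest => [lo0|[l [l_in lb lP]]] [up0|[r [r_in br rP]]].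
- have C0 : 0 \in C by rewrite inE eqxx.
  case: (C_split 0) => [/(lo_in 0 C0)|/(up_in 0 C0)]; first by rewrite lo0.
  by rewrite up0.
- apply: (type_from_above gsP r_in br) => c c_in; left.
  by case: (C_split c) => [/(lo_in c c_in)|/(rP c c_in)//]; rewrite lo0.
- apply: (type_from_below gsP l_in lb) => c c_in; left.
  by case: (C_split c) => [/(lP c c_in)//|/(up_in c c_in)]; rewrite up0.
have [lr|lr] := boolP (vK (b - i r) (b - i l)); last first.
  apply: (type_from_below gsP l_in lb) => c c_in.
  case: (C_split c) => [/(lP c c_in)|bc]; [by left|right; split=> //].
  apply: (vlt_le_trans vKP lr); rewrite -(vNl vKP) -(vNr vKP) !opprB.
  by apply: convK; rewrite ?subr_ge0 ?lerD2r ?rP // ltW.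
have [rl|rl] := boolP (vK (b - i l) (b - i r)); last first.
  apply: (type_from_above gsP r_in br) => c c_in.
  case: (C_split c) => [cb|/(rP c c_in)]; [right; split=> //|by left].
  apply: (vlt_le_trans vKP rl).
  by apply: convK; rewrite ?subr_ge0 ?lerD2l ?lerN2 ?lP // ltW.
apply: (midpoint_type gsP lb br); first by rewrite /veq rl lr.
by move=> c c_in; case: (C_split c) => [/(lP c c_in)|/(rP c c_in)]; [left|right].
Qed.
End RealStep.

(** * The models *)

Definition structure_of (K : fieldType) (le v : rel K) : structure :=
  @Structure K +%R *%R -%R (fun x y => le x y) (fun x y => v x y) 0 1.

Section ModelField.
Variables (M : structure) (HM : is_field M).

(** The proof is an argument of the type, so that the field instances are found from the type
    alone. *)
Definition model_field (_ : is_field M) : Type := carrier M.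
Local Notation K := (model_field HM).

HB.instance Definition _ := gen_eqMixin K.
HB.instance Definition _ := gen_choiceMixin K.

Let addA : associative (@s_add M : K -> K -> K). Proof. by case: HM. Qed.
Let addC : commutative (@s_add M : K -> K -> K). Proof. by case: HM. Qed.
Let add0 : left_id (s_zero : K) (@s_add M : K -> K -> K). Proof. by case: HM. Qed.
Let addN : left_inverse (s_zero : K) (@s_opp M : K -> K) (@s_add M : K -> K -> K).
Proof. by case: HM. Qed.
HB.instance Definition _ := GRing.isZmodule.Build K addA addC add0 addN.

Let mulA : associative (@s_mul M : K -> K -> K). Proof. by case: HM. Qed.
Let mulC : commutative (@s_mul M : K -> K -> K). Proof. by case: HM. Qed.
Let mul1 : left_id (s_one : K) (@s_mul M : K -> K -> K). Proof. by case: HM. Qed.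
Let mulDl : left_distributive (@s_mul M : K -> K -> K) +%R. Proof. by case: HM. Qed.
Let one_neq0 : (s_one : K) != 0. Proof. by apply/eqP; case: HM. Qed.
HB.instance Definition _ :=
  GRing.Zmodule_isComNzRing.Build K mulA mulC mul1 mulDl one_neq0.

Let mulV_ex (x : K) : x != 0 -> exists y, y * x = 1.
Proof.
have inv : forall a : M, a <> s_zero -> exists b, s_mul a b = s_one by case: HM.
by move=> /eqP/(inv x)[y xy]; exists (y : K); rewrite mulrC.
Qed.

Definition model_inv (x : K) : K :=
  if pselect (x != 0) is left x0 then sval (cid (mulV_ex x0)) else 0.

Let mulVf : forall x : K, x != 0 -> model_inv x * x = 1.
Proof. by move=> x x0; rewrite /model_inv; case: pselect => // h; case: cid. Qed.

Let invr0 : model_inv 0 = 0.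
Proof. by rewrite /model_inv; case: pselect => // h; case/eqP: (h). Qed.

HB.instance Definition _ := GRing.ComNzRing_isField.Build K mulVf invr0.

Lemma structure_ofE (le v : rel K) :
  (forall x y, le x y <-> s_le x y) -> (forall x y, v x y <-> s_lev x y) ->
  structure_of le v = M.
Proof.
move=> leE vE; have -> : M = Structure (@s_add M) (@s_mul M) (@s_opp M)
  (@s_le M) (@s_lev M) s_zero s_one by case: (M).
rewrite /structure_of; congr Structure.
  by apply/funext => x; apply/funext => y; apply/propext/leE.
by apply/funext => x; apply/funext => y; apply/propext/vE.
Qed.

Lemma model_pow (x : K) n : pow x n = x ^+ n.
Proof. by elim: n => [|n IHn] //=; rewrite IHn exprS. Qed.

Lemma model_poly_eval (c : nat -> M) d (x : K) :
  poly_eval c d x = (\poly_(k < d.+1) (c k : K)).[x].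
Proof.
rewrite horner_poly; elim: d => [|d IHd] /=; first by rewrite big_ord1 expr0 mulr1.
by rewrite IHd -[s_mul x _]/(pow x d.+1) model_pow [RHS]big_ord_recr.
Qed.

Lemma model_root (p : {poly K}) d : has_roots M d -> size p = d.+1 -> exists x, root p x.
Proof.
move=> roots sp; have pd0 : p`_d != 0.
  by rewrite -[d]/(d.+1.-1) -sp -lead_coefE lead_coef_eq0 -size_poly_eq0 sp.
have [x px] := roots (fun k => p`_k : K) (elimN eqP pd0).
exists (x : K); apply/eqP; have := model_poly_eval (fun k => p`_k : K) d x.
by rewrite px -sp coefK => <-.
Qed.

(** * A quasi-ordering in which -1 is negative is a field ordering *)

Section Order.
Hypothesis Hle : is_quasi_order (@s_le M).
Hypothesis neg : prec (@s_le M) (s_opp s_one) s_zero.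

Let le (x y : K) : Prop := @s_le M x y.

Let le_refl x : le x x. Proof. by case: Hle => + _ _ _ _ _; apply. Qed.
Let le_trans y x z : le x y -> le y z -> le x z.
Proof. by case: Hle => _ + _ _ _ _; apply. Qed.
Let le_total x y : le x y \/ le y x. Proof. by case: Hle => _ _ + _ _ _; apply. Qed.
Let le_anti0 x : le x 0 -> le 0 x -> x = 0.
Proof. by move=> x0 x0'; case: Hle => _ _ _ + _ _; apply. Qed.
Let le_mul x y z : le x y -> le 0 z -> le (x * z) (y * z).
Proof. by case: Hle => _ _ _ _ + _; apply. Qed.
Let le_add' x y z : le x y -> ~ (le z y /\ le y z) -> le (x + z) (y + z).
Proof. by case: Hle => _ _ _ _ _; apply. Qed.

Let le_N1 : le (-1) 0. Proof. by case: neg. Qed.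
Let not_le_N1 : ~ le 0 (-1). Proof. by case: neg => h n h'; apply: n. Qed.

Let le0N x : le 0 x -> le (- x) 0.
Proof. by move=> /(le_mul le_N1); rewrite mulN1r mul0r. Qed.

Let leN0 x : le x 0 -> le 0 (- x).
Proof.
have [->|/eqP x0 lex] := eqVneq x 0; first by rewrite oppr0.
have := @le_add' x 0 (- x) lex; rewrite subrr add0r; apply=> -[h h'].
by apply: x0; rewrite -[x]opprK (le_anti0 h h') oppr0.
Qed.

Let le_selfN y : le y (- y) -> le (- y) y -> y = 0.
Proof.
move=> yN Ny; case: (le_total 0 y) => y0; apply: le_anti0 => //.
  exact: le_trans yN (le0N y0).
exact: le_trans (leN0 y0) Ny.
Qed.

(** (Q2) allows adding [- y] unless [- y] is equivalent to [y]; that forces [y = 0], where (Q0)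
    applies. *)
Let le_anti x y : le x y -> le y x -> x = y.
Proof.
move=> xy yx; have [[h h']|nyy] := pselect (le (- y) y /\ le y (- y)).
  have y0 := le_selfN h' h; rewrite y0 in xy yx *; exact: le_anti0.
have le1 : le (x - y) 0 by rewrite -(subrr y); apply: le_add'.
have le2 : le 0 (x - y).
  rewrite -{1}(subrr y); apply: le_add' => // -[h h'].
  by apply: nyy; split; [apply: le_trans h xy|apply: le_trans yx h'].
by apply/eqP; rewrite -subr_eq0 (le_anti0 le1 le2).
Qed.

Let le_01 : le 0 1.
Proof.
have := @le_add' (-1) 0 1 le_N1; rewrite addNr add0r; apply=> -[h h'].
by have /eqP := le_anti h h'; rewrite oner_eq0.
Qed.

Let le_02 : le 0 (1 + 1).
Proof.
have two0 : 1 + 1 != 0 :> K.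
  apply/eqP => two; apply: not_le_N1.
  by rewrite (_ : -1 = 1) //; apply/eqP; rewrite eq_sym -addr_eq0 two.
apply: (le_trans le_01); have := @le_add' (-1) 0 (1 + 1) le_N1.
rewrite addrA addNr !add0r; apply=> -[h h'].
by move/eqP: two0; apply; apply: le_anti.
Qed.

Let le_double y : le 0 y -> le 0 (y + y).
Proof. by move=> /(le_mul le_02); rewrite mul0r mulrDl mul1r. Qed.

(** Given antisymmetry, (Q2) leaves out only [z = y]. Then [y + y <= x + y] can be reduced by [- y]
    unless [x + y = - y], and the sign of [y] settles that case. *)
Let le_add x y z : le x y -> le (x + z) (y + z).
Proof.
move=> xy; have [zy|/eqP nzy] := eqVneq z y; last first.
  by apply: le_add' => // -[h h']; apply/nzy/le_anti.
rewrite {z}zy; case: (le_total (x + y) (y + y)) => // yx.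
have [xyE|/eqP nxy] := eqVneq (- y) (x + y); last first.
  have : le (y + y - y) (x + y - y).
    by apply: le_add' => // -[h h']; apply/nxy/le_anti.
  by rewrite !addrK => /(le_anti xy)->.
case: (le_total 0 y) => y0.
  by rewrite -xyE; apply: (le_trans (le0N y0)); apply: le_double.
have xE : x = - y + - y by rewrite {2}xyE; ring.
have x0 : x = 0.
  apply: le_anti; first exact: le_trans xy y0.
  by rewrite xE; apply/le_double/leN0.
rewrite x0 in xy *; rewrite (le_anti y0 xy); exact: le_refl.
Qed.

Definition ordered_model (_ : prec (@s_le M) (s_opp s_one) s_zero) : Type := K.
Local Notation R := (ordered_model neg).
HB.instance Definition _ := GRing.Field.on R.

Let leb : rel R := fun x y => `[< le x y >].
Let normb (x : R) : R := if leb 0 x then x else - x.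

Let leb0_add x y : leb 0 x -> leb 0 y -> leb 0 (x + y).
Proof.
move=> /asboolP x0 /asboolP y0; apply/asboolP; apply: (le_trans x0).
by rewrite -[X in le X _]add0r [x + y]addrC; apply: le_add.
Qed.

Let leb0_mul x y : leb 0 x -> leb 0 y -> leb 0 (x * y).
Proof.
move=> /asboolP x0 /asboolP y0; apply/asboolP.
by have := le_mul x0 y0; rewrite mul0r.
Qed.

Let leb0_anti x : leb 0 x -> leb x 0 -> x = 0.
Proof. by move=> /asboolP x0 /asboolP x0'; apply: le_anti. Qed.

Let leb_sub x y : leb 0 (y - x) = leb x y.
Proof.
apply/asboolP/asboolP => [/(le_add x)|/(le_add (- x))].
  by rewrite add0r subrK.
by rewrite subrr.
Qed.

Let leb0_total x : leb 0 x || leb x 0.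
Proof.
by apply/orP; case: (le_total 0 x) => h; [left|right]; apply/asboolP.
Qed.

Let normbN x : normb (- x) = normb x.
Proof.
rewrite /normb opprK; have [x0|x0] := boolP (leb 0 x).
  case: ifP => // Nx; apply/eqP; rewrite eq_sym -addr_eq0; apply/eqP.
  have -> : x = 0; last by rewrite addr0.
  apply: leb0_anti => //; apply/asboolP; have /asboolP := Nx.
  by move/(le_add x); rewrite add0r addNr.
case: ifP => // /negP Nx; case: Nx; apply/asboolP; apply: leN0.
by have := leb0_total x; rewrite (negPf x0) => /asboolP.
Qed.

Let ge0_normb x : leb 0 x -> normb x = x.
Proof. by rewrite /normb => ->. Qed.

HB.instance Definition _ := Num.IntegralDomain_isLeReal.Build R
  leb0_add leb0_mul leb0_anti leb_sub leb0_total normbN ge0_normb (fun _ _ => erefl).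

Lemma ordered_model_leE (x y : R) : (x <= y) <-> s_le (x : M) (y : M).
Proof. by rewrite -[x <= y]/(leb x y); split=> /asboolP. Qed.

Hypothesis Hq : quasi_real_closed M.

Let sqrt_ex (a : R) : 0 <= a -> exists b, a = b ^+ 2.
Proof. by case: Hq => + _ _ => sqr /ordered_model_leE/sqr[b ->]; exists b. Qed.

Let odd_root_ex (p : {poly R}) : ~~ odd (size p) -> p != 0 -> exists x, root p x.
Proof.
move=> sp p0; case: Hq => _ roots _.
apply: (@model_root p ((size p).-1./2).*2.+1); first exact: roots.
have : (0 < size p)%N by rewrite size_poly_gt0.
case: (size p) sp => //= n; rewrite negbK => n_odd _.
by rewrite -{1}(odd_double_half n) n_odd add1n.
Qed.

HB.instance Definition _ :=
  Num.RealField_isClosed.Build R (real_closed_of_roots sqrt_ex odd_root_ex).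

Lemma ordered_model_rcf (v : rel K) : (forall x y, v x y <-> s_lev x y) ->
    valuation_rel v -> (exists w, ~~ v w 1) ->
    (forall x y : K, s_le s_zero x -> s_le x y -> s_lev x y) ->
  exists (E : rcfType) (u : rel E), [/\ structure_of <=%R u = M,
    valuation_rel u, convex_rel u & exists w, ~~ u w 1].
Proof.
move=> vE vP nontriv conv; exists R, v; split=> //.
  by apply: structure_ofE => // x y; apply: ordered_model_leE.
by move=> x y /ordered_model_leE x0 /ordered_model_leE xy; apply/vE/conv.
Qed.
End Order.

Definition lev_rel : rel K := fun x y => `[< @s_lev M x y >].

Lemma lev_relP (G : ordered_group) (w : M -> option G) :
    is_quasi_order (@s_lev M) -> is_valuation w -> induced_by (@s_lev M) w ->
  valuation_rel lev_rel.
Proof.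
move=> [rxx rtrans rtotal r0 rM _] wP wv.
have [lev0 levD _] := valuation_quasi_order HM wP wv.
split.
- by move=> y x z /asboolP xy /asboolP yz; apply/asboolP/(rtrans _ _ _ xy yz).
- by move=> x y; apply/orP; case: (rtotal x y) => h; [left|right]; apply/asboolP.
- by move=> x; apply/asboolP.
- by move=> x /asboolP x0; apply: r0; split.
- by move=> x y z /asboolP xy; apply/asboolP; apply: rM.
- by move=> x y /asboolP xy; apply/asboolP; apply: levD.
Qed.

Lemma lev_rel_nontrivial (G : ordered_group) (w : M -> option G) :
    is_quasi_order (@s_lev M) -> is_valuation w -> induced_by (@s_lev M) w ->
    nontrivial_valuation w ->
  exists x, ~~ lev_rel x 1.
Proof.
move=> Hlev wP wv [a a0 a1]; have vP := lev_relP Hlev wP wv.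
have [_ _ lev1] := valuation_quasi_order HM wP wv.
(* If |a| is not 1, then [a] or its inverse has norm above 1. *)
have [a_le|] := boolP (lev_rel (a : K) 1); last by exists a.
exists (a : K)^-1; rewrite -[X in lev_rel _ X]invr1 (vinv vP) ?oner_eq0 //; last exact/eqP.
apply: contra_notN a1 => /asboolP le1; apply/lev1; split=> //.
exact/asboolP.
Qed.
End ModelField.

(** Extensionality gives equality of structures rather than isomorphism, so a model can simply be
    substituted. *)
Theorem QRC_model_cases (M : structure) : QRC_model M ->
  (exists (K : fieldType) (v : rel K), [/\ structure_of v v = M, valuation_rel v,
     exists w, ~~ v w 1
     & forall p : {poly K}, (1 < size p)%N -> exists x, root p x]) \/
  (exists (E : rcfType) (v : rel E), [/\ structure_of <=%R v = M,
     valuation_rel v, convex_rel v & exists w, ~~ v w 1]).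
Proof.
move=> [HM Hle Hq Hlev [G [w [wP w1 wv]]] pos neg].
have vP := lev_relP HM Hlev wP wv.
have nontriv := lev_rel_nontrivial HM Hlev wP wv w1.
have vE (x y : model_field HM) : @lev_rel M HM x y <-> s_lev (x : M) y.
  by split=> /asboolP.
have N1 : s_opp s_one <> s_zero :> M.
  move=> h; have /eqP : - (1 : model_field HM) = 0 by exact: h.
  by rewrite oppr_eq0 oner_eq0.
have anti0 (x : M) : asymp (@s_le M) x s_zero -> x = s_zero by case: Hle => _ _ _ + _ _; apply.
have total (x y : M) : s_le x y \/ s_le y x by case: Hle => _ _ + _ _ _; apply.
case: (total s_zero (s_opp s_one)) => h; last first.
  have neg1 : prec (@s_le M) (s_opp s_one) s_zero by split=> // /anti0.
  by right; apply: (ordered_model_rcf Hle neg1 Hq vE vP nontriv (neg neg1)).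
have pos1 : prec (@s_le M) s_zero (s_opp s_one) by split=> // -[h1 h2]; apply/N1/anti0.
(* Since |0| <= |x|, [pos] makes every element non-negative, and then identifies the two
   relations. *)
have lev0 (x : M) : s_lev s_zero x by apply/(vE 0 x)/(vrel_0 vP).
have le_pos (x : M) : s_le s_zero x by have [] := proj2 (pos pos1 s_zero x) (lev0 x).
have leE (x y : model_field HM) : @lev_rel M HM x y <-> s_le (x : M) y.
  rewrite vE -(pos pos1 x y); split=> [[]//|]; by split.
left; exists (model_field HM), (@lev_rel M HM); split=> //.
  exact: structure_ofE.
move=> p sp; case: Hq => _ _ closed; apply: (@model_root M HM p (size p).-1).
  case: (size p) sp => [//|[//|n]] _; apply: closed; exists G, w; split=> // x y.
  by rewrite -(wv x y) -(leE x y) -(vE x y).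
by rewrite prednK // ltnW.
Qed.

(** * Quantifier elimination *)

Section ExistsTransfer.
Variables (K L : fieldType) (leK vK : rel K) (leL vL : rel L).
Hypothesis leK_scale : forall x y c, c != 0 -> leK (x * c ^+ 2) (y * c ^+ 2) = leK x y.
Hypothesis leL_scale : forall x y c, c != 0 -> leL (x * c ^+ 2) (y * c ^+ 2) = leL x y.
Hypotheses (vKP : valuation_rel vK) (vLP : valuation_rel vL).

Definition compatible (F : fieldType) (i : {rmorphism F -> K}) (j : {rmorphism F -> L}) :=
  (forall a b, leK (i a) (i b) = leL (j a) (j b)) /\
  (forall a b, vK (i a) (i b) = vL (j a) (j b)).

Definition same_relations (F : fieldType) (i : {rmorphism F -> K}) (j : {rmorphism F -> L})
    (r : K) (s : L) (g h : {poly F}) :=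
  leK (map_poly i g).[r] (map_poly i h).[r] = leL (map_poly j g).[s] (map_poly j h).[s] /\
  vK (map_poly i g).[r] (map_poly i h).[r] = vL (map_poly j g).[s] (map_poly j h).[s].

Hypothesis algebraic_step :
  forall (F : fieldType) (i : {rmorphism F -> K}) (j : {rmorphism F -> L}),
    compatible i j -> forall (p : {poly F}) r, p != 0 -> root (map_poly i p) r ->
  exists s, forall g h, same_relations i j r s g h.

Hypothesis transcendental_step :
  forall (F : fieldType) (i : {rmorphism F -> K}) (j : {rmorphism F -> L}),
    compatible i j ->
    (forall (p : {poly F}) r, p != 0 -> root (map_poly i p) r -> exists a, r = i a) ->
  forall b (fs : seq {poly F}), (forall a, b != i a) ->
  exists b', {in fs &, forall g h, same_relations i j b b' g h}.

Local Notation M := (structure_of leK vK).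
Local Notation N := (structure_of leL vL).

Lemma exists_transfer (V : seq nat) (e : nat -> M) (e' : nat -> N) n g :
    (forall f, qf_over V f -> sat e f <-> sat e' f) ->
    quantifier_free g -> {subset free_vars (FEx n g) <= V} ->
  sat e (FEx n g) -> sat e' (FEx n g).
Proof.
move=> agree g_qf gV [b gb].
pose Q (x : K) (x' : L) := exists t, [/\ {subset term_vars t <= V},
  x = eval e t :> M & x' = eval e' t :> N].
have atom2 t u : {subset term_vars t <= V} -> {subset term_vars u <= V} ->
    {subset term_vars t ++ term_vars u <= V}.
  by move=> tV uV k; rewrite mem_cat => /orP[/tV|/uV].
have HQ : partial_hom leK vK leL vL Q.
  split.
  - by exists TOne.
  - move=> _ _ _ _ [t [tV -> ->]] [u [uV -> ->]].
    by exists (TAdd t (TOpp u)); split=> //; apply: atom2.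
  - move=> _ _ _ _ [t [tV -> ->]] [u [uV -> ->]].
    by exists (TMul t u); split=> //; apply: atom2.
  - move=> _ _ _ _ [t [tV -> ->]] [u [uV -> ->]].
    have tuV : qf_over V (FLe t u) by split=> //; apply: atom2.
    by apply/idP/idP => /(agree _ tuV).
  - move=> _ _ _ _ [t [tV -> ->]] [u [uV -> ->]].
    have tuV : qf_over V (FLev t u) by split=> //; apply: atom2.
    by apply/idP/idP => /(agree _ tuV).
have vscale (E : fieldType) (v : rel E) : valuation_rel v ->
    forall x y c, c != 0 -> v (x * c ^+ 2) (y * c ^+ 2) = v x y.
  by move=> vP x y c c0; rewrite (vmulr_mono vP) // expf_neq0.
have [F [i [j [QF leij vij Fmax]]]] := maximal_iso_field leK_scale leL_scale
  (vscale _ _ vKP) (vscale _ _ vLP) (vx0 vKP) (vx0 vLP) HQ.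
have compat : compatible i j by split.
have relF (p : {poly F}) r : p != 0 -> root (map_poly i p) r -> exists a, r = i a.
  by move=> p0 pr; have [s /Fmax] := algebraic_step compat p0 pr.
have catV (a c W : seq nat) : {subset a ++ c <= W} -> {subset a <= W} /\ {subset c <= W}.
  by move=> acW; split=> k kac; apply: acW; rewrite mem_cat kac ?orbT.
have term_poly t : {subset term_vars t <= n :: V} -> exists f : {poly F}, forall b b',
    eval (update e n b) t = (map_poly i f).[b] :> K /\
    eval (update e' n b') t = (map_poly j f).[b'] :> L.
  elim: t => [k||| t IHt|t IHt u IHu|t IHt u IHu] /= tV.
  - have [->|kn] := eqVneq k n.
      by exists 'X => x x'; rewrite !map_polyX !hornerX /update !eqxx.
    have kV : k \in V by have := tV k (mem_head _ _); rewrite inE (negPf kn).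
    have [|a [eE e'E]] := QF (e k) (e' k).
      by exists (TVar k); split=> // l; rewrite inE => /eqP->.
    by exists a%:P => x x'; rewrite !map_polyC !hornerC /update (negPf kn).
  - by exists 0 => x x'; rewrite !rmorph0 !hornerC.
  - by exists 1 => x x'; rewrite !rmorph1 !hornerC.
  - have [f fE] := IHt tV; exists (- f) => x x'; have [-> ->] := fE x x'.
    by rewrite !rmorphN !hornerN.
  - have [/IHt[f fE] /IHu[h hE]] := catV _ _ _ tV; exists (f + h) => x x'.
    by have [-> ->] := fE x x'; have [-> ->] := hE x x'; rewrite !rmorphD !hornerD.
  have [/IHt[f fE] /IHu[h hE]] := catV _ _ _ tV; exists (f * h) => x x'.
  by have [-> ->] := fE x x'; have [-> ->] := hE x x'; rewrite !rmorphM !hornerM.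
have qf_polys f : quantifier_free f -> {subset free_vars f <= n :: V} ->
    exists fs : seq {poly F}, forall b b', {in fs &, forall g h, same_relations i j b b' g h} ->
      sat (update e n b) f <-> sat (update e' n b') f.
  have two (f1 f2 : formula) (fs1 fs2 : seq {poly F}) :
      (forall b b', {in fs1 &, forall g h, same_relations i j b b' g h} ->
        sat (update e n b) f1 <-> sat (update e' n b') f1) ->
      (forall b b', {in fs2 &, forall g h, same_relations i j b b' g h} ->
        sat (update e n b) f2 <-> sat (update e' n b') f2) ->
      forall b b', {in fs1 ++ fs2 &, forall g h, same_relations i j b b' g h} ->
      (sat (update e n b) f1 <-> sat (update e' n b') f1) /\
      (sat (update e n b) f2 <-> sat (update e' n b') f2).
    move=> H1 H2 x x' H; split; [apply: H1|apply: H2] => p q p_in q_in;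
      by apply: H; rewrite mem_cat ?p_in ?q_in ?orbT.
  elim: f => [t u|t u|t u|f IHf|f IHf h IHh|f IHf h IHh|f IHf h IHh|//|//] /= f_qf fV.
  - have [/term_poly[p pE] /term_poly[q qE]] := catV _ _ _ fV.
    (* Equality is expressed by the valuation: only 0 has norm at most that of 0. *)
    exists [:: p - q; 0] => x x' H; have [-> ->] := pE x x'; have [-> ->] := qE x x'.
    have [_] : same_relations i j x x' (p - q) 0 by apply: H; rewrite !inE eqxx ?orbT.
    rewrite !rmorph0 !horner0 !rmorphB /= !hornerD !hornerN (vx0 vKP) (vx0 vLP) !subr_eq0.
    by move=> E; split=> [/(@eqP K)|/(@eqP L)]; [rewrite E => /(@eqP L)|rewrite -E => /(@eqP K)].
  - have [/term_poly[p pE] /term_poly[q qE]] := catV _ _ _ fV.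
    exists [:: p; q] => x x' H; have [-> ->] := pE x x'; have [-> ->] := qE x x'.
    by have [-> _] : same_relations i j x x' p q by apply: H; rewrite !inE eqxx ?orbT.
  - have [/term_poly[p pE] /term_poly[q qE]] := catV _ _ _ fV.
    exists [:: p; q] => x x' H; have [-> ->] := pE x x'; have [-> ->] := qE x x'.
    by have [_ ->] : same_relations i j x x' p q by apply: H; rewrite !inE eqxx ?orbT.
  - by have [fs fsP] := IHf f_qf fV; exists fs => x x' /fsP ->.
  - case/andP: f_qf => f_qf h_qf; have [/(IHf f_qf)[fs1 H1] /(IHh h_qf)[fs2 H2]] := catV _ _ _ fV.
    by exists (fs1 ++ fs2) => x x' /(two _ _ _ _ H1 H2)[-> ->].
  - case/andP: f_qf => f_qf h_qf; have [/(IHf f_qf)[fs1 H1] /(IHh h_qf)[fs2 H2]] := catV _ _ _ fV.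
    by exists (fs1 ++ fs2) => x x' /(two _ _ _ _ H1 H2)[-> ->].
  case/andP: f_qf => f_qf h_qf; have [/(IHf f_qf)[fs1 H1] /(IHh h_qf)[fs2 H2]] := catV _ _ _ fV.
  by exists (fs1 ++ fs2) => x x' /(two _ _ _ _ H1 H2)[-> ->].
have [fs fsP] : exists fs : seq {poly F}, forall b b',
    {in fs &, forall g h, same_relations i j b b' g h} ->
    sat (update e n b) g <-> sat (update e' n b') g.
  apply: qf_polys => // k kg; rewrite inE; have [//|kn] := eqVneq k n.
  by apply: gV; rewrite mem_filter kn.
suff [b' b'P] : exists b' : L, {in fs &, forall g h, same_relations i j b b' g h}.
  by exists b'; apply/(fsP b b').
have [[a ->]|bNF] := pselect (exists a, b = i a).
  by exists (j a) => p q _ _; rewrite /same_relations !horner_map leij vij.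
apply: (transcendental_step compat relF) => a.
by apply/eqP => ba; apply: bNF; exists a.
Qed.
End ExistsTransfer.

Lemma transfers_SigmaQRC : transfers_exists SigmaQRC.
Proof.
move=> M N /SigmaQRC_models MQ /SigmaQRC_models NQ V e e' agree.
(* The sign of -1 is a quantifier-free sentence, so both models fall into the same case. *)
have sign : @s_le M s_zero (s_opp s_one) <-> @s_le N s_zero (s_opp s_one).
  exact: (agree (FLe TZero (TOpp TOne))).
case: (QRC_model_cases MQ) (QRC_model_cases NQ) =>
    [[K [vK [KM vKP K1 closedK]]]|[K [vK [KM vKP convK K1]]]]
    [[L [vL [LN vLP L1 closedL]]]|[L [vL [LN vLP convL L1]]]];
  subst M N => /=.
- have vscale (E : fieldType) (v : rel E) : valuation_rel v ->
      forall x y c, c != 0 -> v (x * c ^+ 2) (y * c ^+ 2) = v x y.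
    by move=> vP x y c c0; rewrite (vmulr_mono vP) // expf_neq0.
  move=> n g; apply: (exists_transfer (vscale _ _ vKP) (vscale _ _ vLP) vKP vLP) agree.
  + move=> F i j [_ vij] p r p0 pr.
    have [s sP] := closed_algebraic_step vKP vLP vij closedK closedL p0 pr.
    by exists s => g' h; split; apply: sP.
  + move=> F i j [_ vij] relF b fs bNF.
    have closedF (p : {poly F}) : (1 < size p)%N -> exists x, root p x.
      move=> sp; have [|x px] := closedK (map_poly i p); first by rewrite size_map_poly.
      have p0 : p != 0 by rewrite -size_poly_gt0 ltnW.
      have [a aE] := relF p x p0 px; exists a.
      by move: px; rewrite aE /root horner_map fmorph_eq0.
    have [b' b'P] := closed_transcendental_step vKP vLP vij closedF closedL L1 fs bNF.
    by exists b' => f h f_in h_in; split; apply: b'P.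
- exfalso; have := proj1 sign (vrel_0 vKP _); rewrite /= oppr_ge0.
  by rewrite leNgt ltr01.
- exfalso; have := proj2 sign (vrel_0 vLP _); rewrite /= oppr_ge0.
  by rewrite leNgt ltr01.
have lescale (E : realFieldType) (x y c : E) : c != 0 ->
    (x * c ^+ 2 <= y * c ^+ 2) = (x <= y).
  by move=> c0; rewrite ler_pM2r // exprn_even_gt0.
move=> n g; apply: (exists_transfer (lescale K) (lescale L) vKP vLP) agree.
  move=> F i j [leij vij] p r p0 pr.
  exact: (real_algebraic_step vKP vLP convK convL leij vij p0 pr).
move=> F i j [leij vij] relF b fs bNF.
exact: (real_transcendental_step vKP vLP convK convL leij vij relF L1 fs bNF).
Qed.

Theorem theorem4p2 : admits_QE SigmaQRC.
Proof. exact: admits_QE_of_transfers transfers_SigmaQRC. Qed.
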